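(* Let $G$ be a $2$-connected outerplane graph of order $n$ whose internal faces all have length at most $q$. Then $$\pi(G) \leq \frac{n+5}{8}+\frac{q^2-4q+9}{8(n-1)}.$$
   Context: All graphs are finite, simple and connected. The order of a graph is its number of vertices. A graph is $2$-connected if it is connected, has at least three vertices, and remains connected after deletion of any single vertex. A graph is outerplanar if it can be embedded in the plane without edge crossings so that every vertex lies on the boundary of the exterior (unbounded) region; an outerplane graph is an outerplanar graph together with such an embedding. Internal faces are the faces other than the exterior one. In a $2$-connected outerplane graph each internal face is bounded by a cycle, whose length is the length of the face. For a connected graph $G$ of order $n\ge 2$ and $v\in V(G)$, let $\overline{\sigma}(v,G)=\frac{1}{n-1}\sum_{u\in V(G)} d_G(v,u)$, where $d_G$ is the shortest-path distance. The proximity of $G$ is $\pi(G)=\min_{v\in V(G)}\overline{\sigma}(v,G)$. *)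

(* Defs.v *)
From HB Require Import structures.
From mathcomp Require Import all_boot all_order all_algebra.
From mathcomp Require Import all_classical all_reals all_analysis.

Set Implicit Arguments.
Unset Strict Implicit.
Unset Printing Implicit Defensive.

Import Order.TTheory GRing.Theory Num.Theory.
Import numFieldNormedType.Exports.

Local Open Scope classical_set_scope.
Local Open Scope ring_scope.

Record sgraph := SGraph {
  vertex :> finType;
  adj : rel vertex;
  adj_sym : symmetric adj;
  adj_irrefl : irreflexive adj
}.

Arguments adj {s} _ _.

Definition connected_graph (G : sgraph) : Prop :=
  forall u v : G, connect adj u v.

Definition adj_avoiding (G : sgraph) (x : G) : rel G :=
  [rel u v | [&& u != x, v != x & adj u v]].

Definition two_connected (G : sgraph) : Prop :=
  [/\ connected_graph G, (2 < #|G|)%N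
    & forall x u v : G, u != x -> v != x -> connect (adj_avoiding x) u v].

(* There is a walk with k edges from u to v. *)
Definition has_walk (G : sgraph) (u v : G) (k : nat) : bool :=
  [exists p : k.-tuple G, path adj u p && (last u p == v)].

(* Least length of a walk from u to v; a shortest walk is a path, so it has
   length < #|G|.  The value is #|G| when u and v are not connected. *)
Definition dist (G : sgraph) (u v : G) : nat :=
  find (has_walk u v) (iota 0 #|G|).

Definition avg_dist (R : realType) (G : sgraph) (v : G) : R :=
  (\sum_(u : G) dist v u)%:R / (#|G|%:R - 1).

(* The infimum is over a finite set, nonempty as soon as G has a vertex, so it
   is a minimum. *)
Definition proximity (R : realType) (G : sgraph) : R :=
  inf (range (@avg_dist R G)).

(* A crossing-free drawing of G in the plane R * R.  Each edge uv is drawn as a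
   simple arc [earc u v], parametrised by [0, 1] and running from u to v; [earc u v]
   and [earc v u] trace the same set.  The interior of an arc contains no vertex
   and is disjoint from the interior of the arc of any other edge, so that
   distinct arcs meet only at common end vertices.  The values of [earc u v] for
   non-adjacent u, v, or outside [0, 1], are irrelevant. *)
Record plane_embedding (R : realType) (G : sgraph) := PlaneEmbedding {
  vpoint : G -> R * R;
  earc : G -> G -> R -> R * R;
  vpoint_inj : injective vpoint;
  arc_continuous : forall u v, adj u v -> {within `[0, 1], continuous (earc u v)};
  arc_inj : forall u v, adj u v -> set_inj `[0, 1] (earc u v);
  arc_start : forall u v, adj u v -> earc u v 0 = vpoint u;
  arc_end : forall u v, adj u v -> earc u v 1 = vpoint v;
  arc_rev : forall u v, adj u v -> earc v u @` `[0, 1] = earc u v @` `[0, 1];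
  arc_no_vertex : forall u v w, adj u v -> ~ (earc u v @` `]0, 1[) (vpoint w);
  arc_no_crossing : forall u v x y, adj u v -> adj x y ->
    [set u; v]%SET != [set x; y]%SET ->
    earc u v @` `]0, 1[ `&` earc x y @` `]0, 1[ = set0
}.

Definition edge_curve (R : realType) (G : sgraph) (E : plane_embedding R G)
    (u v : G) : set (R * R) :=
  earc E u v @` `[0, 1].

Definition drawing (R : realType) (G : sgraph) (E : plane_embedding R G) :
    set (R * R) :=
  range (vpoint E) `|`
  [set z | exists u v : G, adj u v /\ edge_curve E u v z].

Definition face (R : realType) (G : sgraph) (E : plane_embedding R G)
    (F : set (R * R)) : Prop :=
  exists2 z, ~ drawing E z & F = connected_component (~` drawing E) z.

Definition exterior_face (R : realType) (G : sgraph) (E : plane_embedding R G)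
    (F : set (R * R)) : Prop :=
  face E F /\ ~ bounded_set F.

Definition internal_face (R : realType) (G : sgraph) (E : plane_embedding R G)
    (F : set (R * R)) : Prop :=
  face E F /\ bounded_set F.

Definition boundary (R : realType) (A : set (R * R)) : set (R * R) :=
  closure A `\` interior A.

Definition outerplane (R : realType) (G : sgraph) (E : plane_embedding R G) :
    Prop :=
  exists2 F, exterior_face E F & forall v : G, boundary F (vpoint E v).

(* [c] lists the vertices of a cycle of G, in cyclic order and without
   repetition, and this cycle, as drawn by E, is the boundary of F. *)
Definition bounding_cycle (R : realType) (G : sgraph) (E : plane_embedding R G)
    (F : set (R * R)) (c : seq G) : Prop :=
  [/\ (2 < size c)%N, ucycle adj c
    & boundary F = [set z | exists2 x, x \in c & edge_curve E x (next c x) z]].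

Definition face_length (R : realType) (G : sgraph) (E : plane_embedding R G)
    (F : set (R * R)) (l : nat) : Prop :=
  exists2 c, bounding_cycle E F c & size c = l.

(* Main.v *)
(* Two points [p], [q] off a closed set [K] of the plane are not separated by [K]
   when [(z - p) / (z - q)] has a continuous argument on [K]. Such arguments always
   exist on an arc, and they glue along a connected intersection; hence an arc does
   not separate the plane, a simple closed curve has a bounded complementary
   component, and that component has the whole curve as its boundary. In an
   outerplane graph it follows that a chordless cycle bounds an internal face, so
   has length at most [q], and that no three internally disjoint paths with inner
   vertices join the same two vertices.

   The rest is combinatorial. Let a side of an edge [uv] be a set of vertices whose
   outside neighbours are among [u], [v]. By 2-connectedness its distance levels,
   except possibly the last, have at least two vertices, so [m] vertices on a side
   have distance sum to [u] at most about [m ^ 2 / 4]. If some edge has two sides of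
   comparable size, one of its ends has a small distance sum. Otherwise a central
   chordless cycle exists all of whose bridges are sides of its edges with
   [2 m + q < n], and the average of the distance sums over the cycle is small. *)
Require Import Defs.
From mathcomp Require Import all_boot all_order all_algebra.
From mathcomp Require Import all_classical all_reals all_analysis.
From mathcomp Require Import ring lra zify.
Import Order.TTheory GRing.Theory Num.Theory.
Local Open Scope ring_scope.

Set Implicit Arguments.
Unset Strict Implicit.
Unset Printing Implicit Defensive.

(** After multiplication by [8 * (n - 1)] the claim says that some vertex has a distance sum [s]
    with [8 * s <= n ^ 2 + 4 * n + (q - 2) ^ 2]. If two opposite sides of an edge have [m] and [m']
    vertices, so that [m + m' = n - 2], an end of the edge has distance sum about
    [(m ^ 2 + m' ^ 2) / 4], and [2 * (m ^ 2 + m' ^ 2)] equals [(n - 2) ^ 2 + (m - m') ^ 2]. Thus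
    [(q - 2) ^ 2] is the largest squared imbalance the bound can afford, and this is where the
    threshold [n <= 2 * m + q] between the two cases comes from.

    The drawing is passed on to the combinatorics as two facts: chordless cycles have length at most
    [q], and no three paths with inner vertices join the same two vertices. The complete graph on
    four vertices satisfies the second fact, because such paths need five vertices. It is also the
    only way in which a bridge of a triangle can be attached to all three vertices, so that the
    bridge is not a side of a cycle edge. For this reason order 4 is treated separately. *)

Section PlaneTopology.
Import numFieldNormedType.Exports.
Local Open Scope classical_set_scope.
Local Open Scope ring_scope.

(** * Arguments of plane vector fields *)

Section Rotation.
Context {R : realType}.
Implicit Types (x y : R * R) (t : R).

Definition turn t x : R * R :=
  (x.1 * cos t - x.2 * sin t, x.1 * sin t + x.2 * cos t).
Definition dotp x y : R := x.1 * y.1 + x.2 * y.2.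
Definition dilate (r : R) x : R * R := (r * x.1, r * x.2).

Lemma turnD t s x : turn t (turn s x) = turn (t + s) x.
Proof. by rewrite /turn /= sinD cosD; congr pair; ring. Qed.

Lemma turn0 x : turn 0 x = x.
Proof. by rewrite /turn cos0 sin0 [RHS]surjective_pairing; congr pair; ring. Qed.

Lemma turn_dilate t r x : turn t (dilate r x) = dilate r (turn t x).
Proof. by rewrite /turn /dilate /=; congr pair; ring. Qed.

Lemma dilateA r s x : dilate r (dilate s x) = dilate (r * s) x.
Proof. by rewrite /dilate /= !mulrA. Qed.

Lemma dilate1 x : dilate 1 x = x.
Proof. by rewrite /dilate !mul1r -surjective_pairing. Qed.

Lemma dotp_turn t x : dotp (turn t x) (turn t x) = dotp x x.
Proof.
rewrite /dotp /turn /=.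
have := cos2Dsin2 t.
set c := cos t; set s := sin t => h.
transitivity ((x.1 * x.1 + x.2 * x.2) * (c ^+ 2 + s ^+ 2)); first by ring.
by rewrite h mulr1.
Qed.

Lemma dotp_eq0 x : (dotp x x == 0) = (x == 0).
Proof.
rewrite /dotp -!expr2 paddr_eq0 ?sqr_ge0// !sqrf_eq0.
by case: x => a b; rewrite xpair_eqE.
Qed.

Lemma dotp_ge0 x : 0 <= dotp x x.
Proof. by rewrite /dotp -!expr2 addr_ge0 ?sqr_ge0. Qed.

Lemma dotp_gt0 x : (0 < dotp x x) = (x != 0).
Proof. by rewrite lt_neqAle dotp_ge0 andbT eq_sym dotp_eq0. Qed.

End Rotation.

Lemma withinP {T U : topologicalType} (K : set T) (f : T -> U) :
  {within K, continuous f} <->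
  forall x, K x -> f z @[z --> within K (nbhs x)] --> f x.
Proof. exact: subspace_continuousP. Qed.

Lemma within_eq {T U : topologicalType} (K : set T) (f g : T -> U) :
  (forall x, K x -> f x = g x) -> {within K, continuous f} -> {within K, continuous g}.
Proof.
by move=> fg; apply: subspace_eq_continuous => x /set_mem Kx; exact: fg.
Qed.

Section RotEquiv.
Context {R : realType} {T : topologicalType}.
Implicit Types (K L : set T) (f g h : T -> R * R).

(* On [K], [f / g] has a continuous argument: [f] and [g] are homotopic as maps
   into the punctured plane. *)
Definition rot_equiv K f g := exists2 th : T -> R,
  {within K, continuous th} &
  forall z, K z -> exists2 r, 0 < r & f z = dilate r (turn (th z) (g z)).

Lemma rot_equiv_refl K f : rot_equiv K f f.
Proof.
exists (fun=> 0); first by apply: continuous_subspaceT => x; exact: cvg_cst.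
by move=> z _; exists 1; rewrite // turn0 dilate1.
Qed.

Lemma rot_equiv_sym K f g : rot_equiv K f g -> rot_equiv K g f.
Proof.
move=> [th cth h]; exists (fun z => - th z).
  by move=> x; apply: cvgN; exact: cth.
move=> z /h[r r0 ->]; exists r^-1; first by rewrite invr_gt0.
by rewrite turn_dilate dilateA mulVf ?gt_eqF// dilate1 turnD addNr turn0.
Qed.

Lemma rot_equiv_trans K f g h :
  rot_equiv K f g -> rot_equiv K g h -> rot_equiv K f h.
Proof.
move=> [t ct ht] [s cs hs]; exists (fun z => t z + s z).
  by move=> x; apply: cvgD; [exact: ct|exact: cs].
move=> z Kz; have [r r0 ->] := ht z Kz; have [u u0 ->] := hs z Kz.
by exists (r * u); rewrite ?mulr_gt0// turn_dilate dilateA turnD.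
Qed.

Lemma rot_equiv_sub K L f g : L `<=` K -> rot_equiv K f g -> rot_equiv L f g.
Proof.
move=> LK [t ct ht]; exists t; first exact: continuous_subspaceW ct.
by move=> z /LK; exact: ht.
Qed.

(** The vectors always form an acute angle, so the argument of [f / g] is the arctangent of cross
    product over dot product, whose denominator never vanishes. *)
Lemma rot_equiv_dot K f g : {within K, continuous f} -> {within K, continuous g} ->
  (forall z, K z -> 0 < dotp (f z) (g z)) -> rot_equiv K f g.
Proof.
move=> cf cg h.
pose cr z := (g z).1 * (f z).2 - (g z).2 * (f z).1.
exists (fun z => atan (cr z / dotp (f z) (g z))).
  apply/withinP => x Kx.
  have cf1 : (f z).1 @[z --> within K (nbhs x)] --> (f x).1.
    exact: (cvg_comp _ _ ((withinP K f).1 cf x Kx) cvg_fst).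
  have cf2 : (f z).2 @[z --> within K (nbhs x)] --> (f x).2.
    exact: (cvg_comp _ _ ((withinP K f).1 cf x Kx) cvg_snd).
  have cg1 : (g z).1 @[z --> within K (nbhs x)] --> (g x).1.
    exact: (cvg_comp _ _ ((withinP K g).1 cg x Kx) cvg_fst).
  have cg2 : (g z).2 @[z --> within K (nbhs x)] --> (g x).2.
    exact: (cvg_comp _ _ ((withinP K g).1 cg x Kx) cvg_snd).
  have cq : cr z / dotp (f z) (g z) @[z --> within K (nbhs x)] --> cr x / dotp (f x) (g x).
    apply: cvgM; first by apply: cvgB; exact: cvgM.
    apply: cvgV; first by rewrite gt_eqF// h.
    by apply: cvgD; exact: cvgM.
  apply: (cvg_comp _ _ cq).
  exact: continuous_atan.
move=> z Kz; have := h z Kz; set d := dotp _ _ => d0.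
set a := atan _.
have c0 : 0 < cos a by apply: cos_gt0_pihalf; rewrite atan_gtNpi2 atan_ltpi2.
have sE : sin a = cos a * (cr z / d).
  have : tan a = cr z / d by rewrite /a atanK.
  by rewrite /tan => <-; field; rewrite gt_eqF.
have g0 : 0 < dotp (g z) (g z).
  rewrite dotp_gt0; apply: contraTneq d0 => gz.
  by rewrite /d gz /dotp !mulr0 addr0 ltxx.
exists (d / (cos a * dotp (g z) (g z))); first by rewrite divr_gt0// mulr_gt0.
rewrite [LHS]surjective_pairing /dilate /turn /= sE /cr.
have dE : d = (f z).1 * (g z).1 + (f z).2 * (g z).2 by [].
have gE : dotp (g z) (g z) = (g z).1 * (g z).1 + (g z).2 * (g z).2 by [].
move: d0 g0; rewrite dE gE => d0 g0.
by congr pair; field; rewrite !gt_eqF// .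
Qed.


Lemma connected_cos_eq1 K (th : T -> R) : connected K -> {within K, continuous th} ->
  (forall z, K z -> cos (th z) = 1) -> forall x y, K x -> K y -> th x = th y.
Proof.
move=> cK cth th1 x y Kx Ky.
wlog lt_xy : x y Kx Ky / th x < th y.
  by move=> W; have [l|l|//] := ltgtP (th x) (th y); [exact: W|rewrite (W y x)].
have /connected_intervalP itv := connected_continuous_connected cK cth.
(* By connectedness the value [th x + s] is attained; since [0 < s <= 1 <= pi], its cosine is
   smaller than 1. *)
pose s := Num.min 1 (th y - th x).
have s0 : 0 < s by rewrite lt_min ltr01 subr_gt0.
have s1 : s <= 1 by rewrite ge_min lexx.
have /itv : (th @` K) (th x) by exists x.
move=> /(_ (th y)) /(_ _ (th x + s)) [||z Kz zE].
- by exists y.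
- rewrite lerDl ltW//= -lerBrDl /s ge_min lexx orbT//.
have s_pi : s <= pi by rewrite (le_trans s1)// (le_trans _ (pi_ge2 R))// ler1n.
have := th1 z Kz; rewrite zE cosD th1// mul1r.
have -> : sin (th x) = 0 by apply: cos1sin0; rewrite th1// normr1.
rewrite mul0r subr0 => c1.
have : cos s < cos 0.
  by rewrite ltr_cos// in_itv/= ?lexx ?pi_ge0 ?(ltW s0).
by rewrite c1 cos0 ltxx.
Qed.

(** On the intersection both angles are arguments of the same quotient [f / g], so they differ by a
    multiple of [2 * pi], which is constant by connectedness. Shifting one angle by this constant
    makes them fit. *)
Lemma rot_equiv_glue K L f g : closed K -> closed L -> connected (K `&` L) ->
  (forall z, (K `&` L) z -> g z != 0) ->
  rot_equiv K f g -> rot_equiv L f g -> rot_equiv (K `|` L) f g.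
Proof.
move=> clK clL cKL g0 [t ct ht] [s cs hs].
have cos1 z : (K `&` L) z -> cos (t z - s z) = 1.
  move=> [Kz Lz]; have [r r0 fE] := ht z Kz; have [u u0] := hs z Lz.
  rewrite fE => /(congr1 (@turn R (- s z))); rewrite !turn_dilate !turnD addNr turn0.
  rewrite (addrC (- s z)) => e.
  have d0 : 0 < dotp (g z) (g z) by rewrite dotp_gt0 g0.
  have := congr1 (fun w => dotp w (g z)) e.
  have := congr1 (fun w => dotp w w) e.
  have sc (a : R) w w' : dotp (dilate a w) w' = a * dotp w w'.
    by rewrite /dotp /dilate /=; ring.
  have sc' (a : R) w w' : dotp w (dilate a w') = a * dotp w w'.
    by rewrite /dotp /dilate /=; ring.
  rewrite !sc !sc' dotp_turn !mulrA => /(mulIf (lt0r_neq0 d0)) /eqP.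
  rewrite -!expr2 eqrXn2 ?(ltW r0) ?(ltW u0)// => /eqP ->.
  have -> : dotp (turn (t z - s z) (g z)) (g z) = cos (t z - s z) * dotp (g z) (g z).
    by rewrite /dotp /turn /=; ring.
  rewrite mulrA => /(mulIf (lt0r_neq0 d0)) /eqP.
  by rewrite -[X in _ == X]mulr1 (inj_eq (mulfI (lt0r_neq0 u0))) => /eqP.
have ct' := continuous_subspaceW (@subIsetl _ K L) ct.
have cs' := continuous_subspaceW (@subIsetr _ K L) cs.
have cst : {within K `&` L, continuous (fun z => t z - s z)}.
  by move=> x; apply: cvgB; [exact: ct'|exact: cs'].
have const := connected_cos_eq1 cKL cst cos1.
have [k [k1 kE]] : exists k : R, cos k = 1 /\ forall z, (K `&` L) z -> t z - s z = k.
  have [[z0 Kz0]|/nonemptyPn e] := pselect (K `&` L !=set0).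
    by exists (t z0 - s z0); split; [exact: cos1|move=> z Kz; exact: const].
  by exists 0; rewrite cos0; split => // z; rewrite e.
pose th z := if z \in K then t z else s z + k.
exists th.
  apply: withinU_continuous => //.
    by apply: within_eq ct => z Kz; rewrite /th mem_set.
  apply: (@within_eq _ _ L (fun z => s z + k)).
    move=> z Lz; rewrite /th; case: ifPn => // /set_mem Kz.
    by rewrite -(kE z)// addrC subrK.
  by move=> x; apply: cvgD; [exact: cs|exact: cvg_cst].
move=> z; rewrite /th; case: ifPn => [/set_mem/ht//|/negP zK [/mem_set//|/hs]].
move=> [r r0 ->]; exists r => //; congr dilate.
have k0 : sin k = 0 by apply: cos1sin0; rewrite k1 normr1.
by rewrite /turn cosD sinD k1 k0 !mulr1 !mulr0 subr0 addr0.
Qed.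

End RotEquiv.

(** * Points that a closed set or an arc does not separate *)

Section Plane.
Context {R : realType}.
Implicit Types (p q x y z : R * R) (K L V : set (R * R)).

(** [P] and its negation both hold on relatively open parts of [A], so one of these parts is
    empty. *)
Lemma connected_ind {T : topologicalType} (A : set T) (P : T -> Prop) :
  connected A -> (forall x : T, A x -> \forall y \near x, A y -> (P y <-> P x)) ->
  forall x y : T, A x -> A y -> P x -> P y.
Proof.
move=> cA loc x y Ax Ay Px.
suff : A `&` [set z | P z] = A by move=> /seteqP[_ /(_ y Ay)[]].
apply: cA; first by exists x.
- exists (interior [set z | A z -> P z]); first exact: open_interior.
  apply/seteqP; split=> z [Az Pz]; split=> //; last exact: (interior_subset Pz).
  by apply: filterS (loc z Az) => w h Aw; apply/h.
- exists (~` interior [set z | A z -> ~ P z]).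
    exact/open_closedC/open_interior.
  apply/seteqP; split=> z [Az Pz]; split=> //; first by move=> /interior_subset/(_ Az).
  apply: contrapT => nPz; case: Pz.
  by apply: filterS (loc z Az) => w h Aw /(h Aw).
Qed.

Lemma ball_planeE p e z : ball p e z <-> `|p.1 - z.1| < e /\ `|p.2 - z.2| < e.
Proof. by []. Qed.

Lemma compact_closed_plane K : compact K -> closed K.
Proof. by apply: compact_closed; exact: norm_hausdorff. Qed.

(** The open disc about [x] through the origin contains only vectors at an acute angle with [x]. *)
Lemma dotp_close x y : dotp (x - y) (x - y) < dotp x x -> 0 < dotp x y.
Proof.
case: x y => [a b] [c d]; rewrite /dotp /=.
have := sqr_ge0 c; have := sqr_ge0 d; nra.
Qed.

(** Acute angles are immediate, obtuse ones go through the half turn [- x], and right ones through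
    the diagonal [x + y]. *)
Lemma rot_equiv_cst {T : topologicalType} (K : set T) x y : x != 0 -> y != 0 ->
  rot_equiv K (fun=> x) (fun=> y).
Proof.
have pos x1 y1 : 0 < dotp x1 y1 -> rot_equiv K (fun=> x1) (fun=> y1).
  by move=> h; apply: rot_equiv_dot => // w; exact: cvg_cst.
move=> x0 y0.
have [l|l|l] := ltgtP 0 (dotp x y).
- exact: pos.
- apply: (@rot_equiv_trans _ _ _ _ (fun=> - x)); last first.
    by apply: pos; move: l; rewrite /dotp /=; lra.
  exists (fun=> pi); first by move=> w; exact: cvg_cst.
  move=> z _; exists 1; rewrite // dilate1 /turn /= cospi sinpi.
  by case: x {x0 l} => a b /=; congr pair; ring.
- apply: (@rot_equiv_trans _ _ _ _ (fun=> x + y)); apply: pos.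
    by have := dotp_gt0 x; rewrite x0; move: l; rewrite /dotp /=; lra.
  by have := dotp_gt0 y; rewrite y0; move: l; rewrite /dotp /=; lra.
Qed.

Definition unseparated K p q := rot_equiv K (fun z => z - p) (fun z => z - q).

Lemma continuous_subr K p : {within K, continuous (fun z => z - p)}.
Proof. by apply: continuous_subspaceT => z; apply: cvgB; [exact: cvg_id|exact: cvg_cst]. Qed.

Lemma unseparated_connected K V p q : closed K -> connected V -> V `&` K = set0 ->
  V p -> V q -> unseparated K p q.
Proof.
move=> clK cV VK Vp Vq.
apply: (connected_ind cV) (Vp) (Vq) (rot_equiv_refl K _) => {q Vq} q Vq.
have nKq : (~` K) q by move=> Kq; have : (V `&` K) q by []; rewrite VK.
have /nbhs_ballP[e /= e0 qe] := open_nbhs_nbhs (conj (closed_openC clK) nKq).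
(* Balls of the product norm are squares: [q'] is at squared Euclidean distance less than
   [e ^ 2 / 2] from [q], points of [K] at least [e ^ 2]. So [z - q] and [z - q'] form an acute angle
   for every [z] in [K]. *)
apply/nbhs_ballP; exists (e / 2) => /=; first by rewrite divr_gt0.
move=> q' /ball_planeE[h1 h2] _.
suff E : unseparated K q q'.
  by split => h; apply: rot_equiv_trans h _ => //; exact: rot_equiv_sym.
apply: rot_equiv_dot; [exact: continuous_subr|exact: continuous_subr|].
move=> z Kz; apply: dotp_close.
have /(_ z) /= := qe; rewrite ball_planeE => nb.
have {}nb : ~ (`|q.1 - z.1| < e /\ `|q.2 - z.2| < e) by move=> /nb.
rewrite (_ : z - q - (z - q') = q' - q); last by rewrite opprB addrC addrA addrNK.
have e2 : 0 <= e / 2 by rewrite divr_ge0// ltW.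
have d1 : (q'.1 - q.1) ^+ 2 < (e / 2) ^+ 2.
  by rewrite -[ltLHS]real_normK ?num_real// distrC ltr_sqr// nnegrE.
have d2 : (q'.2 - q.2) ^+ 2 < (e / 2) ^+ 2.
  by rewrite -[ltLHS]real_normK ?num_real// distrC ltr_sqr// nnegrE.
have d3 : e ^+ 2 <= (z.1 - q.1) ^+ 2 \/ e ^+ 2 <= (z.2 - q.2) ^+ 2.
  have [l1|l1] := ltP `|q.1 - z.1| e; last first.
    by left; rewrite -[leRHS]real_normK ?num_real// distrC ler_sqr// nnegrE ltW.
  have [l2|l2] := ltP `|q.2 - z.2| e; first by case: nb.
  by right; rewrite -[leRHS]real_normK ?num_real// distrC ler_sqr// nnegrE ltW.
have := sqr_ge0 (z.1 - q.1); have := sqr_ge0 (z.2 - q.2); have := sqr_ge0 e.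
by rewrite /dotp /=; case: d3; nra.
Qed.

Lemma image_itv_compact (g : R -> R * R) a b s t : {within `[a, b], continuous g} ->
  a <= s -> t <= b -> compact (g @` `[s, t]).
Proof.
move=> cg as_ tb; apply: continuous_compact; last exact: segment_compact.
by apply: continuous_subspaceW cg; apply: subset_itv; rewrite ?bnd_simp.
Qed.

(** The property is propagated along the parameter interval. A short subarc stays in an open half
    plane as seen from [p] and from [q], and by injectivity it meets the preceding part only in the
    point [g s], so the angles glue. *)
Lemma arc_unseparated (g : R -> R * R) a b p q : {within `[a, b], continuous g} ->
  set_inj `[a, b] g -> a <= b -> ~ (g @` `[a, b]) p -> ~ (g @` `[a, b]) q ->
  unseparated (g @` `[a, b]) p q.
Proof.
move=> cg ig ab np nq.
pose P t := unseparated (g @` `[a, t]) p q.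
have small t0 : a <= t0 <= b -> exists2 e : R, 0 < e &
    forall s t, a <= s -> s <= t -> t <= b -> `|t0 - s| < e -> `|t0 - t| < e ->
      unseparated (g @` `[s, t]) p q.
  move=> t0ab; set z0 := g t0.
  have near0 w : ~ (g @` `[a, b]) w ->
      \forall t \near t0, `[a, b]%classic t -> 0 < dotp (g t - w) (z0 - w).
    move=> nw.
    have g0 : g t @[t --> within `[a, b] (nbhs t0)] --> z0.
      by apply: (withinP _ _).1 => //; rewrite /= in_itv/=.
    have g1 := cvg_comp _ _ g0 cvg_fst.
    have g2 := cvg_comp _ _ g0 cvg_snd.
    have d : dotp (g t - w) (z0 - w) @[t --> within `[a, b] (nbhs t0)] -->
        dotp (z0 - w) (z0 - w).
      by apply: cvgD; (apply: cvgM; last exact: cvg_cst);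
         (apply: cvgB; last exact: cvg_cst); [exact: g1|exact: g2].
    apply: (cvgr_gt _ d).
    rewrite dotp_gt0 subr_eq0; apply/eqP => zw; apply: nw.
    by exists t0 => //=; rewrite in_itv.
  have /nbhs_ballP[e /= e0 he] := @filterI _ _ (nbhs_filter t0) _ _ (near0 p np) (near0 q nq).
   exists e => // s t as_ st tb hs ht.
  have {}he r : s <= r <= t -> 0 < dotp (g r - p) (z0 - p) /\ 0 < dotp (g r - q) (z0 - q).
    move=> /andP[sr rt].
    have ab_r : `[a, b]%classic r by rewrite /= in_itv/= (le_trans as_ sr) (le_trans rt).
    have [] := he r; last by move=> h1 h2; split; [exact: h1|exact: h2].
    by rewrite /ball /=; move: hs ht; rewrite !ltr_norml; lra.
  have ne w : ~ (g @` `[a, b]) w -> z0 - w != 0.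
    by rewrite subr_eq0 => nw; apply/eqP => zw; apply: nw; exists t0 => //=; rewrite in_itv.
  have step w : (forall r, s <= r <= t -> 0 < dotp (g r - w) (z0 - w)) ->
      rot_equiv (g @` `[s, t]) (fun z => z - w) (fun=> z0 - w).
    move=> h; apply: rot_equiv_dot; first exact: continuous_subr.
      by apply: continuous_subspaceT => z; exact: cvg_cst.
    by move=> _ [r /= + <-]; rewrite in_itv/=; exact: h.
  apply: rot_equiv_trans (step p _) _; first by move=> r /he[].
  apply: rot_equiv_trans (rot_equiv_sym (step q _)); last by move=> r /he[].
  exact: rot_equiv_cst (ne _ np) (ne _ nq).
suff loc t0 : `[a, b]%classic t0 -> \forall t \near t0, `[a, b]%classic t -> (P t <-> P t0).
  have ca : `[a, b]%classic a by rewrite /= in_itv/= lexx.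
  have cb : `[a, b]%classic b by rewrite /= in_itv/= lexx andbT.
  apply: (connected_ind (@segment_connected _ a b) loc ca cb).
  have [|e e0] := small a; first by rewrite lexx.
  by move=> /(_ a a); apply; rewrite ?subrr ?normr0.
move=> /=; rewrite in_itv/= => t0ab.
have [e e0 he] := small t0 t0ab.
have key s t : a <= s -> s <= t -> t <= b -> `|t0 - s| < e -> `|t0 - t| < e -> P s <-> P t.
  move=> as_ st tb hs ht.
  have cup : g @` `[a, t] = g @` `[a, s] `|` g @` `[s, t].
    rewrite -image_setU; congr image; apply/seteqP; split=> r /=; rewrite !in_itv/=.
      by move=> /andP[h1 h2]; have /orP[h|h] := le_total r s; [left|right]; apply/andP.
    by case=> /andP[h1 h2]; apply/andP; split; lra.
  split; last by apply: rot_equiv_sub; rewrite cup; left.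
  rewrite /P cup => Ps; apply: rot_equiv_glue => //; last exact: he.
  - by apply: compact_closed_plane; apply: image_itv_compact cg _ _ => //; exact: le_trans st tb.
  - by apply: compact_closed_plane; exact: image_itv_compact cg _ _.
  - rewrite (_ : _ `&` _ = [set g s]); first exact: connected1.
    apply/seteqP; split=> [z [[r1 + <-] [r2 + e12]]|_ ->] /=.
      rewrite /= !in_itv/= => /andP[a1 a2] /andP[b1 b2].
      have r21 : r2 = r1.
        by apply: ig => //; rewrite inE/= in_itv/=; apply/andP; split; lra.
      by congr (g _); apply/eqP; rewrite eq_le a2 -r21 b1.
    by split; exists s; rewrite //= in_itv/= ?as_ ?lexx ?st.
  - move=> z [_ [r + <-]]; rewrite subr_eq0 /= in_itv/= => /andP[sr rt].
    apply/eqP => gq; apply: nq; exists r => //=; rewrite in_itv/=.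
    by rewrite (le_trans as_ sr) (le_trans rt tb).
apply/nbhs_ballP; exists e => // t; rewrite /ball/= => ht /andP[a_t tb].
have /andP[a0 b0] := t0ab.
have h0 : `|t0 - t0| < e by rewrite subrr normr0.
by case: (leP t t0) => [h|/ltW h]; [exact: key|apply: iff_sym; exact: key].
Qed.

End Plane.

(** * Curves that wind around a point *)

Section Winding.
Context {R : realType}.

Lemma cos_gt0_bound (y : R) : 0 < cos y -> `|y| < pi / 2 + pi -> `|y| < pi / 2.
Proof.
rewrite -(cos_norm y); move: `|y| (normr_ge0 y) => {}y y0 c h; rewrite ltNge.
apply/negP => y2; move: c; apply/negP; rewrite -leNgt.
rewrite -(subrK pi y) cosDpi oppr_le0.
by apply: cos_ge0_pihalf; have := pi_gt0 R; lra.
Qed.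

(** To leave the branch around [phi] the angle would have to take the value [phi + pi / 2] or
    [phi - pi / 2], where the cosine vanishes. *)
Lemma angle_branch (T : topologicalType) (X : set T) (th : T -> R) (phi : R) x0 :
  connected X -> {within X, continuous th} ->
  (forall x, X x -> 0 < cos (th x - phi)) -> X x0 -> `|th x0 - phi| < pi / 2 ->
  forall x, X x -> `|th x - phi| < pi / 2.
Proof.
move=> cX ct c Xx0 h0 x Xx.
have /connected_intervalP itv := connected_continuous_connected cX ct.
have hi y : X y -> th y != phi + pi / 2 /\ th y != phi - pi / 2.
  move=> Xy; have := c y Xy => H; split; apply/eqP => e; move: H; rewrite e.
    by rewrite addrC addKr cos_pihalf ltxx.
  by rewrite addrC addKr cosN cos_pihalf ltxx.
have im y : X y -> (th @` X) (th y) by move=> Xy; exists y.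
move: h0; rewrite !ltr_norml => /andP[l0 r0]; apply/andP; split.
  rewrite ltNge; apply/negP => l.
  have [|z Xz zE] := itv _ _ (im x Xx) (im x0 Xx0) (phi - pi / 2); first by apply/andP; split; lra.
  by have [_] := hi z Xz; rewrite zE eqxx.
rewrite ltNge; apply/negP => l.
have [|z Xz zE] := itv _ _ (im x0 Xx0) (im x Xx) (phi + pi / 2); first by apply/andP; split; lra.
by have [] := hi z Xz; rewrite zE eqxx.
Qed.

(* The four open half planes through [s] are visited in counterclockwise order,
   so a continuous argument of [z - s] would grow by [2 pi] along the way. *)
Lemma winding_nonzero (K X1 X2 X3 X4 : set (R * R)) (s u : R * R) :
  u != 0 ->
  X1 `<=` K -> X2 `<=` K -> X3 `<=` K -> X4 `<=` K ->
  connected X1 -> connected X2 -> connected X3 -> connected X4 ->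
  (forall z, X1 z -> s.2 < z.2) -> (forall z, X2 z -> z.1 < s.1) ->
  (forall z, X3 z -> z.2 < s.2) -> (forall z, X4 z -> s.1 < z.1) ->
  X1 `&` X2 !=set0 -> X2 `&` X3 !=set0 -> X3 `&` X4 !=set0 -> X4 `&` X1 !=set0 ->
  ~ rot_equiv K (fun z => z - s) (fun=> u).
Proof.
move=> u0 K1 K2 K3 K4 c1 c2 c3 c4 h1 h2 h3 h4 [a [a1 a2]] [b [b2 b3]] [c [c3' c4']] [d [d4 d1]].
have e0 : ((1, 0) : R * R) != 0 by rewrite xpair_eqE negb_and oner_eq0.
move=> /rot_equiv_trans /(_ (rot_equiv_cst K u0 e0)) [th ct ht].
have {}ht z : K z -> exists2 r, 0 < r & z.1 - s.1 = r * cos (th z) /\ z.2 - s.2 = r * sin (th z).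
  move=> /ht[r r0 e]; exists r => //.
  have := congr1 fst e; have := congr1 snd e; rewrite /turn /dilate /= => -> ->.
  by rewrite !mul1r !mul0r subr0 addr0.
have s1 z : X1 z -> 0 < sin (th z).
  move=> Xz; have [r r0 [_ e]] := ht z (K1 _ Xz).
  by have := h1 z Xz; rewrite -subr_gt0 e pmulr_rgt0.
have s2 z : X2 z -> cos (th z) < 0.
  move=> Xz; have [r r0 [e _]] := ht z (K2 _ Xz).
  by have := h2 z Xz; rewrite -subr_lt0 e pmulr_rlt0.
have s3 z : X3 z -> sin (th z) < 0.
  move=> Xz; have [r r0 [_ e]] := ht z (K3 _ Xz).
  by have := h3 z Xz; rewrite -subr_lt0 e pmulr_rlt0.
have s4 z : X4 z -> 0 < cos (th z).
  move=> Xz; have [r r0 [e _]] := ht z (K4 _ Xz).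
  by have := h4 z Xz; rewrite -subr_gt0 e pmulr_rgt0.
(* [phi] is the number congruent to [pi / 2] modulo [2 * pi] that is closest to [th a]; it is the
   centre of the branch for the upper half plane. Each later half plane moves the centre by
   [pi / 2]. *)
have [phi [cphi sphi pa]] : exists phi : R,
    [/\ cos phi = 0, sin phi = 1 & `|th a - phi| < pi / 2].
  set t := th a; have st := s1 a a1; pose al := atan (- cos t / sin t).
  have ca : 0 < cos al by apply: cos_gt0_pihalf; rewrite atan_gtNpi2 atan_ltpi2.
  have sE : sin al = cos al * (- cos t / sin t).
    have <- : tan al = - cos t / sin t by rewrite atanK.
    by rewrite /tan; field; rewrite gt_eqF.
  have cE : cos al = sin t.
    apply/eqP; rewrite -(eqrXn2 (n := 2))// ?ltW//; apply/eqP.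
    have := cos2Dsin2 al; rewrite sE => e1.
    have e2 := cos2Dsin2 t.
    have : cos al ^+ 2 * (sin t ^+ 2 + cos t ^+ 2) = sin t ^+ 2.
      rewrite -[RHS]mulr1 -e1; field; rewrite gt_eqF//.
    by rewrite addrC e2 mulr1.
  have {}sE : sin al = - cos t by rewrite sE cE; field; rewrite gt_eqF.
  exists (t - al); split.
  - by rewrite cosB cE sE; ring.
  - by rewrite sinB cE sE -(cos2Dsin2 t); ring.
  - by rewrite opprB addrC subrK ltr_norml atan_gtNpi2 atan_ltpi2.
have c_phi (t : R) : cos (t - phi) = sin t by rewrite cosB cphi sphi; ring.
have s_phi (t : R) : sin (t - phi) = - cos t by rewrite sinB cphi sphi; ring.
have sub (X : set (R * R)) : X `<=` K -> {within X, continuous th}.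
  by move=> XK; exact: continuous_subspaceW ct.
pose p2 : R := phi + pi / 2.
pose p3 : R := p2 + pi / 2.
pose p4 : R := p3 + pi / 2.
have e2 (t : R) : cos (t - p2) = - cos t.
  by rewrite /p2 opprD addrA cosBpihalf s_phi.
have se2 (t : R) : sin (t - p2) = - sin t.
  by rewrite /p2 opprD addrA sinBpihalf c_phi.
have e3 (t : R) : cos (t - p3) = - sin t.
  by rewrite /p3 opprD addrA cosBpihalf se2.
have se3 (t : R) : sin (t - p3) = cos t.
  by rewrite /p3 opprD addrA sinBpihalf e2 opprK.
have e4 (t : R) : cos (t - p4) = cos t.
  by rewrite /p4 opprD addrA cosBpihalf se3.
have step (t f : R) : `|t - f| < pi / 2 -> 0 < cos (t - (f + pi / 2)) ->
    `|t - (f + pi / 2)| < pi / 2.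
  move=> tf h; apply: (cos_gt0_bound h).
  by move: tf; rewrite !ltr_norml; have := pi_gt0 R; lra.
have A1 := angle_branch c1 (sub _ K1) _ a1 pa.
have {}A1 x : X1 x -> `|th x - phi| < pi / 2.
  by apply: A1 => z /s1; rewrite c_phi.
have H2 z : X2 z -> 0 < cos (th z - p2) by move=> /s2; rewrite e2 oppr_gt0.
have A2 := angle_branch c2 (sub _ K2) H2 a2 (step _ _ (A1 a a1) (H2 a a2)).
have H3 z : X3 z -> 0 < cos (th z - p3) by move=> /s3; rewrite e3 oppr_gt0.
have A3 := angle_branch c3 (sub _ K3) H3 b3 (step _ _ (A2 b b2) (H3 b b3)).
have H4 z : X4 z -> 0 < cos (th z - p4) by move=> /s4; rewrite e4.
have A4 := angle_branch c4 (sub _ K4) H4 c4' (step _ _ (A3 c c3') (H4 c c4')).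
(* The point [d] closes the tour: its single angle would lie within [pi / 2] of both [phi] and
   [phi + 3 * pi / 2]. *)
have := A4 d d4; have := A1 d d1; rewrite !ltr_norml /p4 /p3 /p2; have := pi_gt0 R; lra.
Qed.

End Winding.

(** * The separation criterion *)

Lemma cvg_pt (T : Type) (U V : topologicalType) (F : set_system T) {FF : Filter F}
    (f : T -> U) (g : T -> V) (a : U) (b : V) :
  f x @[x --> F] --> a -> g x @[x --> F] --> b -> (f x, g x) @[x --> F] --> (a, b).
Proof. by move=> fa gb; exact: (cvg_pair fa gb). Qed.

Section Square.
Context {R : realType}.
Implicit Types (p q x y z : R * R) (K U : set (R * R)).

Definition hseg (a b y : R) : set (R * R) := (fun t => (t, y)) @` `[a, b].
Definition vseg (a b x : R) : set (R * R) := (fun t => (x, t)) @` `[a, b].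

Lemma hsegP a b c z : hseg a b c z <-> [/\ a <= z.1, z.1 <= b & z.2 = c].
Proof.
split=> [[t + <-]|[h1 h2 h3]]; first by rewrite /= in_itv/= => /andP[].
by exists z.1; rewrite /= ?in_itv/= ?h1// [RHS]surjective_pairing h3.
Qed.

Lemma vsegP a b c z : vseg a b c z <-> [/\ a <= z.2, z.2 <= b & z.1 = c].
Proof.
split=> [[t + <-]|[h1 h2 h3]]; first by rewrite /= in_itv/= => /andP[].
by exists z.2; rewrite /= ?in_itv/= ?h1// [RHS]surjective_pairing h3.
Qed.

Lemma continuous_hline (c : R) : continuous (fun t : R => (t, c)).
Proof. by move=> t; apply: cvg_pt; [exact: cvg_id|exact: cvg_cst]. Qed.

Lemma continuous_vline (c : R) : continuous (fun t : R => (c, t)).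
Proof. by move=> t; apply: cvg_pt; [exact: cvg_cst|exact: cvg_id]. Qed.

Lemma hseg_connected a b c : connected (hseg a b c).
Proof.
apply: connected_continuous_connected; first exact: segment_connected.
by apply: continuous_subspaceT; exact: continuous_hline.
Qed.

Lemma vseg_connected a b c : connected (vseg a b c).
Proof.
apply: connected_continuous_connected; first exact: segment_connected.
by apply: continuous_subspaceT; exact: continuous_vline.
Qed.

Lemma hseg_compact a b c : compact (hseg a b c).
Proof.
apply: continuous_compact; last exact: segment_compact.
by apply: continuous_subspaceT; exact: continuous_hline.
Qed.

Lemma vseg_compact a b c : compact (vseg a b c).
Proof.
apply: continuous_compact; last exact: segment_compact.
by apply: continuous_subspaceT; exact: continuous_vline.
Qed.

(** The boundary only, its sides listed in the counterclockwise order top, left, bottom, right used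
    by [winding_nonzero]. *)
Definition square p (M : R) : set (R * R) :=
  hseg (p.1 - M) (p.1 + M) (p.2 + M) `|` vseg (p.2 - M) (p.2 + M) (p.1 - M) `|`
  hseg (p.1 - M) (p.1 + M) (p.2 - M) `|` vseg (p.2 - M) (p.2 + M) (p.1 + M).

Lemma square_compact p M : compact (square p M).
Proof.
by do 3 ?apply: compactU; (exact: hseg_compact || exact: vseg_compact).
Qed.

Lemma square_out p M z : square p M z -> `|z.1 - p.1| = `|M| \/ `|z.2 - p.2| = `|M|.
Proof.
case=> [[[]|]|] => [/hsegP|/vsegP|/hsegP|/vsegP] [_ _ ->]; [right|left|right|left];
  by rewrite addrC addKr ?normrN.
Qed.

Lemma square_winding p M u : 0 < M -> u != 0 ->
  ~ rot_equiv (square p M) (fun z => z - p) (fun=> u).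
Proof.
move=> M0 u0.
apply: (@winding_nonzero _ _ (hseg (p.1 - M) (p.1 + M) (p.2 + M))
  (vseg (p.2 - M) (p.2 + M) (p.1 - M)) (hseg (p.1 - M) (p.1 + M) (p.2 - M))
  (vseg (p.2 - M) (p.2 + M) (p.1 + M))) => //.
- by move=> z h; do 3 left.
- by move=> z h; do 2 left; right.
- by move=> z h; left; right.
- by move=> z h; right.
- exact: hseg_connected.
- exact: vseg_connected.
- exact: hseg_connected.
- exact: vseg_connected.
- by move=> z /hsegP[_ _ ->]; lra.
- by move=> z /vsegP[_ _ ->]; lra.
- by move=> z /hsegP[_ _ ->]; lra.
- by move=> z /vsegP[_ _ ->]; lra.
- by exists (p.1 - M, p.2 + M); split; [apply/hsegP|apply/vsegP]; split=> //=; lra.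
- by exists (p.1 - M, p.2 - M); split; [apply/vsegP|apply/hsegP]; split=> //=; lra.
- by exists (p.1 + M, p.2 - M); split; [apply/hsegP|apply/vsegP]; split=> //=; lra.
- by exists (p.1 + M, p.2 + M); split; [apply/vsegP|apply/hsegP]; split=> //=; lra.
Qed.

(** Contracting the plane to [p] deforms [h] into the constant [h p] without creating zeros. By
    compactness of [K], a small step of the deformation turns every vector by less than a right
    angle. *)
Lemma nonvanishing_rot_equiv K p (h : R * R -> R * R) : compact K -> continuous h ->
  (forall z, h z != 0) -> rot_equiv K h (fun=> h p).
Proof.
move=> cK ch h0.
pose H t z := h (p + dilate t (z - p)).
have H1 : H 1 = h by apply/funext => z; rewrite /H dilate1 addrC subrK.
have H0 : H 0 = fun=> h p.
  by apply/funext => z; rewrite /H /dilate !mul0r; congr h; exact: addr0.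
rewrite -H0 -[X in rot_equiv _ X _]H1.
have cH : continuous (fun w : R * (R * R) => H w.1 w.2).
  move=> w; apply: continuous_comp; last exact: ch.
  apply: cvgD; first exact: cvg_cst.
  have w1 : x.1 @[x --> w] --> w.1 by exact: cvg_fst.
  have w2 : x.2 @[x --> w] --> w.2 by exact: cvg_snd.
  have w21 : x.2.1 @[x --> w] --> w.2.1 by exact: (cvg_comp _ _ w2 cvg_fst).
  have w22 : x.2.2 @[x --> w] --> w.2.2 by exact: (cvg_comp _ _ w2 cvg_snd).
  by apply: cvg_pt; (apply: cvgM; first exact: w1); (apply: cvgB; last exact: cvg_cst).
have cHt t : continuous (H t).
  move=> z.
  have E : (t, w) @[w --> z] --> (t, z) by apply: cvg_pt; [exact: cvg_cst|exact: cvg_id].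
  exact: (cvg_comp _ _ E (cH (t, z))).
have i0 : `[0 : R, 1]%classic 0 by rewrite /= in_itv/= lexx ler01.
have i1 : `[0 : R, 1]%classic 1 by rewrite /= in_itv/= lexx ler01.
apply: (@connected_ind _ _ (fun t => rot_equiv K (H t) (H 0)) (@segment_connected R 0 1) _
  _ _ i0 i1 (rot_equiv_refl _ _)).
move=> t0 _.
have : \forall t \near t0, K `<=` (fun z => 0 < dotp (H t z) (H t0 z)).
  have /compact_near_coveringP nc := cK.
  refine (nc R (nbhs t0) (fun t z => 0 < dotp (H t z) (H t0 z)) _ _) => z0 Kz0.
  have : 0 < dotp (H t0 z0) (H t0 z0) by rewrite dotp_gt0 h0.
  have d : dotp (H w.2 w.1) (H t0 w.1) @[w --> filter_prod (nbhs z0) (nbhs t0)] -->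
      dotp (H t0 z0) (H t0 z0).
    have g1 : H w.2 w.1 @[w --> filter_prod (nbhs z0) (nbhs t0)] --> H t0 z0.
      have E : (w.2, w.1) @[w --> filter_prod (nbhs z0) (nbhs t0)] --> (t0, z0).
        by apply: cvg_pt; [exact: cvg_snd|exact: cvg_fst].
      exact: (cvg_comp _ _ E (cH (t0, z0))).
    have g2 : H t0 w.1 @[w --> filter_prod (nbhs z0) (nbhs t0)] --> H t0 z0.
      have E : w.1 @[w --> filter_prod (nbhs z0) (nbhs t0)] --> z0 by exact: cvg_fst.
      exact: (cvg_comp _ _ E (cHt t0 z0)).
    apply: cvgD; apply: cvgM.
    - exact: (cvg_comp _ _ g1 cvg_fst).
    - exact: (cvg_comp _ _ g2 cvg_fst).
    - exact: (cvg_comp _ _ g1 cvg_snd).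
    - exact: (cvg_comp _ _ g2 cvg_snd).
  exact: (cvgr_gt _ d).
apply: filterS => t ht _.
suff E : rot_equiv K (H t) (H t0).
  by split; apply: rot_equiv_trans; [exact: rot_equiv_sym|].
by apply: rot_equiv_dot => //; apply: continuous_subspaceT; exact: cHt.
Qed.

End Square.

Lemma rot_equiv_ext {R : realType} {T : topologicalType} (K : set T)
    (f f' g g' : T -> R * R) :
  (forall z, K z -> f z = f' z) -> (forall z, K z -> g z = g' z) ->
  rot_equiv K f' g' -> rot_equiv K f g.
Proof.
move=> ff gg [th cth h]; exists th => // z Kz.
by rewrite ff// gg//; exact: h.
Qed.

Section Separation.
Context {R : realType}.
Implicit Types (p q x y z : R * R) (K U : set (R * R)).

(** The positive factor in [rot_equiv] need not be continuous. Normalising removes it, so that the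
    two halves of the field in [separation] agree exactly on [K]. *)
Definition unit_dir x : R * R := dilate (Num.sqrt (dotp x x))^-1 x.

Lemma dotp_dilate (r : R) x : dotp (dilate r x) (dilate r x) = r ^+ 2 * dotp x x.
Proof. by rewrite /dotp /dilate /=; ring. Qed.

Lemma sqrt_dotp_gt0 x : x != 0 -> 0 < Num.sqrt (dotp x x).
Proof. by move=> x0; rewrite sqrtr_gt0 dotp_gt0. Qed.

Lemma unit_dir_dilate (r : R) x : 0 < r -> unit_dir (dilate r x) = unit_dir x.
Proof.
move=> r0; rewrite /unit_dir dotp_dilate sqrtrM ?sqr_ge0// sqrtr_sqr gtr0_norm//.
by rewrite dilateA invfM mulrAC mulVf ?gt_eqF// mul1r.
Qed.

Lemma unit_dir_turn t x : unit_dir (turn t x) = turn t (unit_dir x).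
Proof. by rewrite /unit_dir dotp_turn turn_dilate. Qed.

Lemma turn_eq0 t x : (turn t x == 0) = (x == 0).
Proof. by rewrite -dotp_eq0 dotp_turn dotp_eq0. Qed.

Lemma unit_dir_eq0 x : (unit_dir x == 0) = (x == 0).
Proof.
rewrite -dotp_eq0 /unit_dir dotp_dilate; have [->|x0] := eqVneq x 0.
  by rewrite /dotp !mulr0 addr0 mulr0 eqxx.
by rewrite mulf_eq0 sqrf_eq0 invr_eq0 gt_eqF ?sqrt_dotp_gt0//= dotp_eq0 (negbTE x0).
Qed.

Lemma unit_dir_continuous (x : R * R) : x != 0 -> unit_dir y @[y --> x] --> unit_dir x.
Proof.
move=> x0.
have c1 : y.1 @[y --> x] --> x.1 by exact: cvg_fst.
have c2 : y.2 @[y --> x] --> x.2 by exact: cvg_snd.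
have cd : dotp y y @[y --> x] --> dotp x x by apply: cvgD; exact: cvgM.
have cs : Num.sqrt (dotp y y) @[y --> x] --> Num.sqrt (dotp x x).
  exact: (cvg_comp _ _ cd (@sqrt_continuous R _)).
have ci : (Num.sqrt (dotp y y))^-1 @[y --> x] --> (Num.sqrt (dotp x x))^-1.
  by apply: cvgV => //; rewrite gt_eqF// sqrt_dotp_gt0.
by apply: cvg_pt; exact: cvgM.
Qed.

Lemma unit_dir_rot_equiv {T : topologicalType} (K : set T) (f : T -> R * R) :
  (forall t, K t -> f t != 0) -> rot_equiv K (fun t => unit_dir (f t)) f.
Proof.
move=> f0; exists (fun=> 0); first by move=> z; exact: cvg_cst.
move=> z Kz; exists (Num.sqrt (dotp (f z) (f z)))^-1; last by rewrite turn0.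
by rewrite invr_gt0 sqrt_dotp_gt0// f0.
Qed.

Lemma plane_bounded K : bounded_set K ->
  exists2 M, 0 < M & forall z, K z -> `|z.1| < M /\ `|z.2| < M.
Proof.
move=> [M [_ hM]]; exists (`|M| + 2); first by rewrite ltr_wpDl.
move=> z Kz; have h : M < `|M| + 1 -> `|z| <= `|M| + 1 by move=> /hM; apply.
have /h : M < `|M| + 1 by rewrite (le_lt_trans (ler_norm M))// ltrDl.
have -> : `|z| = Num.max `|z.1| `|z.2| by [].
by rewrite ge_max => /andP[h1 h2]; split; lra.
Qed.

(* Eilenberg's criterion: if [(z - p) / (z - q)] had a continuous argument [Th] on
   [K], extended to the whole plane by Tietze's theorem, then the field equal to
   [z - q] turned by [Th] on [U] and to [z - p] outside would have no zero in a
   large square, yet wind once around its boundary. *)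
Lemma separation K U p q : compact K -> open U -> bounded_set U ->
  closure U `<=` U `|` K -> U `&` K = set0 -> U p -> ~ U q -> ~ K q ->
  ~ unseparated K p q.
Proof.
move=> cK oU bU clU UK Up Uq Kq [th cth hth].
have [Th [ThE cTh]] : exists Th : R * R -> R, (forall z, K z -> th z = Th z) /\ continuous Th.
  have /compact_bounded[M [_ hM]] : compact ((th : R * R -> R^o) @` K).
    exact: continuous_compact.
  have M0 : 0 < `|M| + 1 by rewrite ltr_wpDl.
  have thM z : K z -> `|th z| <= `|M| + 1.
    move=> Kz; apply: (hM (`|M| + 1)) => /=; last by exists z.
    by rewrite (le_lt_trans (ler_norm M))// ltrDl.
  have [g [gE cg _]] := continuous_bounded_extension (@pseudometric_normal R (R * R)%type)
    (compact_closed_plane cK) M0 cth thM.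
  by exists g; split=> // z Kz; apply: gE; exact: mem_set.
pose A z := turn (Th z) (unit_dir (z - q)).
pose B z := unit_dir (z - p).
pose h z := if z \in U then A z else B z.
have AB z : K z -> A z = B z.
  move=> Kz; rewrite /A /B; have [r r0 ->] := hth z Kz.
  by rewrite unit_dir_dilate// unit_dir_turn -ThE.
have nq z : closure U z -> z - q != 0.
  move=> /clU Uz; rewrite subr_eq0; apply/eqP => zq; move: Uz; rewrite zq.
  by case.
have np z : ~ U z -> z - p != 0.
  by move=> Uz; rewrite subr_eq0; apply/eqP => zq; apply: Uz; rewrite zq.
have h0 z : h z != 0.
  rewrite /h; case: ifPn => [/set_mem Uz|/negP Uz].
    by rewrite turn_eq0 unit_dir_eq0 nq//; exact: subset_closure.
  by rewrite unit_dir_eq0 np// => /mem_set.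
have cB (x : R * R) z : z - x != 0 -> unit_dir (w - x) @[w --> z] --> unit_dir (z - x).
  move=> zx; have c : w - x @[w --> z] --> z - x by apply: cvgB; [exact: cvg_id|exact: cvg_cst].
  exact: (cvg_comp _ _ c (unit_dir_continuous zx)).
have ch : continuous h.
  apply/continuous_subspace_setT.
  (* The two closed pieces overlap only in points of [K], where [A] and [B] coincide. *)
  have -> : [set: R * R] = closure U `|` ~` U.
    apply/seteqP; split=> // z _; have [Uz|Uz] := pselect (U z); last by right.
    by left; exact: subset_closure.
  apply: withinU_continuous.
  - exact: closed_closure.
  - exact: open_closedC.
  - apply: (@within_eq _ _ _ A).
      move=> z cz; rewrite /h; case: ifPn => // /negP Uz; apply: AB.
      by have [/mem_set//|] := clU z cz.
    apply: continuous_in_subspaceT => z /set_mem/nq zq.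
    have c := cB q z zq.
    have c1 : (unit_dir (w - q)).1 @[w --> z] --> (unit_dir (z - q)).1 := cvg_comp _ _ c cvg_fst.
    have c2 : (unit_dir (w - q)).2 @[w --> z] --> (unit_dir (z - q)).2 := cvg_comp _ _ c cvg_snd.
    have cc : cos (Th w) @[w --> z] --> cos (Th z).
      exact: (cvg_comp _ _ (cTh z) (@continuous_cos R _)).
    have cs : sin (Th w) @[w --> z] --> sin (Th z).
      exact: (cvg_comp _ _ (cTh z) (@continuous_sin R _)).
    by apply: cvg_pt; [apply: cvgB|apply: cvgD]; apply: cvgM; [exact: c1|exact: cc|exact: c2|exact: cs|exact: c1|exact: cs|exact: c2|exact: cc].
  - apply: (@within_eq _ _ _ B).
      by move=> z Uz; rewrite /h; case: ifPn => // /set_mem.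
    by apply: continuous_in_subspaceT => z /set_mem/np; exact: cB.
have [M M0 hM] := plane_bounded bU.
have [p1 p2] := hM p Up.
(* [U] lies in the box of half-side [M] about the origin and contains [p], so the square of
   half-side [2 * M] about [p] avoids [U]. *)
pose N := M + M.
have N0 : 0 < N by rewrite addr_gt0.
have SU z : square p N z -> ~ U z.
  move=> /square_out + /hM[]; rewrite (gtr0_norm N0).
  move: p1 p2; rewrite !ltr_norml /N => /andP[? ?] /andP[? ?] [] e /andP[? ?] /andP[? ?].
    have : `|z.1 - p.1| < M + M by rewrite ltr_norml; lra.
    by rewrite e ltxx.
  have : `|z.2 - p.2| < M + M by rewrite ltr_norml; lra.
  by rewrite e ltxx.
have := @square_winding _ p N (h p) N0 (h0 p); apply.
apply: rot_equiv_trans (nonvanishing_rot_equiv p (@square_compact _ p N) ch h0).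
apply: rot_equiv_sym.
apply: rot_equiv_ext (@unit_dir_rot_equiv _ (square p N) (fun z => z - p) _) => // z Sz.
  by rewrite /h memNset//; exact: SU.
by apply: np; exact: SU.
Qed.

End Separation.

(** * Jordan curves *)

Section PlaneSets.
Context {R : realType}.
Implicit Types (p q x y z : R * R) (K U : set (R * R)).

Lemma star_connected K p : K p ->
  (forall z t, K z -> 0 <= t <= 1 -> K (p + dilate t (z - p))) -> connected K.
Proof.
move=> Kp star.
pose seg z := (fun t : R => p + dilate t (z - p)) @` `[0, 1].
have -> : K = \bigcup_(z in K) seg z.
  apply/seteqP; split=> [z Kz|z [w Kw [t + <-]]].
    by exists z => //; exists 1; rewrite /= ?in_itv/= ?lexx ?ler01// dilate1 addrC subrK.
  by rewrite /= in_itv/=; exact: star.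
apply: bigcup_connected.
  exists p => z _; exists 0; rewrite /= ?in_itv/= ?lexx ?ler01//.
  by rewrite /dilate !mul0r; exact: addr0.
move=> z _; apply: connected_continuous_connected; first exact: segment_connected.
apply: continuous_subspaceT => t; apply: cvgD; first exact: cvg_cst.
by apply: cvg_pt; (apply: cvgM; [exact: cvg_id|exact: cvg_cst]).
Qed.

Lemma ball_connected p (e : R) : 0 < e -> connected (ball p e).
Proof.
move=> e0; apply: (@star_connected _ p); first exact: ballxx.
move=> z t /ball_planeE[h1 h2] /andP[t0 t1]; apply/ball_planeE => /=.
have dE (a b : R) : a - (a + t * (b - a)) = t * (a - b) by ring.
rewrite !dE !normrM (ger0_norm t0).
by split; [apply: le_lt_trans h1|apply: le_lt_trans h2]; rewrite ler_piMl.
Qed.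

Lemma component_open K x : open K -> open (connected_component K x).
Proof.
rewrite !openE => oK y Wy.
have /oK/nbhs_ballP[e /= e0 eK] := connected_component_sub Wy.
apply/nbhs_ballP; exists e => //= z yz.
apply: connected_component_trans Wy _.
exists (ball y e) => //; split => //; [exact: ballxx|exact: ball_connected].
Qed.

Lemma component_boundary K x : closed K ->
  closure (connected_component (~` K) x) `<=` connected_component (~` K) x `|` K.
Proof.
move=> cK y cy; have [Ky|nKy] := pselect (K y); [by right|left].
have oK : open (~` K) by exact: closed_openC.
have /nbhs_ballP[e /= e0 eK] := open_nbhs_nbhs (conj oK nKy).
have [z [Wz yz]] := cy _ (nbhsx_ballx y e e0).
apply: connected_component_trans Wz _.
exists (ball y e); last exact: ballxx.
by split => //; exact: ball_connected.
Qed.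

Lemma box_bounded K (M : R) : (forall z, K z -> `|z.1| <= M /\ `|z.2| <= M) -> bounded_set K.
Proof.
move=> h; exists M; split; first exact: num_real.
move=> N MN z /h[h1 h2] /=.
have -> : `|z| = Num.max `|z.1| `|z.2| by [].
by rewrite ge_max (le_trans h1) ?(le_trans h2)// ltW.
Qed.

Definition ext (M : R) : set (R * R) :=
  [set z | z.2 <= - M] `|` [set z | z.1 <= - M] `|` [set z | M <= z.1]
  `|` [set z | M <= z.2].

Lemma ext_connected (M : R) : 0 < M -> connected (ext M).
Proof.
move=> M0.
have c1 : connected [set z : R * R | z.2 <= - M].
  apply: (@star_connected _ (0, - M)) => /=; first exact: lexx.
  by move=> z t /= zM /andP[t0 t1]; nra.
have c2 : connected [set z : R * R | z.1 <= - M].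
  apply: (@star_connected _ (- M, 0)) => /=; first exact: lexx.
  by move=> z t /= zM /andP[t0 t1]; nra.
have c3 : connected [set z : R * R | M <= z.1].
  apply: (@star_connected _ (M, 0)) => /=; first exact: lexx.
  by move=> z t /= zM /andP[t0 t1]; nra.
have c4 : connected [set z : R * R | M <= z.2].
  apply: (@star_connected _ (0, M)) => /=; first exact: lexx.
  by move=> z t /= zM /andP[t0 t1]; nra.
have c12 : connected ([set z : R * R | z.2 <= - M] `|` [set z | z.1 <= - M]).
  by apply: connectedU => //; exists (- M, - M); split => /=.
have c123 : connected ([set z : R * R | z.2 <= - M] `|` [set z | z.1 <= - M] `|` [set z | M <= z.1]).
  by apply: connectedU => //; exists (M, - M); split => /=; [left|].
by apply: connectedU => //; exists (M, M); split => /=; [right|].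
Qed.

(** An unbounded component leaves the box of half-side [M], and what lies outside is connected and
    free of [K]. *)
Lemma unbounded_component K x (M : R) z : 0 < M ->
  (forall z, K z -> `|z.1| < M /\ `|z.2| < M) ->
  ~ bounded_set (connected_component (~` K) x) -> ext M z ->
  connected_component (~` K) x z.
Proof.
move=> M0 KM unb Ez.
have [w [Ww Ew]] : exists w, connected_component (~` K) x w /\ ext M w.
  apply: contrapT => /forallNP nE; apply: unb; apply: (@box_bounded _ M) => w Ww.
  have nEw : ~ ext M w by move=> Ew; exact: (nE w).
  rewrite !ler_norml; split; apply/andP; split; rewrite leNgt; apply/negP => h; apply: nEw.
  - by left; left; right => /=; exact: ltW.
  - by left; right => /=; exact: ltW.
  - by left; left; left => /=; exact: ltW.
  - by right => /=; exact: ltW.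
apply: connected_component_trans Ww _.
exists (ext M) => //; split => //; last exact: ext_connected.
move=> y Ey /KM[]; rewrite !ltr_norml => /andP[? ?] /andP[? ?].
by case: Ey => [[[]|]|] /=; lra.
Qed.

Lemma closed_halfplanes (a : R) :
  [/\ closed [set z : R * R | z.1 <= a], closed [set z : R * R | a <= z.1],
      closed [set z : R * R | z.2 <= a] & closed [set z : R * R | a <= z.2]].
Proof.
have cfst : continuous (@fst R R) by move=> x; exact: cvg_fst.
have csnd : continuous (@snd R R) by move=> x; exact: cvg_snd.
split.
- exact: (proj1 (continuous_closedP _) cfst _ (@closed_le R a)).
- exact: (proj1 (continuous_closedP _) cfst _ (@closed_ge R a)).
- exact: (proj1 (continuous_closedP _) csnd _ (@closed_le R a)).
- exact: (proj1 (continuous_closedP _) csnd _ (@closed_ge R a)).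
Qed.

Lemma closed_hline (a : R) : closed [set z : R * R | z.1 = a].
Proof.
have -> : [set z : R * R | z.1 = a] = [set z | z.1 <= a] `&` [set z | a <= z.1].
  by apply/seteqP; split=> z /=; [move->; rewrite lexx|case=> h1 h2; apply/eqP; rewrite eq_le h1].
by apply: closedI; have [] := closed_halfplanes a.
Qed.

Lemma compact_argmax K (f : R * R -> R) : K !=set0 -> compact K -> continuous f ->
  exists2 a, K a & forall z, K z -> f z <= f a.
Proof.
move=> K0 cK cf.
have [a /set_mem Ka h] := compact_EVT_max K0 cK (continuous_subspaceT cf).
by exists a => // z /mem_set; exact: h.
Qed.

Lemma compact_argmin K (f : R * R -> R) : K !=set0 -> compact K -> continuous f ->
  exists2 a, K a & forall z, K z -> f a <= f z.
Proof.
move=> K0 cK cf.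
have [a /set_mem Ka h] := compact_EVT_min K0 cK (continuous_subspaceT cf).
by exists a => // z /mem_set; exact: h.
Qed.

End PlaneSets.

(** * Splitting a simple closed curve into two arcs *)

Section Loop.
Context {R : realType}.
Implicit Types (a b p q x y z : R * R) (A B J K U : set (R * R)).

Definition is_loop (g : R -> R * R) :=
  [/\ {within `[0, 1], continuous g}, g 0 = g 1 &
    forall s t, 0 <= s -> s < t -> t <= 1 -> g s = g t -> s = 0 /\ t = 1].

(** The last clause concerns [A] alone, so the notion is not symmetric in [A] and [B], and the
    splitting lemmas provide both orders. *)
Definition splits J a b A B :=
  [/\ J = A `|` B, compact A /\ compact B, connected A /\ connected B,
    A `&` B = [set a; b] & connected (A `\` [set a; b])].

Lemma image_itv_connected (g : R -> R * R) (i : interval R) :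
  {within `[0, 1], continuous g} -> [set` i] `<=` `[0, 1] -> connected (g @` [set` i]).
Proof.
move=> cg sub; apply: connected_continuous_connected.
  by apply/connected_intervalP; exact: interval_is_interval.
exact: continuous_subspaceW cg.
Qed.

Lemma loop_splits (g : R -> R * R) s t : is_loop g -> 0 <= s -> s < t -> t <= 1 ->
  g s != g t ->
  let A := g @` `[s, t] in let B := g @` `[0, s] `|` g @` `[t, 1] in
  splits (g @` `[0, 1]) (g s) (g t) A B /\ splits (g @` `[0, 1]) (g s) (g t) B A.
Proof.
move=> [cg g01 inj] s0 st t1 gst A B.
have t0 : 0 <= t by lra.
have s1 : s <= 1 by lra.
have Ic : g @` `[0, 1] = A `|` B.
  rewrite /A /B -!image_setU; congr image; apply/seteqP; split=> r /=; rewrite !in_itv/=.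
    move=> /andP[r0 r1]; have /orP[h1|h1] := le_total r s.
      by right; left; rewrite r0.
    have /orP[h2|h2] := le_total r t; first by left; rewrite h1.
    by right; right; rewrite h2.
  by case=> [|[|]] /andP[? ?]; apply/andP; split; lra.
have inj' r r' : 0 <= r <= 1 -> 0 <= r' <= 1 -> g r = g r' ->
    [\/ r = r', r = 0 /\ r' = 1 | r = 1 /\ r' = 0].
  move=> /andP[? ?] /andP[? ?] e; have [l|l|] := ltgtP r r'; last by constructor 1.
    by have [] := inj _ _ _ l _ e => // -> ->; constructor 2.
  by have [] := inj _ _ _ l _ (esym e) => // -> ->; constructor 3.
have I : A `&` B = [set g s; g t].
  apply/seteqP; split=> z.
    move=> [[r + <-] h]; rewrite /= in_itv/= => /andP[r1 r2].
    case: h => -[r' + e]; rewrite /= in_itv/= => /andP[r3 r4].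
      have [||ee|[e1 e2]|[e1 e2]] := inj' r' r _ _ e; try (apply/andP; split; lra).
      + by left; congr g; lra.
      + by right; congr g; lra.
      + by left; congr g; lra.
    have [||ee|[e1 e2]|[e1 e2]] := inj' r' r _ _ e; try (apply/andP; split; lra).
    + by right; congr g; lra.
    + by right; congr g; lra.
    + by left; congr g; lra.
  case=> ->; split.
  - by exists s => //=; rewrite in_itv/= lexx ltW.
  - by left; exists s => //=; rewrite in_itv/= lexx s0.
  - by exists t => //=; rewrite in_itv/= lexx ltW.
  - by right; exists t => //=; rewrite in_itv/= lexx t1.
have sub (i : interval R) : (forall r, r \in i -> 0 <= r <= 1) -> [set` i] `<=` `[0, 1].
  by move=> h r /= /h; rewrite in_itv.
have cA : compact A by apply: image_itv_compact cg _ _ => //; lra.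
have kB : compact B by apply: compactU; apply: image_itv_compact cg _ _.
have conA : connected A.
  by apply: image_itv_connected cg _; apply: sub => r; rewrite in_itv/=; lra.
have conB : connected B.
  apply: connectedU.
  - exists (g 0); split; first by exists 0 => //=; rewrite in_itv/= lexx.
    by exists 1; rewrite //= in_itv/= lexx t1.
  - by apply: image_itv_connected cg _; apply: sub => r; rewrite in_itv/=; lra.
  - by apply: image_itv_connected cg _; apply: sub => r; rewrite in_itv/=; lra.
have I01 r : s <= r <= t -> 0 <= r <= 1 by lra.
have I0s r : 0 <= r <= s -> 0 <= r <= 1 by lra.
have It1 r : t <= r <= 1 -> 0 <= r <= 1 by lra.
have sI : 0 <= s <= 1 by lra.
have tI : 0 <= t <= 1 by lra.
have AE : A `\` [set g s; g t] = g @` `]s, t[.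
  apply/seteqP; split=> z.
    move=> [[r + <-] nz]; rewrite /= in_itv/= => /andP[r1 r2]; exists r => //=.
    rewrite in_itv/= !lt_neqAle r1 r2 !andbT; apply/andP; split.
      by apply/eqP => e; apply: nz; left; rewrite e.
    by apply/eqP => e; apply: nz; right; rewrite e.
  move=> [r + <-]; rewrite /= in_itv/= => /andP[r1 r2].
  have rI : 0 <= r <= 1 by lra.
  split; first by exists r => //=; rewrite in_itv/= !ltW.
  case=> e.
    have : r < r; last by rewrite ltxx.
    by case: (inj' r s rI sI e) => [ee|[e1 e2]|[e1 e2]]; lra.
  have : r < r; last by rewrite ltxx.
  by case: (inj' r t rI tI e) => [ee|[e1 e2]|[e1 e2]]; lra.
have conB' : connected (B `\` [set g s; g t]).
  (* If [s = 0] or [t = 1], the base point [g 0 = g 1] is an end of [B] and one open arc remains.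
     Otherwise two half-open arcs remain, joined at the base point. *)
  have [s00|s00] := eqVneq s 0.
    have -> : B `\` [set g s; g t] = g @` `]t, 1[.
      apply/seteqP; split=> z.
        move=> [[|] [r + <-] nz]; rewrite /= in_itv/= => /andP[r1 r2].
          by case: nz; left; congr g; lra.
        exists r => //=; rewrite in_itv/= !lt_neqAle r1 r2 !andbT; apply/andP; split.
          by apply/eqP => e; apply: nz; right; rewrite e.
        by apply/eqP => e; apply: nz; left; rewrite e s00 g01.
      move=> [r + <-]; rewrite /= in_itv/= => /andP[r1 r2].
      have rI : 0 <= r <= 1 by lra.
      split; first by right; exists r => //=; rewrite in_itv/= !ltW.
      case=> e.
        have : r < r; last by rewrite ltxx.
        by case: (inj' r s rI sI e) => [ee|[e1 e2]|[e1 e2]]; lra.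
      have : r < r; last by rewrite ltxx.
      by case: (inj' r t rI tI e) => [ee|[e1 e2]|[e1 e2]]; lra.
    by apply: image_itv_connected cg _; apply: sub => r; rewrite in_itv/=; lra.
  have [t11|t11] := eqVneq t 1.
    have -> : B `\` [set g s; g t] = g @` `]0, s[.
      apply/seteqP; split=> z.
        move=> [[|] [r + <-] nz]; rewrite /= in_itv/= => /andP[r1 r2]; last first.
          by case: nz; right; congr g; lra.
        exists r => //=; rewrite in_itv/= !lt_neqAle r1 r2 !andbT; apply/andP; split.
          by apply/eqP => e; apply: nz; right; rewrite -e t11 g01.
        by apply/eqP => e; apply: nz; left; rewrite e.
      move=> [r + <-]; rewrite /= in_itv/= => /andP[r1 r2].
      have rI : 0 <= r <= 1 by lra.
      split; first by left; exists r => //=; rewrite in_itv/= !ltW.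
      case=> e.
        have : r < r; last by rewrite ltxx.
        by case: (inj' r s rI sI e) => [ee|[e1 e2]|[e1 e2]]; lra.
      have : r < r; last by rewrite ltxx.
      by case: (inj' r t rI tI e) => [ee|[e1 e2]|[e1 e2]]; lra.
    by apply: image_itv_connected cg _; apply: sub => r; rewrite in_itv/=; lra.
  have s0' : 0 < s by rewrite lt_neqAle eq_sym s00.
  have t1' : t < 1 by rewrite lt_neqAle t11.
  have -> : B `\` [set g s; g t] = g @` `[0, s[ `|` g @` `]t, 1].
    apply/seteqP; split=> z.
      move=> [[|] [r + <-] nz]; rewrite /= in_itv/= => /andP[r1 r2].
        left; exists r => //=; rewrite in_itv/= r1 lt_neqAle r2 andbT.
        by apply/eqP => e; apply: nz; left; rewrite e.
      right; exists r => //=; rewrite in_itv/= r2 lt_neqAle r1 !andbT.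
      by apply/eqP => e; apply: nz; right; rewrite e.
    case=> -[r + <-]; rewrite /= in_itv/= => /andP[r1 r2]; (have rI : 0 <= r <= 1 by lra); split.
    - by left; exists r => //=; rewrite in_itv/= r1 ltW.
    - case=> e.
        have : r < r; last by rewrite ltxx.
        by case: (inj' r s rI sI e) => [ee|[e1 e2]|[e1 e2]]; lra.
      have : r < r; last by rewrite ltxx.
      by case: (inj' r t rI tI e) => [ee|[e1 e2]|[e1 e2]]; lra.
    - by right; exists r => //=; rewrite in_itv/= r2 ltW.
    - case=> e.
        have : r < r; last by rewrite ltxx.
        by case: (inj' r s rI sI e) => [ee|[e1 e2]|[e1 e2]]; lra.
      have : r < r; last by rewrite ltxx.
      by case: (inj' r t rI tI e) => [ee|[e1 e2]|[e1 e2]]; lra.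
  apply: connectedU.
  - exists (g 0); split; first by exists 0; rewrite //= in_itv/= lexx s0'.
    by exists 1; rewrite //= in_itv/= lexx t1'.
  - by apply: image_itv_connected cg _; apply: sub => r; rewrite in_itv/=; lra.
  - by apply: image_itv_connected cg _; apply: sub => r; rewrite in_itv/=; lra.
split; split => //.
- by rewrite AE; apply: image_itv_connected cg _; apply: sub => r; rewrite in_itv/=; lra.
- by rewrite setUC.
- by rewrite setIC.
Qed.

End Loop.

(** * A simple closed curve has a bounded complementary component *)

Section Jordan.
Context {R : realType}.
Implicit Types (a b p q x y z : R * R) (A B J K U : set (R * R)).

Lemma continuous_fst_plane : continuous (@fst R R).
Proof. by move=> z; exact: cvg_fst. Qed.

Lemma continuous_snd_plane : continuous (@snd R R).
Proof. by move=> z; exact: cvg_snd. Qed.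

(* The region below and beside [J] reaching [J] only at [a] and [b]. *)
Definition outer_frame a b (Y : R) : set (R * R) :=
  [set z | z.1 <= a.1 /\ z.2 <= a.2] `|` [set z | z.2 <= Y] `|`
  [set z | b.1 <= z.1 /\ z.2 <= b.2].

Lemma quadrant_connected a : connected [set z : R * R | z.1 <= a.1 /\ z.2 <= a.2] /\
  connected [set z : R * R | a.1 <= z.1 /\ z.2 <= a.2] /\
  connected [set z : R * R | z.2 <= a.2].
Proof.
split; [|split]; apply: (@star_connected _ _ a) => /=; rewrite ?lexx//.
- by move=> z t /= [h1 h2] /andP[t0 t1]; split; nra.
- by move=> z t /= [h1 h2] /andP[t0 t1]; split; nra.
- by move=> z t /= h /andP[t0 t1]; nra.
Qed.

Lemma outer_frame_closed a b (Y : R) : closed (outer_frame a b Y).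
Proof.
have [c1 _ c3 _] := closed_halfplanes a.1.
have [_ _ c3' _] := closed_halfplanes a.2.
have [_ _ cY _] := closed_halfplanes Y.
have [_ cb _ _] := closed_halfplanes b.1.
have [_ _ cb' _] := closed_halfplanes b.2.
by apply: closedU; [apply: closedU => //|]; exact: closedI.
Qed.

(* [B] together with the frame winds once around [(xm, - M)], but not around
   the point [(xm, M)] above it. *)
Lemma frame_separates B a b (M xm : R) : connected B -> B a -> B b ->
  (forall z, B z -> `|z.1| < M /\ `|z.2| < M) -> a.1 < xm < b.1 ->
  ~ unseparated (B `|` outer_frame a b (- M - 1)) (xm, M) (xm, - M).
Proof.
move=> cB Ba Bb BM /andP[axm xmb].
have [_] := BM _ Ba; rewrite ltr_norml => /andP[a1 a2].
have [_] := BM _ Bb; rewrite ltr_norml => /andP[b1 b2].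
set K := B `|` _ => sep.
have K_below z : K z -> z.2 < M.
  by case=> [/BM[_]|[[[_]|]|[_]]] /=; rewrite ?ltr_norml; lra.
have u0 : ((0, - 1) : R * R) != 0 by rewrite xpair_eqE negb_and oppr_eq0 oner_eq0 orbT.
(* All of [K] lies below [(xm, M)], so seen from there it does not wind; if the two points were
   unseparated, it would not wind around [(xm, - M)] either. *)
have : rot_equiv K (fun z => z - (xm, - M)) (fun=> (0, - 1)).
  apply: rot_equiv_trans (rot_equiv_sym sep) _.
  apply: rot_equiv_dot; first exact: continuous_subr.
    by apply: continuous_subspaceT => z; exact: cvg_cst.
  by move=> z /K_below; rewrite /dotp /=; lra.
have [q1 _] := quadrant_connected a.
have [_ [q2 _]] := quadrant_connected b.
have [_ [_ q3]] := quadrant_connected (0, - M - 1).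
apply: (@winding_nonzero _ K B [set z | z.1 <= a.1 /\ z.2 <= a.2] [set z | z.2 <= - M - 1]
  [set z | b.1 <= z.1 /\ z.2 <= b.2]) => //.
- by move=> z; left.
- by move=> z h; right; left; left.
- by move=> z h; right; left; right.
- by move=> z h; right; right.
- by move=> z /BM[_]; rewrite ltr_norml => /andP[].
- by move=> z [h _] /=; lra.
- by move=> z /=; lra.
- by move=> z [h _] /=; lra.
- by exists a; split=> //=; rewrite !lexx.
- by exists (a.1, - M - 1); rewrite /= !lexx; split=> //; split=> //=; lra.
- by exists (b.1, - M - 1); rewrite /= !lexx; split=> //; split=> //=; lra.
- by exists b; split=> //=; rewrite !lexx.
Qed.

Lemma vseg_outside_frame a b (M xm s t : R) z : a.1 < xm < b.1 -> - M <= s ->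
  vseg s t xm z -> ~ outer_frame a b (- M - 1) z.
Proof.
move=> /andP[h1 h2] Ms /vsegP[h3 h4 h5] [[[]|]|[]] /=; lra.
Qed.

Lemma unseparated_vseg K (s t c : R) (r r' : R) : closed K ->
  (forall z, vseg s t c z -> ~ K z) -> s <= r <= t -> s <= r' <= t ->
  unseparated K (c, r) (c, r').
Proof.
move=> clK nK /andP[h1 h2] /andP[h3 h4].
apply: (@unseparated_connected _ K (vseg s t c)) => //.
- exact: vseg_connected.
- by rewrite -subset0 => z [/nK].
- by apply/vsegP.
- by apply/vsegP.
Qed.

(** On the vertical line at [xm], let [m] be the lowest point of [A], [p] the highest point of [B]
    below [m], and [x] the midpoint of [p] and [m]. Going down to [l], through [A] to [m] and down
    to [x] avoids [B] and the frame. If the component of [x] were unbounded, [A] with [B] would not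
    separate [x] from [(xm, - M)]. Nor does [A] with the frame, and these two unions meet in the
    connected set [A]. After gluing, [B] with the frame would not separate the points above and
    below it, against [frame_separates]. *)
Lemma jordan_core J A B a b l (M xm : R) :
  splits J a b A B -> a.1 < xm < b.1 -> 0 < M ->
  (forall z, J z -> `|z.1| < M /\ `|z.2| < M) ->
  (forall z, J z -> outer_frame a b (- M - 1) z -> z = a \/ z = b) ->
  A l -> l.1 = xm -> (forall z, J z -> z.1 = xm -> z.2 <= l.2) ->
  exists2 x, ~ J x & bounded_set (connected_component (~` J) x).
Proof.
move=> [JE [cA cB] [conA conB] AB conA'] axb M0 JM JF Al lxm ltop.
have /andP[ax xb] := axb.
have clA := compact_closed_plane cA; have clB := compact_closed_plane cB.
have JA z : A z -> J z by rewrite JE; left.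
have JB z : B z -> J z by rewrite JE; right.
have [Aa Ba] : (A `&` B) a by rewrite AB; left.
have [Ab Bb] : (A `&` B) b by rewrite AB; right.
have nab z : z.1 = xm -> ~ [set a; b] z.
  by move=> zx [] e; move: zx; rewrite e => e'; move: axb; rewrite -e' ltxx ?andbF.
have nAB z : z.1 = xm -> A z -> ~ B z.
  by move=> zx Az Bz; apply: (nab z zx); rewrite -AB.
pose F := outer_frame a b (- M - 1).
have clF : closed F by exact: outer_frame_closed.
have cline : closed [set z : R * R | z.1 = xm] by exact: closed_hline.
have [m [Am mxm] mlow] : exists2 m, (A `&` [set z | z.1 = xm]) m &
    forall z, (A `&` [set z | z.1 = xm]) z -> m.2 <= z.2.
  apply: compact_argmin continuous_snd_plane; first by exists l.
  exact: compact_closedI.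
have A'l : (A `\` [set a; b]) l by split=> //; exact: nab.
have A'm : (A `\` [set a; b]) m by split=> //; exact: nab.
have ptE z : z.1 = xm -> z = (xm, z.2) by move=> <-; rewrite -surjective_pairing.
have [_ lM] := JM _ (JA _ Al); have [_ mM] := JM _ (JA _ Am).
move: lM mM; rewrite !ltr_norml => /andP[lM1 lM2] /andP[mM1 mM2].
(* A vertical path from the top through [A] down to height [r]. *)
have top_to r : - M <= r <= m.2 -> (forall z, B z -> z.1 = xm -> z.2 <= m.2 -> z.2 < r) ->
    unseparated (B `|` F) (xm, M) (xm, r).
  move=> /andP[Mr rm] Br.
  pose V := vseg l.2 M xm `|` (A `\` [set a; b]) `|` vseg r m.2 xm.
  apply: (@unseparated_connected _ _ V); first exact: closedU.
  - apply: connectedU; last exact: vseg_connected.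
      exists m; split; first by right.
      by apply/vsegP.
    apply: connectedU; last exact: conA'.
      by exists l; split => //; apply/vsegP; split => //; lra.
    exact: vseg_connected.
  - rewrite -subset0 => z [[[]|]] => [Vz [Bz|]|[Az nz] [Bz|Fz]|Vz [Bz|]].
    + have [z1 z2 zx] := (vsegP _ _ _ _).1 Vz.
      have e : z = l.
        rewrite (ptE z zx) (ptE l lxm); congr pair; apply/eqP; rewrite eq_le z1.
        by rewrite ltop//; exact: JB.
      by apply: (nAB l lxm Al); rewrite -e.
    + by apply: (vseg_outside_frame (M := M)) Vz => //; lra.
    + by apply: nz; rewrite -AB.
    + by apply: nz; have [->|->] := JF z (JA _ Az) Fz; [left|right].
    + have [z1 z2 zx] := (vsegP _ _ _ _).1 Vz.
      by have := Br z Bz zx z2; lra.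
    + by apply: (vseg_outside_frame (M := M)) Vz.
  - by left; left; apply/vsegP; split=> //=; lra.
  - by right; apply/vsegP; split=> //=; lra.
have BM z : B z -> `|z.1| < M /\ `|z.2| < M by move=> /JB/JM.
have nosep := frame_separates conB Ba Bb BM axb.
have [p [[Bp pxm] pm] ptop] : exists2 p, (B `&` [set z | z.1 = xm] `&` [set z | z.2 <= m.2]) p &
    forall z, (B `&` [set z | z.1 = xm] `&` [set z | z.2 <= m.2]) z -> z.2 <= p.2.
  apply: compact_argmax continuous_snd_plane; last first.
    apply: compact_closedI; first exact: compact_closedI.
    by have [] := closed_halfplanes m.2.
  (* Without a point of [B] below [m], the path could continue down to height [- M]. *)
  apply/set0P/negP => /eqP E0; apply: nosep; apply: top_to; first by lra.
  move=> z Bz zx zm; have : (B `&` [set z | z.1 = xm] `&` [set z | z.2 <= m.2]) z by [].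
  by rewrite E0.
have pm' : p.2 < m.2.
  rewrite lt_neqAle pm andbT; apply/eqP => e; apply: (nAB m mxm Am).
  by rewrite (ptE m mxm) -e -ptE.
have [_] := BM _ Bp; rewrite ltr_norml => /andP[pM1 pM2].
pose r : R := (p.2 + m.2) / 2; pose x : R * R := (xm, r).
have rp : p.2 < r by rewrite /r; lra.
have rm : r < m.2 by rewrite /r; lra.
have nJx : ~ J x.
  rewrite JE => -[Ax|Bx].
    by have /= := mlow x (conj Ax erefl); lra.
  by have /= := ptop x (conj (conj Bx erefl) (ltW rm)); lra.
exists x => //; apply: contrapT => unb.
have Ws : connected_component (~` J) x (xm, - M).
  by apply: (unbounded_component M0 JM unb); left; left; left => /=.
have cJ : closed J by rewrite JE; exact: closedU.
have xsJ : unseparated (A `|` B) x (xm, - M).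
  rewrite -JE; apply: (unseparated_connected cJ (@component_connected _ (~` J) x)) => //.
    by rewrite -subset0 => z [/connected_component_sub].
  exact: connected_component_refl.
have xsAF : unseparated (A `|` F) x (xm, - M).
  apply: (@unseparated_vseg _ (- M) r); first exact: closedU.
  - move=> z Vz [Az|]; last by apply: (vseg_outside_frame (M := M)) Vz.
    have [z1 z2 zx] := (vsegP _ _ _ _).1 Vz.
    by have /= := mlow z (conj Az zx); lra.
  - by apply/andP; split; lra.
  - by apply/andP; split; lra.
have nx : unseparated (B `|` F) (xm, M) x.
  apply: top_to; first by apply/andP; split; lra.
  by move=> z Bz zx zm; have := ptop z (conj (conj Bz zx) zm); lra.
have glue : unseparated ((A `|` F) `|` (A `|` B)) x (xm, - M).
  have I : (A `|` F) `&` (A `|` B) = A.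
    apply/seteqP; split=> [z [[//|Fz] [//|Bz]]|z Az]; last by split; left.
    by have [->|->] := JF z (JB _ Bz) Fz.
  apply: rot_equiv_glue xsAF xsJ; [exact: closedU|exact: closedU| |]; rewrite I//.
  move=> z /JA/JM[_]; rewrite subr_eq0 ltr_norml => /andP[h _].
  by apply/eqP => e; move: h; rewrite e /= ltxx.
apply: nosep; apply: rot_equiv_trans nx _; apply: rot_equiv_sub glue.
by move=> z [|]; [right; right|left; right].
Qed.

End Jordan.

Section JordanCurve.
Context {R : realType}.
Implicit Types (a b p q x y z : R * R) (A B J K U : set (R * R)).

Lemma splitsC J a b A B : splits J b a A B -> splits J a b A B.
Proof. by case=> h1 h2 h3 h4 h5; split; rewrite // setUC. Qed.

Lemma loop_compact (g : R -> R * R) : is_loop g -> compact (g @` `[0, 1]).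
Proof. by move=> [cg _ _]; apply: image_itv_compact cg _ _. Qed.

Lemma loop_splits_at (g : R -> R * R) a b : is_loop g ->
  (g @` `[0, 1]) a -> (g @` `[0, 1]) b -> a != b ->
  exists A B, splits (g @` `[0, 1]) a b A B /\ splits (g @` `[0, 1]) a b B A.
Proof.
move=> lg [s + <-] [t + <-]; rewrite /= !in_itv/= => /andP[s0 s1] /andP[t0 t1] st.
have [l|l|e] := ltgtP s t; last by move: st; rewrite e eqxx.
  by eexists; eexists; exact: (loop_splits lg s0 l t1 st).
rewrite eq_sym in st.
have [S1 S2] := loop_splits lg t0 l s1 st.
by eexists; eexists; split; apply: splitsC; [exact: S1|exact: S2].
Qed.

Lemma connected_fst A a b c : connected A -> A a -> A b -> a.1 <= c <= b.1 ->
  exists2 z, A z & z.1 = c.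
Proof.
move=> cA Aa Ab h.
have /connected_intervalP itv : connected (fst @` A).
  by apply: connected_continuous_connected cA _; apply: continuous_subspaceT; exact: continuous_fst_plane.
have [||z Az ze] := itv a.1 b.1 _ _ c h; [by exists a|by exists b|].
by exists z.
Qed.

Lemma connected_snd A a b c : connected A -> A a -> A b -> a.2 <= c <= b.2 ->
  exists2 z, A z & z.2 = c.
Proof.
move=> cA Aa Ab h.
have /connected_intervalP itv : connected (snd @` A).
  by apply: connected_continuous_connected cA _; apply: continuous_subspaceT; exact: continuous_snd_plane.
have [||z Az ze] := itv a.2 b.2 _ _ c h; [by exists a|by exists b|].
by exists z.
Qed.

(** On a vertical line both arcs between two points of the curve would contain the point at middle
    height. *)
Lemma loop_not_vertical (g : R -> R * R) c : is_loop g ->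
  ~ (forall z, (g @` `[0, 1]) z -> z.1 = c).
Proof.
move=> lg Jc.
have J0 : (g @` `[0, 1]) (g 0) by exists 0; rewrite //= in_itv/= lexx ler01.
have J1 : (g @` `[0, 1]) (g (1/2)) by exists (1/2) => //=; rewrite in_itv/=; lra.
have ne : g 0 != g (1/2).
  case: lg => _ _ inj; apply/eqP => e.
  by have [] := inj 0 (1/2) _ _ _ e; lra.
wlog : / exists u v, [/\ (g @` `[0, 1]) u, (g @` `[0, 1]) v & u.2 < v.2].
  apply; have [l|l|e] := ltgtP (g 0).2 (g (1/2)).2.
  - by exists (g 0), (g (1/2)).
  - by exists (g (1/2)), (g 0).
  - move: ne; rewrite [g 0]surjective_pairing [g (1/2)]surjective_pairing e.
    by rewrite (Jc _ J0) (Jc _ J1) eqxx.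
move=> [u [v [Ju Jv uv]]].
have uv' : u != v by apply: contraTneq uv => ->; rewrite ltxx.
have [A [B [[JE _ [cA cB] AB _] _]]] := loop_splits_at lg Ju Jv uv'.
have [Au Bu] : (A `&` B) u by rewrite AB; left.
have [Av Bv] : (A `&` B) v by rewrite AB; right.
have h : u.2 <= (u.2 + v.2) / 2 <= v.2 by lra.
have [z Az ze] := connected_snd cA Au Av h.
have [w Bw we] := connected_snd cB Bu Bv h.
have zw : z = w.
  rewrite [z]surjective_pairing [w]surjective_pairing ze we.
  by rewrite (Jc z) ?(Jc w)// JE; [right|left].
have : (A `&` B) z by split=> //; rewrite zw.
by rewrite AB => -[] e; move: ze; rewrite e; lra.
Qed.

Lemma loop_inside (g : R -> R * R) : is_loop g ->
  exists2 x, ~ (g @` `[0, 1]) x & bounded_set (connected_component (~` (g @` `[0, 1])) x).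
Proof.
move=> lg; set J := g @` `[0, 1].
have cJ : compact J := loop_compact lg.
have J0 : J !=set0 by exists (g 0); exists 0; rewrite //= in_itv/= lexx ler01.
have [M M0 JM] := plane_bounded (compact_bounded (V := (R * R)%type) cJ).
have [a0 Ja0 a0min] := compact_argmin J0 cJ continuous_fst_plane.
have [b0 Jb0 b0max] := compact_argmax J0 cJ continuous_fst_plane.
(* The lowest of the leftmost points and the lowest of the rightmost points are chosen, so that the
   frame meets the curve nowhere else. *)
have [a [Ja ax] amin] : exists2 a, (J `&` [set z | z.1 = a0.1]) a &
    forall z, (J `&` [set z | z.1 = a0.1]) z -> a.2 <= z.2.
  apply: compact_argmin continuous_snd_plane; first by exists a0.
  by apply: compact_closedI => //; exact: closed_hline.
have [b [Jb bx] bmin] : exists2 b, (J `&` [set z | z.1 = b0.1]) b &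
    forall z, (J `&` [set z | z.1 = b0.1]) z -> b.2 <= z.2.
  apply: compact_argmin continuous_snd_plane; first by exists b0.
  by apply: compact_closedI => //; exact: closed_hline.
rewrite /= in ax bx.
have ab : a.1 < b.1.
  rewrite ltNge; apply/negP => ba; apply: (loop_not_vertical (c := a.1) lg) => z Jz.
  by have := a0min z Jz; have := b0max z Jz; lra.
have nab : a != b by apply: contraTneq ab => ->; rewrite ltxx.
have [A [B [S1 S2]]] := loop_splits_at lg Ja Jb nab.
pose xm := (a.1 + b.1) / 2.
have axb : a.1 < xm < b.1 by rewrite /xm; lra.
have JF z : J z -> outer_frame a b (- M - 1) z -> z = a \/ z = b.
  move=> Jz [[[h1 h2]|h]|[h1 h2]].
  - have e : z.1 = a.1 by apply/eqP; rewrite eq_le h1 ax a0min.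
    left; rewrite [z]surjective_pairing [a]surjective_pairing e; congr pair.
    by apply/eqP; rewrite eq_le h2 amin//; split=> //=; rewrite e.
  - by exfalso; have [_] := JM z Jz; rewrite ltr_norml => /andP[]; move: h => /=; lra.
  - have e : z.1 = b.1 by apply/eqP; rewrite eq_le h1 bx b0max.
    right; rewrite [z]surjective_pairing [b]surjective_pairing e; congr pair.
    by apply/eqP; rewrite eq_le h2 bmin//; split=> //=; rewrite e.
have [l [Jl lx] ltop] : exists2 l, (J `&` [set z | z.1 = xm]) l &
    forall z, (J `&` [set z | z.1 = xm]) z -> z.2 <= l.2.
  apply: compact_argmax continuous_snd_plane; last first.
    by apply: compact_closedI => //; exact: closed_hline.
  have [JE _ [cA _] AB _] := S1.
  have [Aa _] : (A `&` B) a by rewrite AB; left.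
  have [Ab _] : (A `&` B) b by rewrite AB; right.
  have [|z Az zx] := connected_fst (c := xm) cA Aa Ab; first by lra.
  by exists z; split=> //; rewrite /J JE; left.
have ltop' z : J z -> z.1 = xm -> z.2 <= l.2 by move=> Jz zx; exact: ltop.
have := Jl; rewrite {1}/J; have [-> _ _ _ _] := S1 => -[Al|Bl].
  exact: (jordan_core S1 axb M0 JM JF Al lx ltop').
exact: (jordan_core S2 axb M0 JM JF Bl lx ltop').
Qed.

(** If a point of the curve had a neighbourhood free of the component, a short subarc could be
    dropped there. The rest would still contain the boundary of the component and so separate [x]
    from a distant point; but the rest is an arc, which separates nothing. *)
Lemma loop_boundary (g : R -> R * R) x : is_loop g -> ~ (g @` `[0, 1]) x ->
  bounded_set (connected_component (~` (g @` `[0, 1])) x) ->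
  g @` `[0, 1] `<=` closure (connected_component (~` (g @` `[0, 1])) x).
Proof.
move=> lg; set J := g @` `[0, 1] => nJx; set U := connected_component _ _ => bU.
have cJ : compact J := loop_compact lg.
have clJ := compact_closed_plane cJ.
have [cg g01 inj] := lg.
move=> _ [t0 + <-]; rewrite /= in_itv/= => /andP[t00 t01].
apply: contrapT => ncl.
have : exists2 N, nbhs (g t0) N & N `&` U = set0.
  apply: contrapT => h; apply: ncl => N Nt; rewrite setIC; apply/set0P/negP => /eqP E0.
  by apply: h; exists N.
move=> [N0 N0t N0U]; pose N := interior N0.
have oN : open N by exact: open_interior.
have NU z : N z -> ~ closure U z.
  move=> Nz cz; have [w [Uw N0w]] := cz _ (open_nbhs_nbhs (conj oN Nz)).
  have : (N0 `&` U) w by split=> //; exact: (interior_subset N0w).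
  by rewrite N0U.
have t0I : `[0 : R, 1]%classic t0 by rewrite /= in_itv/= t00 t01.
have gN : \forall t \near within `[0, 1] (nbhs t0), N (g t).
  exact: ((withinP _ _).1 cg t0 t0I N (open_nbhs_nbhs (conj oN N0t))).
have /nbhs_ballP[d /= d0 dN] : \forall t \near t0, `[0 : R, 1]%classic t -> N (g t) by [].
have [s [t [s0 st t1 stN]]] : exists s t, [/\ 0 <= s, s < t, t <= 1 &
    forall r, s <= r <= t -> N (g r)].
  have [t1|t1] := ltP t0 1.
    exists t0, (Num.min 1 (t0 + d / 2)).
    have h1 : Num.min 1 (t0 + d / 2) <= 1 by rewrite ge_min lexx.
    have h2 : Num.min 1 (t0 + d / 2) <= t0 + d / 2 by rewrite ge_min lexx orbT.
    split => //; first by rewrite lt_min t1 ltrDl divr_gt0.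
    move=> r /andP[r1 r2]; apply: dN; last by rewrite /= in_itv/=; lra.
    by rewrite /ball/= ltr_norml; lra.
  exists (Num.max 0 (1 - d / 2)), 1.
  have h1 : 0 <= Num.max 0 (1 - d / 2) by rewrite le_max lexx.
  have h2 : 1 - d / 2 <= Num.max 0 (1 - d / 2) by rewrite le_max lexx orbT.
  split => //; first by rewrite gt_max ltr01/=; lra.
  move=> r /andP[r1 r2]; apply: dN; last by rewrite /= in_itv/=; lra.
  by rewrite /ball/= ltr_norml; lra.
pose J' := g @` `[0, s] `|` g @` `[t, 1].
have J'J : J' `<=` J.
  by move=> z [|] [r + <-]; rewrite /= in_itv/= => h; exists r => //=; rewrite in_itv/=; lra.
have cJ1 : compact (g @` `[0, s]) by apply: image_itv_compact cg _ _ => //; lra.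
have cJ2 : compact (g @` `[t, 1]) by apply: image_itv_compact cg _ _ => //; lra.
have cJ' : compact J' by exact: compactU.
have JJ' z : J z -> ~ J' z -> N z.
  move=> [r + <-]; rewrite /= in_itv/= => /andP[r0 r1] nJ'; apply: stN.
  rewrite !leNgt; apply/andP; split; apply/negP => h; apply: nJ'.
    by left; exists r => //=; rewrite in_itv/=; lra.
  by right; exists r => //=; rewrite in_itv/=; lra.
have clU : closure U `<=` U `|` J'.
  move=> z cz; have [Uz|Jz] := component_boundary clJ cz; [by left|right].
  by apply: contrapT => nJ'; apply: (NU z (JJ' z Jz nJ')).
have Ux : U x by exact: connected_component_refl.
have UJ z : U z -> ~ J z by move=> /connected_component_sub.
have [M M0 UM] := plane_bounded bU.
have [M' M'0 JM] := plane_bounded (compact_bounded (V := (R * R)%type) cJ).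
pose q : R * R := (M + M', 0).
have nUq : ~ U q by move=> /UM[]; rewrite /= ltr_norml; lra.
have nJq : ~ J q by move=> /JM[]; rewrite /= ltr_norml; lra.
have n12 : ~ unseparated J' x q.
  have oU : open U by apply: component_open; exact: closed_openC.
  have UJ' : U `&` J' = set0 by rewrite -subset0 => z [/UJ + /J'J].
  by apply: (separation cJ' oU bU clU UJ' Ux nUq) => /J'J.
have nx : ~ J' x by move=> /J'J.
have nq : ~ J' q by move=> /J'J.
(* The rest runs through the base point of the parametrisation, so it is treated as two arcs glued
   at [g 0]. *)
apply: n12; apply: rot_equiv_glue.
- exact: compact_closed_plane.
- exact: compact_closed_plane.
- suff -> : g @` `[0, s] `&` g @` `[t, 1] = [set g 0] by exact: connected1.
  apply/seteqP; split=> [z [[r + <-] [r' + e]]|_ ->].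
    rewrite /= !in_itv/= => /andP[? ?] /andP[? ?].
    by have [|||-> _] := inj r r' _ _ _ (esym e) => //; lra.
  by split; [exists 0; rewrite //= in_itv/= lexx|exists 1; rewrite //= in_itv/= lexx; lra].
- move=> z [Jz _]; rewrite subr_eq0; apply/eqP => zq; apply: nq; rewrite -zq; by left.
- apply: arc_unseparated => //.
  + by apply: continuous_subspaceW cg => r /=; rewrite !in_itv/=; lra.
  + move=> r r'; rewrite !inE /= !in_itv/= => /andP[? ?] /andP[? ?] e.
    have [l|l|//] := ltgtP r r'.
      by have [|||_ ?] := inj r r' _ _ _ e => //; lra.
    by have [|||_ ?] := inj r' r _ _ _ (esym e) => //; lra.
  + by move=> h; apply: nx; left.
  + by move=> h; apply: nq; left.
- apply: arc_unseparated => //.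
  + by apply: continuous_subspaceW cg => r /=; rewrite !in_itv/=; lra.
  + move=> r r'; rewrite !inE /= !in_itv/= => /andP[? ?] /andP[? ?] e.
    have [l|l|//] := ltgtP r r'.
      by have [|||? _] := inj r r' _ _ _ e => //; lra.
    by have [|||? _] := inj r' r _ _ _ (esym e) => //; lra.
  + by move=> h; apply: nx; right.
  + by move=> h; apply: nq; right.
Qed.

End JordanCurve.

(** * Arcs, paths and cycles of a drawing *)

Section Concat.
Context {R : realType}.
Implicit Types (a b c p q x y z : R * R) (A B J K U : set (R * R)).

Definition arc_between A a b := exists g : R -> R * R,
  [/\ {within `[0, 1], continuous g}, set_inj `[0, 1] g, g 0 = a, g 1 = b
    & A = g @` `[0, 1]].

Definition concat (g h : R -> R * R) (t : R) : R * R :=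
  if t <= 1 / 2 then g (2 * t) else h (2 * t - 1).

Lemma concat_image (g h : R -> R * R) : g 1 = h 0 ->
  concat g h @` `[0, 1] = g @` `[0, 1] `|` h @` `[0, 1].
Proof.
move=> gh; apply/seteqP; split=> z.
  move=> [t + <-]; rewrite /= in_itv/= /concat => /andP[t0 t1].
  case: ifPn => [t2|]; last rewrite -ltNge => t2.
    by left; exists (2 * t) => //=; rewrite in_itv/=; lra.
  by right; exists (2 * t - 1) => //=; rewrite in_itv/=; lra.
case=> -[t + <-]; rewrite /= in_itv/= => /andP[t0 t1].
  exists (t / 2); first by rewrite /= in_itv/=; lra.
  by rewrite /concat ifT; [congr g; lra|lra].
have [t2|t2] := ltP 0 t.
  exists ((t + 1) / 2); first by rewrite /= in_itv/=; lra.
  by rewrite /concat ifF; [congr h; lra|apply/negbTE; rewrite -ltNge; lra].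
exists (1 / 2); first by rewrite /= in_itv/=; lra.
rewrite /concat lexx (_ : t = 0); last by lra.
by rewrite -gh; congr g; lra.
Qed.

Lemma concat_continuous (g h : R -> R * R) : g 1 = h 0 ->
  {within `[0, 1], continuous g} -> {within `[0, 1], continuous h} ->
  {within `[0, 1], continuous (concat g h)}.
Proof.
move=> gh cg ch.
have -> : `[0, 1]%classic = `[0, 1 / 2]%classic `|` `[1 / 2, 1]%classic :> set R.
  apply/seteqP; split=> t /=; rewrite !in_itv/=.
    by move=> /andP[h0 h1]; have [l|/ltW l] := leP t (1/2); [left|right]; lra.
  by case=> /andP[h0 h1]; lra.
have aff (u v : R) : continuous (fun t : R => u * t + v).
  move=> t; apply: cvgD; last exact: cvg_cst.
  by apply: cvgM; [exact: cvg_cst|exact: cvg_id].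
have comp (k : R -> R * R) (u v a b : R) : {within `[0, 1], continuous k} ->
    (forall t, a <= t <= b -> 0 <= u * t + v <= 1) ->
    {within `[a, b], continuous (fun t => k (u * t + v))}.
  move=> ck sub; apply/withinP => t; rewrite /= in_itv/= => abt W Wt.
  have It : `[0 : R, 1]%classic (u * t + v) by rewrite /= in_itv/=; exact: sub.
  have nW := (withinP _ _).1 ck _ It W Wt.
  have {}nW : \forall w \near (u * t + v), `[0 : R, 1]%classic w -> W (k w) by [].
  have := aff u v t _ nW; apply: (@filterS _ (nbhs t) (nbhs_filter t)) => r hr; rewrite /= in_itv/= => abr; apply: hr.
  by rewrite /= in_itv/=; exact: sub.
have cl : {within `[0, 1 / 2], continuous (concat g h)}.
  have L : {within `[0, 1 / 2], continuous (fun t : R => g (2 * t + 0))}.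
    by apply: comp => // t; lra.
  by apply: within_eq L => t /=; rewrite in_itv/= /concat addr0 => /andP[_ ->].
have cr : {within `[1 / 2, 1], continuous (concat g h)}.
  have L : {within `[1 / 2, 1], continuous (fun t : R => h (2 * t + - 1))}.
    by apply: comp => // t; lra.
  apply: within_eq L => t /=; rewrite in_itv/= /concat => /andP[t2 t1]; case: ifPn => // t2'.
  rewrite (_ : t = 1 / 2); last by lra.
  rewrite (_ : 2 * (1 / 2) - 1 = 0); last by lra.
  by rewrite -gh; congr g; lra.
by apply: withinU_continuous cl cr; exact: interval_closed.
Qed.

Lemma concat_arc A B a b c : arc_between A a b -> arc_between B b c ->
  A `&` B = [set b] -> arc_between (A `|` B) a c.
Proof.
move=> [g [cg ig g0 g1 ->]] [h [ch ih h0 h1 ->]] I.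
have gh : g 1 = h 0 by rewrite g1 h0.
exists (concat g h); split.
- exact: concat_continuous.
- have key s t : 0 <= s <= 1 -> 0 <= t <= 1 -> concat g h s = concat g h t -> s < t -> False.
    move=> /andP[s0 s1] /andP[t0 t1] + st; rewrite /concat.
    case: ifPn => s2; case: ifPn => t2 e.
    + have : 2 * s = 2 * t by apply: ig e; rewrite inE/= in_itv/=; lra.
      by lra.
    + have : (g @` `[0, 1] `&` h @` `[0, 1]) (h (2 * t - 1)).
        move: t2; rewrite -ltNge => t2.
        by split; [exists (2 * s) => //=; rewrite in_itv/=; lra|
                   exists (2 * t - 1) => //=; rewrite in_itv/=; lra].
      move: t2; rewrite -ltNge I => t2 /= e'.
      have : 2 * t - 1 = 0 by apply: ih; rewrite ?inE/= ?in_itv/= ?h0//; lra.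
      by lra.
    + have : s < s; [by move: s2; rewrite -ltNge => s2; lra|by rewrite ltxx].
    + have : 2 * s - 1 = 2 * t - 1.
        by move: s2 t2; rewrite -!ltNge => s2 t2; apply: ih e; rewrite inE/= in_itv/=; lra.
      by lra.
  move=> s t; rewrite !inE/= !in_itv/= => sI tI e.
  have [l|l|//] := ltgtP s t; exfalso; first exact: key l.
  exact: key (esym e) l.
- by rewrite /concat ifT; [rewrite mulr0|lra].
- rewrite /concat ifF; last by apply/negbTE; rewrite -ltNge; lra.
  by rewrite -h1; congr h; lra.
- by rewrite concat_image.
Qed.

Lemma concat_loop A B a b : a != b -> arc_between A a b -> arc_between B b a ->
  A `&` B = [set a; b] -> exists2 g, is_loop g & A `|` B = g @` `[0, 1].
Proof.
move=> ab [g [cg ig g0 g1 ->]] [h [ch ih h0 h1 ->]] I.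
have gh : g 1 = h 0 by rewrite g1 h0.
exists (concat g h); last by rewrite concat_image.
have E0 : concat g h 0 = g 0 by rewrite /concat ifT; [rewrite mulr0|lra].
have E1 : concat g h 1 = h 1.
  rewrite /concat ifF; last by apply/negbTE; rewrite -ltNge; lra.
  by congr h; lra.
split; [exact: concat_continuous|by rewrite E0 E1 g0 h1|].
move=> s t s0 st t1; rewrite /concat.
case: ifPn => s2; case: ifPn => t2 e.
- have : 2 * s = 2 * t by apply: ig e; rewrite inE/= in_itv/=; lra.
  by lra.
- move: t2; rewrite -ltNge => t2.
  have : (g @` `[0, 1] `&` h @` `[0, 1]) (h (2 * t - 1)).
    by split; [exists (2 * s) => //=; rewrite in_itv/=; lra|
               exists (2 * t - 1) => //=; rewrite in_itv/=; lra].
  rewrite I => -[] /= e'.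
    have E : 2 * t - 1 = 1 by apply: ih; rewrite ?inE/= ?in_itv/= ?h1//; lra.
    have : 2 * s = 0 by apply: ig; rewrite ?inE/= ?in_itv/= ?g0 ?e//; lra.
    by lra.
  have : 2 * t - 1 = 0 by apply: ih; rewrite ?inE/= ?in_itv/= ?h0//; lra.
  by lra.
- have : s < s; [by move: s2; rewrite -ltNge => s2; lra|by rewrite ltxx].
- have : 2 * s - 1 = 2 * t - 1.
    by move: s2 t2; rewrite -!ltNge => s2 t2; apply: ih e; rewrite inE/= in_itv/=; lra.
  by lra.
Qed.

Lemma arc_compact A a b : arc_between A a b -> compact A.
Proof. by move=> [g [cg _ _ _ ->]]; apply: image_itv_compact cg _ _. Qed.

Lemma arc_connected A a b : arc_between A a b -> connected A.
Proof.
move=> [g [cg _ _ _ ->]]; apply: connected_continuous_connected cg.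
exact: segment_connected.
Qed.

Lemma arc_interior_connected A a b : arc_between A a b -> connected (A `\` [set a; b]).
Proof.
move=> [g [cg ig g0 g1 ->]].
have -> : g @` `[0, 1] `\` [set a; b] = g @` `]0, 1[.
  apply/seteqP; split=> z.
    move=> [[t + <-] nz]; rewrite /= in_itv/= => /andP[t0 t1]; exists t => //=.
    rewrite in_itv/= !lt_neqAle t0 t1 !andbT; apply/andP; split.
      by apply/eqP => e; apply: nz; left; rewrite -e.
    by apply/eqP => e; apply: nz; right; rewrite e.
  move=> [t + <-]; rewrite /= in_itv/= => /andP[t0 t1].
  split; first by exists t => //=; rewrite in_itv/= !ltW.
  case=> /= e.
    have : t = 0 by apply: ig; rewrite ?inE/= ?in_itv/= ?g0//; lra.
    by lra.
  have : t = 1 by apply: ig; rewrite ?inE/= ?in_itv/= ?g1//; lra.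
  by lra.
apply: image_itv_connected cg _ => t /=; rewrite !in_itv/=; lra.
Qed.

End Concat.

(** * Curves traced by paths and cycles of the graph *)

Section Drawing.
Context {R : realType} {G : sgraph} (E : plane_embedding R G).
Implicit Types (u v w x y : G) (p q : seq G) (z : R * R).

Definition open_edge u v : set (R * R) := earc E u v @` `]0, 1[.

Lemma edge_curveP u v z : adj u v ->
  edge_curve E u v z <-> [\/ z = vpoint E u, z = vpoint E v | open_edge u v z].
Proof.
move=> uv; split.
  move=> [t + <-]; rewrite /= in_itv/= => /andP[t0 t1].
  have [->|n0] := eqVneq t 0; first by constructor 1; rewrite arc_start.
  have [->|n1] := eqVneq t 1; first by constructor 2; rewrite arc_end.
  by constructor 3; exists t => //=; rewrite in_itv/= !lt_neqAle eq_sym n0 n1 t0.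
case=> [->|->|[t + <-]].
- by exists 0; rewrite /= ?in_itv/= ?lexx ?ler01// arc_start.
- by exists 1; rewrite /= ?in_itv/= ?lexx ?ler01// arc_end.
- by rewrite /= in_itv/= => /andP[h1 h2]; exists t => //=; rewrite in_itv/= !ltW.
Qed.

Lemma open_edgeC u v z : adj u v -> open_edge u v z -> open_edge v u z.
Proof.
move=> uv zuv; have vu : adj v u by rewrite adj_sym.
have : edge_curve E v u z.
  by rewrite /edge_curve (arc_rev E uv); apply/edge_curveP => //; constructor 3.
move=> /(edge_curveP _ vu)[e|e|//]; rewrite e in zuv; by case: (arc_no_vertex uv zuv).
Qed.

Lemma open_edge_inter u v x y z : adj u v -> adj x y ->
  open_edge u v z -> open_edge x y z -> [set u; v]%SET = [set x; y]%SET.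
Proof.
move=> uv xy h1 h2; apply/eqP; apply: contraT => ne.
have : (open_edge u v `&` open_edge x y) z by [].
by rewrite /open_edge (arc_no_crossing E uv xy ne).
Qed.

Lemma open_edge_connected u v : adj u v -> connected (open_edge u v).
Proof.
move=> uv; apply: image_itv_connected (arc_continuous (p := E) uv) _.
by move=> t /=; rewrite !in_itv/= => /andP[h1 h2]; rewrite !ltW.
Qed.

Lemma edge_arc u v : adj u v -> arc_between (edge_curve E u v) (vpoint E u) (vpoint E v).
Proof.
move=> uv; exists (earc E u v); split => //.
- exact: arc_continuous.
- exact: arc_inj.
- exact: arc_start.
- exact: arc_end.
Qed.

Fixpoint path_curve x p : set (R * R) :=
  if p is y :: p' then edge_curve E x y `|` path_curve y p' else [set vpoint E x].

Definition path_edges x p := zip (x :: p) p.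

Lemma path_edges_cons x y p e :
  (e \in path_edges x (y :: p)) = (e == (x, y)) || (e \in path_edges y p).
Proof. by rewrite /path_edges /= inE. Qed.

Lemma path_edges_adj x p e : path adj x p -> e \in path_edges x p -> adj e.1 e.2.
Proof.
elim: p x => [|y p IH] x //= /andP[xy py]; rewrite path_edges_cons => /orP[/eqP->//|].
exact: IH.
Qed.

Lemma path_edges_mem x p e : e \in path_edges x p -> e.1 \in x :: p /\ e.2 \in p.
Proof.
elim: p x => [|y p IH] x //=; rewrite path_edges_cons => /orP[/eqP->|/IH[h1 h2]] /=.
  by rewrite !inE !eqxx.
by rewrite in_cons h1 orbT in_cons h2 orbT.
Qed.

Lemma path_curveP x p z : path adj x p -> path_curve x p z ->
  (exists2 w, w \in x :: p & z = vpoint E w) \/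
  (exists2 e, e \in path_edges x p & open_edge e.1 e.2 z).
Proof.
elim: p x => [|y p IH] x /=; first by move=> _ ->; left; exists x; rewrite // inE.
move=> /andP[xy py] [/(edge_curveP _ xy)[->|->|h]|/(IH _ py)[[w wp ->]|[e ep h]]].
- by left; exists x; rewrite // inE eqxx.
- by left; exists y; rewrite // !inE eqxx orbT.
- by right; exists (x, y); rewrite // path_edges_cons eqxx.
- by left; exists w => //; rewrite in_cons wp orbT.
- by right; exists e => //; rewrite path_edges_cons ep orbT.
Qed.

Lemma path_curve_vertex x p w : path adj x p -> w \in x :: p -> path_curve x p (vpoint E w).
Proof.
elim: p x => [|y p IH] x /=; first by rewrite inE => _ /eqP->.
move=> /andP[xy py]; rewrite in_cons => /orP[/eqP->|/IH h]; last by right; exact: h.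
by left; apply/edge_curveP => //; constructor 1.
Qed.

Lemma path_curve_open_edge x p e : path adj x p -> e \in path_edges x p ->
  open_edge e.1 e.2 `<=` path_curve x p.
Proof.
elim: p x => [|y p IH] x //= /andP[xy py]; rewrite path_edges_cons.
move=> /orP[/eqP->|/(IH _ py) h] z hz; last by right; exact: h.
by left; apply/edge_curveP => //; constructor 3.
Qed.

Lemma path_curve_vertexP x p w : path adj x p -> path_curve x p (vpoint E w) -> w \in x :: p.
Proof.
move=> px /(path_curveP px)[[w' h /vpoint_inj->//]|[e ep /(arc_no_vertex)[]]].
exact: path_edges_adj ep.
Qed.

Lemma path_curve_drawing x p : path adj x p -> path_curve x p `<=` drawing E.
Proof.
move=> px z /(path_curveP px)[[w _ ->]|[e ep h]]; first by left; exists w.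
right; exists e.1, e.2; have a := path_edges_adj px ep; split => //.
by apply/edge_curveP => //; constructor 3.
Qed.

Lemma path_curve_inter x p y q z : path adj x p -> path adj y q ->
  (forall e f, e \in path_edges x p -> f \in path_edges y q ->
    [set e.1; e.2]%SET != [set f.1; f.2]%SET) ->
  path_curve x p z -> path_curve y q z ->
  exists w, [/\ w \in x :: p, w \in y :: q & z = vpoint E w].
Proof.
move=> px qy ne /(path_curveP px)[[w wp ->]|[e ep he]].
  by move=> /(path_curve_vertexP qy) wq; exists w.
move=> /(path_curveP qy)[[w wp e']|[f fq hf]].
  by rewrite e' in he; case: (arc_no_vertex (path_edges_adj px ep) he).
have := ne e f ep fq.
by rewrite (open_edge_inter (path_edges_adj px ep) (path_edges_adj qy fq) he hf) eqxx.
Qed.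

Lemma path_edges_ends x p e : uniq (x :: p) -> (1 < size p)%N -> e \in path_edges x p ->
  [set e.1; e.2]%SET != [set x; last x p]%SET.
Proof.
case: p => [|a [|b p]] //= /andP[xp /andP[ap _]] _.
rewrite path_edges_cons => /orP[/eqP->|ep] /=; apply/eqP => eq.
  have : a \in [set x; last b p]%SET by rewrite -eq !inE eqxx orbT.
  rewrite !inE => /orP[/eqP e1|/eqP e1].
    by move: xp; rewrite e1 inE eqxx.
  by move: ap; rewrite e1 mem_last.
have [h1 h2] := path_edges_mem ep.
have : x \in [set e.1; e.2]%SET by rewrite eq !inE eqxx.
rewrite !inE => /orP[/eqP e1|/eqP e1]; move: xp.
  by rewrite e1 h1.
by rewrite e1 in_cons h2 orbT.
Qed.

(** A common edge would have both ends among the common vertices, hence join the two ends of the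
    first path; a simple path with at least two edges contains no such edge. *)
Lemma path_curve_meet x p y q z : path adj x p -> path adj y q -> uniq (x :: p) ->
  (1 < size p)%N ->
  (forall w, w \in x :: p -> w \in y :: q -> w = x \/ w = last x p) ->
  path_curve x p z -> path_curve y q z -> z = vpoint E x \/ z = vpoint E (last x p).
Proof.
move=> px qy u sz I h1 h2.
have [|w [w1 w2 ->]] := path_curve_inter px qy _ h1 h2; last first.
  by have [->|->] := I w w1 w2; [left|right].
move=> e f ep fq; apply: contraNneq (path_edges_ends u sz ep) => ef.
have [e1 e2] := path_edges_mem ep; have [f1 f2] := path_edges_mem fq.
have inf a : a \in [set e.1; e.2]%SET -> a = x \/ a = last x p.
  move=> h; have h' := h; rewrite ef in h'.
  have h1' : (a == e.1) || (a == e.2) by move: h; rewrite !inE.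
  have h2' : (a == f.1) || (a == f.2) by move: h'; rewrite !inE.
  apply: I; first by case/orP: h1' => /eqP->//; rewrite in_cons e2 orbT.
  by case/orP: h2' => /eqP->//; rewrite in_cons f2 orbT.
have ne : e.1 != e.2.
  by apply/eqP => e0; have := path_edges_adj px ep; rewrite e0 adj_irrefl.
have i1 : e.1 = x \/ e.1 = last x p by apply: inf; rewrite !inE eqxx.
have i2 : e.2 = x \/ e.2 = last x p by apply: inf; rewrite !inE eqxx orbT.
case: i1 i2 => e1' [e2''|e2'']; rewrite ?e1' ?e2''//.
- by move: ne; rewrite e1' e2'' eqxx.
- by rewrite finset.setUC.
- by move: ne; rewrite e1' e2'' eqxx.
Qed.

Lemma path_arc x p : path adj x p -> uniq (x :: p) -> p != [::] ->
  arc_between (path_curve x p) (vpoint E x) (vpoint E (last x p)).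
Proof.
elim: p x => [|y p IH] x //= /andP[xy py] /andP[xp up] _.
have [->|p0] := eqVneq p [::].
  rewrite (_ : _ `|` _ = edge_curve E x y); first exact: edge_arc.
  apply/seteqP; split=> z; last by left.
  by case=> // ->; apply/edge_curveP => //; constructor 2.
apply: concat_arc (edge_arc xy) (IH _ py up p0) _.
apply/seteqP; split=> [z [h1 h2]|_ ->]; last first.
  split; first by apply/edge_curveP => //; constructor 2.
  by apply: path_curve_vertex => //; rewrite inE eqxx.
have [|||w [w1 w2 ->]] := @path_curve_inter x [:: y] y p z _ py _ _ h2.
- by rewrite /= xy.
- move=> e f; rewrite path_edges_cons orbF => /eqP-> fp; apply/eqP => /= eq.
  have [f1 f2] := path_edges_mem fp.
  have : x \in [set f.1; f.2]%SET by rewrite -eq !inE eqxx.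
  rewrite !inE => /orP[/eqP e1|/eqP e1]; move: xp.
    by rewrite e1 f1.
  by rewrite e1 in_cons f2 orbT.
- by left.
- move: w1; rewrite !inE => /orP[/eqP e1|/eqP->//].
  by move: xp; rewrite -e1 w2.
Qed.

Lemma path_curve_cat x p q : path adj x (p ++ q) ->
  path_curve x (p ++ q) = path_curve x p `|` path_curve (last x p) q.
Proof.
elim: p x => [|y p IH] x /=; last by move=> /andP[_ /IH ->]; rewrite setUA.
move=> px; apply/seteqP; split=> z; first by right.
by case=> // ->; apply: path_curve_vertex => //; rewrite inE eqxx.
Qed.

Definition cycle_curve (c : seq G) : set (R * R) :=
  [set z | exists2 x, x \in c & edge_curve E x (next c x) z].

(** The closing edge comes from a default value: [next] looks up the successor of the last vertex
    beyond the end of [p], where [nth] returns [x]. *)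
Lemma path_edges_cycle x p e : uniq (x :: p) ->
  e \in path_edges x (rcons p x) <-> e.1 \in x :: p /\ e.2 = next (x :: p) e.1.
Proof.
move=> u; have NE a : next (x :: p) a = if a \in x :: p then nth x p (index a (x :: p)) else a.
  by rewrite next_nth.
move: NE; set N := next (x :: p); move: N => N NE.
split.
  move=> /(nthP (x, x))[i ip <-]; rewrite size_zip /= size_rcons minnC (minn_idPl _)// in ip.
  rewrite nth_zip_cond size_zip /= size_rcons minnC (minn_idPl _)// ip.
  rewrite [(_, _).1]/= [(_, _).2]/= NE.
  have ip' : (i < size (x :: p))%N by [].
  have -> : nth x (x :: rcons p x) i = nth x (x :: p) i.
    by rewrite -rcons_cons nth_rcons ip'.
  split; first exact: mem_nth.
  rewrite mem_nth// index_uniq// nth_rcons.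
  case: ltngtP => // h; last by rewrite nth_default// h.
  by move: ip; rewrite ltnS leqNgt h.
rewrite NE; move: NE => _; case: e => a b [] /[swap]; rewrite [(a, b).1]/= [(a, b).2]/= => -> ac.
rewrite ac; pose i := index a (x :: p).
have ip : (i < (size p).+1)%N by rewrite -[(size p).+1]/(size (x :: p)) index_mem.
apply/(nthP (x, x)); exists i.
  by rewrite size_zip /= size_rcons minnC (minn_idPl _).
rewrite nth_zip_cond size_zip /= size_rcons minnC (minn_idPl _)// ip.
congr pair; first by rewrite -rcons_cons nth_rcons /= ip nth_index.
rewrite nth_rcons -/i.
case: ltngtP => // h; first by move: ip; rewrite ltnS leqNgt h.
by rewrite -[X in nth x p X]/i nth_default// h.
Qed.

Lemma cycle_curveE x p : ucycle adj (x :: p) ->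
  cycle_curve (x :: p) = path_curve x (rcons p x).
Proof.
move=> /andP[cy u]; apply/seteqP; split=> z.
  move=> [a ac h].
  have ep : (a, next (x :: p) a) \in path_edges x (rcons p x) by apply/path_edges_cycle.
  have aa := path_edges_adj cy ep.
  have [h1 h2] := path_edges_mem ep.
  case/(edge_curveP _ aa): h => [->|->|h].
  - exact: path_curve_vertex.
  - by apply: path_curve_vertex => //; rewrite in_cons h2 orbT.
  - exact: (path_curve_open_edge cy ep).
have nx a : a \in x :: p -> adj a (next (x :: p) a).
  by move=> ac; apply: next_cycle.
move=> /(path_curveP cy)[[w wp ->]|[e ep he]].
  have wc : w \in x :: p by move: wp; rewrite in_cons mem_rcons => /orP[/eqP->|]; rewrite // inE eqxx.
  by exists w => //; apply/edge_curveP; [exact: nx|constructor 1].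
have [e1 e2] := (path_edges_cycle e u).1 ep.
by exists e.1 => //; rewrite -e2; apply/edge_curveP; [exact: path_edges_adj ep|constructor 3].
Qed.

Lemma two_arcs x p1 y p2 : ucycle adj (x :: p1 ++ y :: p2) ->
  (2 < size (x :: p1 ++ y :: p2))%N ->
  [/\ arc_between (path_curve x (rcons p1 y)) (vpoint E x) (vpoint E y),
      arc_between (path_curve y (rcons p2 x)) (vpoint E y) (vpoint E x),
      path_curve x (rcons p1 y) `&` path_curve y (rcons p2 x) = [set vpoint E x; vpoint E y] &
      cycle_curve (x :: p1 ++ y :: p2) = path_curve x (rcons p1 y) `|` path_curve y (rcons p2 x)].
Proof.
move=> uc; have /andP[cy u] := uc => sz.
have E1 : rcons (p1 ++ y :: p2) x = rcons p1 y ++ rcons p2 x.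
  by rewrite -cats1 -catA /= cats1 -cat_rcons.
move: (cy); rewrite /= E1 cat_path last_rcons => /andP[c1 c2].
have [u1 u2] : uniq (x :: rcons p1 y) /\ uniq (y :: rcons p2 x).
  move: u; rewrite /= mem_cat inE !negb_or cat_uniq /= negb_or => /andP[/and3P[a1 a2 a3]].
  move=> /and3P[b1 /andP[b2 b3] /andP[b4 b5]].
  by rewrite !rcons_uniq !mem_rcons !inE !negb_or a1 a2 a3 b1 b2 b4 b5 eq_sym a2.
have rc q w : rcons q w != [::] by case: q.
have A1 := path_arc c1 u1 (rc p1 y).
have A2 := path_arc c2 u2 (rc p2 x).
rewrite last_rcons in A1; rewrite last_rcons in A2.
split => //; last first.
  by rewrite cycle_curveE// E1 path_curve_cat ?last_rcons// -E1.
have I w : w \in x :: rcons p1 y -> w \in y :: rcons p2 x -> w = x \/ w = y.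
  rewrite !in_cons !mem_rcons !in_cons => /or3P[/eqP->|/eqP->|w1]; [by left|by right|].
  move=> /or3P[/eqP->|/eqP->|w2]; [by right|by left|].
  move: u; rewrite /= cat_uniq => /and4P[_ _ /hasPn/(_ w) + _].
  by rewrite in_cons w2 orbT => /(_ isT); rewrite /= w1.
apply/seteqP; split=> z.
  move=> [h1 h2].
  (* The cycle has at least three vertices, so one of its two paths has at least two edges and can
     play the first role in [path_curve_meet]. *)
  have : (1 < size (rcons p1 y))%N \/ (1 < size (rcons p2 x))%N.
    by move: sz; rewrite /= size_cat /= !size_rcons; case: (p1) (p2) => [|? ?] [|? ?] //=; [right|left|left].
  case=> s.
    have [|->|->] := path_curve_meet c1 c2 u1 s _ h1 h2; rewrite ?last_rcons//; by [left|right].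
  have [|->|->] := path_curve_meet c2 c1 u2 s _ h2 h1; rewrite ?last_rcons; [|by right|by left].
  by move=> w w1 w2; have [->|->] := I w w2 w1; [right|left].
by case=> ->; split; apply: path_curve_vertex; rewrite ?inE ?mem_rcons ?inE ?eqxx ?orbT.
Qed.

Lemma cycle_loop c : ucycle adj c -> (2 < size c)%N ->
  exists2 g, is_loop g & cycle_curve c = g @` `[0, 1].
Proof.
case: c => [|x [|y p]] // uc sz.
have [A1 A2 I ->] := @two_arcs x [::] y p uc sz.
apply: concat_loop A1 A2 I.
by move: uc => /andP[_ /= /andP[+ _]]; rewrite inE negb_or (inj_eq (@vpoint_inj _ _ E)) => /andP[].
Qed.

End Drawing.

(** * Faces of outerplane graphs *)

Section Theta.
Context {R : realType}.
Implicit Types (p q x y z : R * R) (A B J K U O : set (R * R)).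

(** A small ball about the common limit point [x] connects [U] to [O] off [K]. *)
Lemma unseparated_bridge K U O x p q : closed K -> connected U -> connected O ->
  U `&` K = set0 -> O `&` K = set0 -> closure U x -> closure O x -> ~ K x ->
  U p -> O q -> unseparated K p q.
Proof.
move=> clK cU cO UK OK Ux Ox nKx Up Oq.
have /nbhs_ballP[e /= e0 eK] := open_nbhs_nbhs (conj (closed_openC clK) nKx).
have [u [Uu xu]] := Ux _ (nbhsx_ballx x e e0).
have [w [Ow xw]] := Ox _ (nbhsx_ballx x e e0).
apply: (@unseparated_connected _ _ (U `|` ball x e `|` O)) => //.
- apply: connectedU => //; first by exists w; split=> //; right.
  by apply: connectedU => //; [exists u|exact: ball_connected].
- by rewrite !setIUl UK OK set0U setU0; rewrite -subset0 => z [/eK].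
- by left; left.
- by right.
Qed.

(** Without [A1] the sets [U] and [O] are joined through [x1], without [A2] through [x2]. The two
    remaining unions meet in the connected set [A3], so the angles glue over all three arcs. *)
Lemma theta_unseparated A1 A2 A3 U O x1 x2 p q :
  closed A1 -> closed A2 -> closed A3 -> connected A3 -> A1 `&` A2 `<=` A3 ->
  connected U -> connected O ->
  U `&` (A1 `|` A2 `|` A3) = set0 -> O `&` (A1 `|` A2 `|` A3) = set0 ->
  closure U x1 -> closure O x1 -> ~ (A2 `|` A3) x1 ->
  closure U x2 -> closure O x2 -> ~ (A1 `|` A3) x2 ->
  U p -> O q -> unseparated (A1 `|` A2 `|` A3) p q.
Proof.
move=> c1 c2 c3 cA3 A12 cU cO UK OK Ux1 Ox1 nx1 Ux2 Ox2 nx2 Up Oq.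
have s23 : A2 `|` A3 `<=` A1 `|` A2 `|` A3 by move=> z [|]; [left; right|right].
have s13 : A1 `|` A3 `<=` A1 `|` A2 `|` A3 by move=> z [|]; [left; left|right].
have empty V K : K `<=` A1 `|` A2 `|` A3 -> V `&` (A1 `|` A2 `|` A3) = set0 -> V `&` K = set0.
  by move=> KT VT; rewrite -subset0 -VT; exact: setIS.
have h23 : unseparated (A2 `|` A3) p q.
  by apply: (@unseparated_bridge _ U O x1) => //; [exact: closedU|exact: empty|exact: empty].
have h13 : unseparated (A1 `|` A3) p q.
  by apply: (@unseparated_bridge _ U O x2) => //; [exact: closedU|exact: empty|exact: empty].
have I : (A2 `|` A3) `&` (A1 `|` A3) = A3.
  apply/seteqP; split=> [z [[h2|//] [h1|//]]|z h]; last by split; right.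
  exact: A12.
have g : unseparated ((A2 `|` A3) `|` (A1 `|` A3)) p q.
  apply: rot_equiv_glue h23 h13; [exact: closedU|exact: closedU|by rewrite I|].
  rewrite I => z h; rewrite subr_eq0; apply/eqP => e.
  have : (O `&` (A1 `|` A2 `|` A3)) q by split=> //; right; rewrite -e.
  by rewrite OK.
apply: rot_equiv_sub g => z [[|]|]; [right; left|left; left|right; right] => //.
Qed.

Lemma arc_closure (g : R -> R * R) : {within `[0, 1], continuous g} ->
  closure (g @` `]0, 1[) (g 0) /\ closure (g @` `]0, 1[) (g 1).
Proof.
move=> cg.
have key t0 : 0 <= t0 <= 1 -> closure (g @` `]0, 1[) (g t0).
  move=> t0I N Nt.
  have It : `[0 : R, 1]%classic t0 by rewrite /= in_itv.
  have h := (withinP _ _).1 cg _ It N Nt.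
  have {h}/nbhs_ballP[d /= d0 dN] : \forall w \near t0, `[0 : R, 1]%classic w -> N (g w) by [].
  pose e := Num.min (1 / 4) (d / 2).
  have e1 : e <= 1 / 4 by rewrite ge_min lexx.
  have e2 : e <= d / 2 by rewrite ge_min lexx orbT.
  have e0 : 0 < e by rewrite lt_min !divr_gt0.
  have [t [t1 t2]] : exists t : R, 0 < t < 1 /\ `|t0 - t| < d.
    have [l|l] := leP t0 (1/2).
      by exists (t0 + e); split; [lra|rewrite ltr_norml; lra].
    by exists (t0 - e); split; [lra|rewrite ltr_norml; lra].
  exists (g t); split; first by exists t.
  by apply: dN => //=; rewrite in_itv/=; lra.
by split; apply: key; rewrite lexx ler01.
Qed.

Lemma bounded_subset U K : U `<=` K -> bounded_set K -> bounded_set U.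
Proof.
move=> UK /plane_bounded[M M0 h]; apply: (@box_bounded _ _ M) => z /UK/h[h1 h2].
by rewrite !ltW.
Qed.

End Theta.

(** * The inside of a cycle in an outerplane drawing *)

Section Outerplane.
Context {R : realType} {G : sgraph} (E : plane_embedding R G) (hE : outerplane E).
Implicit Types (u v w x y : G) (p q c : seq G) (z : R * R).

Lemma cycle_curve_drawing c : ucycle adj c -> cycle_curve E c `<=` drawing E.
Proof.
move=> /andP[cy _] z [x xc h]; right; exists x, (next c x); split => //.
exact: next_cycle.
Qed.

(** The exterior face is connected and avoids the curve, so if it met a bounded component of the
    complement it would be contained in it and be bounded. *)
Lemma outer_face_inside c (x0 : R * R) : ucycle adj c ->
  bounded_set (connected_component (~` cycle_curve E c) x0) ->
  exists F z0, [/\ F = connected_component (~` drawing E) z0, F z0,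
    (forall v, closure F (vpoint E v)) &
    F `&` connected_component (~` cycle_curve E c) x0 = set0].
Proof.
move=> uc bU; have [F [[z0 nz0 FE] unb] bF] := hE.
exists F, z0; split => //.
- by rewrite FE; exact: connected_component_refl.
- by move=> v; have [] := bF v.
rewrite -subset0 => z [Fz Uz]; apply: unb; apply: bounded_subset bU => w Fw.
apply: connected_component_trans Uz _.
exists F => //; split => //; last by rewrite FE; exact: component_connected.
rewrite FE => y /connected_component_sub nd Jy; apply: nd.
exact: cycle_curve_drawing Jy.
Qed.

(** Every vertex is a limit of points of the exterior face, which does not meet the open inside of
    the cycle. *)
Lemma vertex_not_inside c (x0 : R * R) v : ucycle adj c -> (2 < size c)%N ->
  bounded_set (connected_component (~` cycle_curve E c) x0) ->
  ~ connected_component (~` cycle_curve E c) x0 (vpoint E v).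
Proof.
move=> uc sz bU Uv; have [F [z0 [_ _ cF FU]]] := outer_face_inside uc bU.
have [g lg JE] := cycle_loop E uc sz.
have oU : open (connected_component (~` cycle_curve E c) x0).
  apply: component_open; apply: closed_openC; rewrite JE.
  by apply: compact_closed_plane; exact: loop_compact.
have [z [Fz Uz]] := cF v _ (open_nbhs_nbhs (conj oU Uv)).
have : (F `&` connected_component (~` cycle_curve E c) x0) z by [].
by rewrite FU.
Qed.

Lemma cycle_curve_vertex c v : ucycle adj c -> cycle_curve E c (vpoint E v) -> v \in c.
Proof.
move=> /andP[cy _] [x xc]; have xn : adj x (next c x) by exact: next_cycle.
move=> /(edge_curveP _ _ xn)[/vpoint_inj->//|/vpoint_inj->|/arc_no_vertex[]//].
by rewrite mem_next.
Qed.

(** The inside [U] contains no vertex. An edge entering [U] stays there up to its ends, which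
    therefore lie on the cycle; without chords it is an edge of the cycle, which is not in [U]. So
    [U] avoids the drawing and is a face. *)
Lemma chordless_face c : ucycle adj c -> (2 < size c)%N ->
  (forall u v, u \in c -> v \in c -> adj u v -> v = next c u \/ u = next c v) ->
  exists2 F, internal_face E F & bounding_cycle E F c.
Proof.
move=> uc sz chord; have /andP[cy _] := uc.
have [g lg JE] := cycle_loop E uc sz.
have cJ : closed (cycle_curve E c).
  by rewrite JE; apply: compact_closed_plane; exact: loop_compact.
have [x0] := loop_inside lg; rewrite -JE => nJx0 bU.
have Jcl := loop_boundary lg; rewrite -JE in Jcl.
have {}Jcl := Jcl x0 nJx0 bU.
set J := cycle_curve E c in cJ nJx0 bU Jcl JE *.
set U := connected_component (~` J) x0 in bU Jcl *.
have oU : open U by apply: component_open; exact: closed_openC.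
have UJ z : U z -> ~ J z by move=> /connected_component_sub.
have Ux0 : U x0 by exact: connected_component_refl.
have nvU v : ~ U (vpoint E v) by exact: vertex_not_inside.
have nx x : x \in c -> adj x (next c x) by move=> xc; exact: next_cycle.
have neU u v z : adj u v -> open_edge E u v z -> ~ U z.
  move=> uv zuv Uz.
  have inJ x : x \in c -> [set u; v]%SET = [set x; next c x]%SET -> False.
    move=> xc eq; apply: (UJ z Uz); exists x => //; apply/edge_curveP; first exact: nx.
    constructor 3.
    have : u \in [set x; next c x]%SET by rewrite -eq !inE eqxx.
    have : v \in [set x; next c x]%SET by rewrite -eq !inE eqxx orbT.
    rewrite !inE => /orP[/eqP ev|/eqP ev] /orP[/eqP eu|/eqP eu].
    - by move: uv; rewrite eu ev adj_irrefl.
    - by rewrite -eu -ev; exact: open_edgeC.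
    - by rewrite -ev -eu.
    - by move: uv; rewrite eu ev adj_irrefl.
  have disj (w : R * R) : open_edge E u v w -> ~ J w.
    move=> wuv [x xc /(edge_curveP _ _ (nx x xc))[e|e|h]].
    - by rewrite e in wuv; case: (arc_no_vertex uv wuv).
    - by rewrite e in wuv; case: (arc_no_vertex uv wuv).
    - exact: (inJ x xc (open_edge_inter uv (nx x xc) wuv h)).
  have sub : open_edge E u v `<=` U.
    move=> w wuv; apply: connected_component_trans Uz _.
    by exists (open_edge E u v) => //; split => //; exact: open_edge_connected.
  have [cl0 cl1] := arc_closure (arc_continuous (p := E) uv).
  have inc w : closure (open_edge E u v) (vpoint E w) -> w \in c.
    move=> /(closureS sub)/(component_boundary cJ)[/nvU//|].
    exact: cycle_curve_vertex.
  have uc' : u \in c by apply: inc; rewrite -(arc_start E uv).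
  have vc' : v \in c by apply: inc; rewrite -(arc_end E uv).
  have [e|e] := chord u v uc' vc' uv; first by apply: (inJ u uc'); rewrite e.
  by apply: (inJ v vc'); rewrite e finset.setUC.
have Udr z : U z -> ~ drawing E z.
  move=> Uz [[v _ e]|[u [v [uv]]]]; first by apply: (nvU v); rewrite e.
  move=> /(edge_curveP _ _ uv)[e|e|h]; last exact: (neU u v z uv h).
    by apply: (nvU u); rewrite -e.
  by apply: (nvU v); rewrite -e.
have UE : U = connected_component (~` drawing E) x0.
  apply/seteqP; split.
    apply: connected_component_max => //; exact: component_connected.
  apply: connected_component_max; last exact: component_connected.
    by apply: connected_component_refl; exact: Udr.
  move=> w /connected_component_sub nd Jw; apply: nd.
  exact: cycle_curve_drawing Jw.
exists U.
  by split=> //; exists x0 => //; exact: Udr.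
split => //; rewrite /boundary -/(J) (interior_id U).1//.
apply/seteqP; split=> [z [/(component_boundary cJ)[//|//] ]|z Jz].
by split; [exact: Jcl|move=> /UJ].
Qed.

(** The third path has an inner vertex, and this is not inside the cycle, so its whole curve stays
    out of the inside [U]. Now [U] and the exterior face both accumulate at a vertex of [p1] and at
    a vertex of [p2], so by [theta_unseparated] the three curves do not separate them. But the cycle
    alone does. *)
Lemma no_theta x p1 y p2 r : p1 != [::] -> p2 != [::] -> r != [::] ->
  ucycle adj (x :: p1 ++ y :: p2) -> path adj x (rcons r y) -> uniq r ->
  (forall w, w \in r -> w \notin x :: p1 ++ y :: p2) -> False.
Proof.
move=> p10 p20 r0 uc pr ur rc.
have sz : (2 < size (x :: p1 ++ y :: p2))%N.
  by rewrite /= size_cat /=; case: (p1) p10 => //= ? ? _; rewrite addnS.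
have [A1 A2 I12 cE] := two_arcs E uc sz.
have /andP[cy u] := uc.
have xy : x != y.
  by move: u => /= /andP[+ _]; rewrite mem_cat !inE !negb_or => /and3P[].
have urx : uniq (x :: rcons r y).
  rewrite /= rcons_uniq ur andbT mem_rcons inE negb_or xy /=; apply/andP; split.
    by apply/negP => /rc; rewrite inE eqxx.
  by apply/negP => /rc; rewrite in_cons mem_cat in_cons eqxx !orbT.
have rcn (s : seq G) w : rcons s w != [::] by case: s.
have A3 := path_arc E pr urx (rcn r y); rewrite last_rcons in A3.
have E1 : rcons (p1 ++ y :: p2) x = rcons p1 y ++ rcons p2 x.
  by rewrite -cats1 -catA /= cats1 -cat_rcons.
move: (cy); rewrite /= E1 cat_path last_rcons => /andP[c1 c2].
have szr : (1 < size (rcons r y))%N by rewrite size_rcons; case: (r) r0.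
set B1 := path_curve E x (rcons p1 y) in A1 I12 cE *.
set B2 := path_curve E y (rcons p2 x) in A2 I12 cE *.
set B3 := path_curve E x (rcons r y) in A3 *.
have onlyends w : w \in x :: rcons r y -> w \in x :: p1 ++ y :: p2 -> w = x \/ w = y.
  rewrite in_cons mem_rcons in_cons => /or3P[/eqP->|/eqP->|/rc/negP//]; by [left|right].
have I31 z : B3 z -> B1 z -> z = vpoint E x \/ z = vpoint E y.
  move=> h3 h1; have := path_curve_meet pr c1 urx szr _ h3 h1; rewrite last_rcons; apply.
  move=> w w1 w2; apply: onlyends => //.
  by move: w2; rewrite !in_cons mem_rcons mem_cat !in_cons => /or3P[->|->|->]; rewrite ?orbT.
have I32 z : B3 z -> B2 z -> z = vpoint E x \/ z = vpoint E y.
  move=> h3 h2; have := path_curve_meet pr c2 urx szr _ h3 h2; rewrite last_rcons; apply.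
  move=> w w1 w2; apply: onlyends => //.
  by move: w2; rewrite !in_cons mem_rcons mem_cat !in_cons => /or3P[->|->|->]; rewrite ?orbT.
have [g lg JE] := cycle_loop E uc sz.
have [x0] := loop_inside lg; rewrite -JE => nJx0 bU.
have Jcl := loop_boundary lg; rewrite -JE in Jcl.
have {}Jcl := Jcl x0 nJx0 bU.
have [F [z0 [FE Fz0 cF FU]]] := outer_face_inside uc bU.
have nvU v := vertex_not_inside (v := v) uc sz bU.
set J := cycle_curve E _ in bU Jcl JE FU nJx0 nvU cE.
set U := connected_component (~` J) x0 in bU Jcl FU nvU.
have k1 := arc_compact A1; have k2 := arc_compact A2; have k3 := arc_compact A3.
have cl1 := compact_closed_plane k1; have cl2 := compact_closed_plane k2.
have cl3 := compact_closed_plane k3.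
have cJ : closed J by rewrite cE; exact: closedU.
have oU : open U by apply: component_open; exact: closed_openC.
have UJ z : U z -> ~ J z by move=> /connected_component_sub.
have Ux0 : U x0 by exact: connected_component_refl.
have U3 z : U z -> ~ B3 z.
  move=> Uz h3.
  have ends (t : R * R) : [set vpoint E x; vpoint E y] t -> J t.
    by rewrite -I12 cE => -[]; left.
  have nends : ~ [set vpoint E x; vpoint E y] z by move=> /ends; exact: UJ.
  have con3 := arc_interior_connected A3.
  have {con3} sub : B3 `\` [set vpoint E x; vpoint E y] `<=` U.
    move=> t t3; apply: connected_component_trans Uz _.
    exists (B3 `\` [set vpoint E x; vpoint E y]) => //; split => // s [h ns] Js.
    apply: ns; move: Js; rewrite cE => -[h'|h'].
      by have [->|->] := I31 s h h'; [left|right].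
    by have [->|->] := I32 s h h'; [left|right].
  have [a ar] : exists a, a \in r by case: (r) r0 => // a ? _; exists a; rewrite inE eqxx.
  apply: (nvU a); apply: sub; split.
    by apply: (path_curve_vertex E pr); rewrite in_cons mem_rcons in_cons ar !orbT.
  have ac := rc a ar.
  move=> /ends/cycle_curve_vertex h; move: ac; by rewrite h.
have Fdr z : F z -> ~ drawing E z by rewrite FE => /connected_component_sub.
have D1 : B1 `<=` drawing E by exact: path_curve_drawing.
have D2 : B2 `<=` drawing E by exact: path_curve_drawing.
have D3 : B3 `<=` drawing E by exact: path_curve_drawing.
have Jv v : v \in x :: p1 ++ y :: p2 -> J (vpoint E v).
  move=> vc; exists v => //; apply/edge_curveP; last by constructor 1.
  exact: next_cycle.
have nUz0 : ~ U z0.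
  by move=> Uz; have : (F `&` U) z0 by []; rewrite FU.
have nJz0 : ~ J z0 by move=> Jz; exact: (Fdr z0 Fz0 (cycle_curve_drawing uc Jz)).
have : unseparated (B1 `|` B2 `|` B3) x0 z0.
  have [a ap] : exists a, a \in p1 by case: (p1) p10 => // a ? _; exists a; rewrite inE eqxx.
  have [b bp] : exists b, b \in p2 by case: (p2) p20 => // b ? _; exists b; rewrite inE eqxx.
  have ac : a \in x :: p1 ++ y :: p2 by rewrite in_cons mem_cat ap orbT.
  have bc : b \in x :: p1 ++ y :: p2 by rewrite in_cons mem_cat in_cons bp !orbT.
  move: (u); rewrite /= mem_cat in_cons !negb_or cat_uniq => /andP[/and3P[xp1 _ xp2]].
  move=> /and3P[up1 /hasPn h12 /andP[yp2 _]].
  have yp1 : y \notin p1 by apply: h12; rewrite inE eqxx.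
  have ax : a != x by apply: contraNneq xp1 => <-.
  have ay : a != y by apply: contraNneq yp1 => <-.
  have bx : b != x by apply: contraNneq xp2 => <-.
  have by_ : b != y by apply: contraNneq yp2 => <-.
  have ap2 : a \notin p2.
    by apply/negP => h; have := h12 a; rewrite in_cons h orbT => /(_ isT); rewrite /= ap.
  have bp1 : b \notin p1 by apply: h12; rewrite in_cons bp orbT.
  have n3 w : w \in x :: p1 ++ y :: p2 -> w != x -> w != y -> ~ B3 (vpoint E w).
    move=> wc wx wy /(path_curve_vertexP pr) /onlyends /(_ wc)[] e.
      by rewrite e eqxx in wx.
    by rewrite e eqxx in wy.
  apply: (@theta_unseparated _ B1 B2 B3 U F (vpoint E a) (vpoint E b)) => //.
  - exact: arc_connected A3.
  - rewrite I12 => _ [|] ->; apply: path_curve_vertex => //.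
      by rewrite inE eqxx.
    by rewrite in_cons mem_rcons inE eqxx orbT.
  - exact: component_connected.
  - by rewrite FE; exact: component_connected.
  - rewrite -subset0 => z [Uz [h|h]]; last exact: (U3 z Uz h).
    by apply: (UJ z Uz); rewrite cE.
  - by rewrite -subset0 => z [/Fdr nd [[/D1|/D2]|/D3]].
  - by apply: Jcl; exact: Jv.
  - case=> [/(path_curve_vertexP c2)|]; last exact: n3.
    by rewrite in_cons mem_rcons in_cons (negbTE ax) (negbTE ay) (negbTE ap2).
  - by apply: Jcl; exact: Jv.
  - case=> [/(path_curve_vertexP c1)|]; last exact: n3.
    by rewrite in_cons mem_rcons in_cons (negbTE bx) (negbTE by_) (negbTE bp1).
move=> h; apply: (separation _ oU bU (component_boundary cJ) _ Ux0 nUz0 nJz0).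
- by rewrite cE; exact: compactU.
- by rewrite -subset0 => z [/UJ].
- by rewrite cE; apply: rot_equiv_sub h => z; left.
Qed.

End Outerplane.

End PlaneTopology.

Section Combinatorics.
Local Open Scope classical_set_scope.
Local Open Scope ring_scope.
Local Open Scope nat_scope.

(** * Distances and levels *)

Lemma connect_leaves (T : finType) (e : rel T) (A : {set T}) a b :
  connect e a b -> a \in A -> b \notin A ->
  exists x y, [/\ x \in A, y \notin A, e x y & connect e a x].
Proof.
move=> /connectP[p pp ->]; elim: p a pp => [|c p IH] a /=; first by move=> _ ->.
move=> /andP[ac cp] aA bA; have [cA|cA] := boolP (c \in A).
  have [x [y [xA yA xy cx]]] := IH c cp cA bA.
  by exists x, y; split => //; apply: connect_trans cx; exact: connect1.
by exists a, c.
Qed.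

Section Distance.
Context {G : sgraph}.
Implicit Types (u v w x y : G) (p : seq G).

Lemma has_walkP u v k :
  reflect (exists p, [/\ path adj u p, last u p = v & size p = k]) (has_walk u v k).
Proof.
apply: (iffP existsP) => [[p /andP[pp /eqP pl]]|[p [pp pl ps]]].
  by exists p; rewrite size_tuple.
have sp : size p == k by rewrite ps.
by exists (Tuple sp); rewrite /= pp pl eqxx.
Qed.

Lemma dist_le_walk u p : path adj u p -> dist u (last u p) <= size p.
Proof.
move=> pp; rewrite /dist.
have h : has_walk u (last u p) (size p) by apply/has_walkP; exists p.
have [l|l] := ltnP (size p) #|G|; last first.
  by apply: leq_trans (find_size _ _) _; rewrite size_iota.
rewrite leqNgt; apply/negP => lt; have := before_find 0 lt.
by rewrite nth_iota// add0n h.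
Qed.

Lemma dist_walk u v : connected_graph G ->
  exists p, [/\ path adj u p, last u p = v & size p = dist u v].
Proof.
move=> cG; have /connectP[p pp vE] := cG u v.
case/shortenP: pp vE => p' pp' up' _ vE.
have szp' : size p' < #|G|.
  by rewrite -[(size p').+1]/(size (u :: p')) -(card_uniqP up') max_card.
have h : has (has_walk u v) (iota 0 #|G|).
  apply/hasP; exists (size p'); first by rewrite mem_iota.
  by apply/has_walkP; exists p'.
have := nth_find 0 h; rewrite nth_iota; last by rewrite -[X in _ < X](size_iota 0) -has_find.
by rewrite add0n => /has_walkP.
Qed.

Lemma distxx v : dist v v = 0.
Proof. by have := @dist_le_walk v [::] isT; rewrite leqn0 => /eqP. Qed.

Lemma dist_cat u v w : connected_graph G -> dist u w <= dist u v + dist v w.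
Proof.
move=> cG; have [p [pp pl <-]] := dist_walk u v cG.
have [p' [pp' pl' <-]] := dist_walk v w cG.
have := @dist_le_walk u (p ++ p'); rewrite last_cat pl pl' size_cat; apply.
by rewrite cat_path pp pl.
Qed.

Lemma dist_adj u v : adj u v -> dist u v <= 1.
Proof. by move=> uv; apply: (@dist_le_walk u [:: v]); rewrite /= uv. Qed.

Lemma dist_lipschitz v w y : connected_graph G -> adj w y -> dist v w <= dist v y + 1.
Proof.
move=> cG wy; apply: leq_trans (dist_cat v y w cG) _; rewrite leq_add2l.
by apply: dist_adj; rewrite adj_sym.
Qed.

Lemma dist_path x p i j : connected_graph G -> path adj x p -> i <= j -> j <= size p ->
  dist (nth x (x :: p) i) (nth x (x :: p) j) <= j - i.
Proof.
move=> cG px; elim: j => [|j IH]; first by rewrite leqn0 => /eqP-> _; rewrite distxx.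
rewrite leq_eqVlt => /orP[/eqP->|]; first by rewrite distxx.
rewrite ltnS => ij jp; have a : adj (nth x (x :: p) j) (nth x (x :: p) j.+1).
  by have /pathP := px; apply.
apply: leq_trans (dist_cat _ (nth x (x :: p) j) _ cG) _.
by rewrite subSn// -(addn1 (j - i)); apply: leq_add; [apply: IH => //; exact: ltnW|exact: dist_adj].
Qed.

Lemma dist_sym u v : connected_graph G -> dist u v = dist v u.
Proof.
move=> cG; wlog suff : u v / dist v u <= dist u v.
  by move=> h; apply/eqP; rewrite eqn_leq !h.
have [p [pp <- <-]] := dist_walk u v cG.
have := @dist_le_walk (last u p) (rev (belast u p)).
rewrite size_rev size_belast.
have -> : last (last u p) (rev (belast u p)) = u.
  by case: p pp => //= a p _; rewrite rev_cons last_rcons.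
apply; rewrite rev_path; apply: sub_path pp => a b; by rewrite /= adj_sym.
Qed.

End Distance.

(* Listing [S] by increasing [f], the [i]-th element has [f] at most [(i + c)./2]. *)
Lemma sum_levels (T : finType) (S : {set T}) (f : T -> nat) (c : nat) :
  (forall t : T, t \in S -> 2 * f t <= c + #|[set t' in S | f t' < f t]|) ->
  \sum_(t in S) f t <= \sum_(i < #|S|) (i + c)./2.
Proof.
move: {2}#|S| (erefl #|S|) => m; elim: m S => [|m IH] S cS h.
  by rewrite (cards0_eq cS) big_set0.
have /card_gt0P[w0 w0S] : 0 < #|S| by rewrite cS.
case: (@arg_maxnP _ w0 [in S] f w0S) => w wS wmax.
rewrite cS big_ord_recr /= (big_setD1 w wS) /= addnC.
have cS' : #|S :\ w| = m by have := cardsD1 w S; rewrite wS cS => -[].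
apply: leq_add.
  have := IH _ cS'; rewrite cS'; apply => x; rewrite in_setD1 => /andP[xw xS].
  apply: leq_trans (h x xS) _; rewrite leq_add2l; apply: subset_leq_card.
  apply/fintype.subsetP => y; rewrite !inE => /andP[yS yx]; rewrite yS yx !andbT.
  by have /= hx := wmax x xS; apply/eqP => e; move: yx; rewrite e ltnNge hx.
have : #|[set w' in S | f w' < f w]| <= m.
  rewrite -cS'; apply: subset_leq_card; apply/fintype.subsetP => y; rewrite !inE => /andP[yS yx].
  by rewrite yS andbT; apply/eqP => e; move: yx; rewrite e ltnn.
by have := h w wS; lia.
Qed.

Lemma sum_half2 m : 4 * \sum_(i < m) (i + 2)./2 <= (m + 1) ^ 2.
Proof.
elim/ltn_ind: m => -[|[|m]] IH; rewrite ?big_ord0 ?big_ord_recr ?big_ord0//=.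
by have := IH m (leqW (leqnn _)); set s := \sum_(i < m) _; rewrite !expnS !expn0; nia.
Qed.

Lemma sum_half3 m : 4 * \sum_(i < m) (i + 3)./2 <= m ^ 2 + 4 * m.
Proof.
elim/ltn_ind: m => -[|[|m]] IH; rewrite ?big_ord0 ?big_ord_recr ?big_ord0//=.
by have := IH m (leqW (leqnn _)); set s := \sum_(i < m) _; rewrite !expnS !expn0; nia.
Qed.

(** * Sizes of the distance levels on a side of an edge *)

Section Levels.
Context {G : sgraph} (h2 : two_connected G).
Implicit Types (u v w x y : G) (S : {set G}) (f : G -> nat).

Lemma cut_neighbour (T : {set G}) x w z : w \in T -> w != x -> z \notin T -> z != x ->
  exists a b, [/\ a \in T, b \notin T, b != x & adj a b].
Proof.
move=> wT wx zT zx; have [_ _ /(_ x w z wx zx) c] := h2.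
have [a [b [aT bT /= /and3P[_ bx ab] _]]] := connect_leaves c wT zT.
by exists a, b.
Qed.

Definition is_side u v S := [/\ u \notin S, v \notin S &
  forall w y, w \in S -> adj w y -> [\/ y \in S, y = u | y = v]].

(** More general than a distance from one vertex: the minimum of two distances is also needed, for
    the middle vertex of an odd cycle. *)
Definition edge_lipschitz f := forall w y, adj w y -> f w <= f y + 1.

Definition level S f j := [set w in S | f w == j].
Definition below S f j := [set w in S | f w < j].

(** A path to [v] avoiding [u] leaves the vertices of [S] above level [j]. The value drops by at
    most one per step, so it leaves them to a vertex of value exactly [j], which is not [v] and
    hence is in [S]. *)
Lemma level_ge1 u v S f j w : adj u v -> is_side u v S -> edge_lipschitz f ->
  f v < j -> w \in S -> j < f w -> 0 < #|level S f j|.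
Proof.
move=> uv [uS vS side] lf fv wS fw.
have vu : v != u by apply/eqP => e; rewrite e adj_irrefl in uv.
have [||||a [b [aT bT bu ab]]] := @cut_neighbour [set w in S | j < f w] u w v.
- by rewrite inE wS.
- by apply/eqP => e; rewrite e in wS; rewrite wS in uS.
- by rewrite inE (negbTE vS).
- exact: vu.
move: aT bT; rewrite !inE => /andP[aS fa]; rewrite negb_and -leqNgt => bT.
have fb := lf a b ab.
have bv : b != v by apply/eqP => e; move: fb fv; rewrite e; lia.
have bS : b \in S by case: (side a b aS ab) => // e; [rewrite e eqxx in bu|rewrite e eqxx in bv].
apply/card_gt0P; exists b; rewrite inE bS /=.
by move: bT; rewrite bS /=; lia.
Qed.

(** The same exit argument with a known vertex [y1] of level [j] deleted yields a second one; now
    [u] is excluded by its value. *)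
Lemma level_ge2 u v S f j w : adj u v -> is_side u v S -> edge_lipschitz f ->
  f v < j -> f u < j -> w \in S -> j < f w -> 1 < #|level S f j|.
Proof.
move=> uv sd lf fv fu wS fw; have [uS vS side] := sd.
have /card_gt0P[y1] := level_ge1 uv sd lf fv wS fw; rewrite inE => /andP[y1S /eqP fy1].
have [||||a [b [aT bT bu ab]]] := @cut_neighbour [set w in S | j < f w] y1 w v.
- by rewrite inE wS.
- by apply/eqP => e; move: fw; rewrite e fy1 ltnn.
- by rewrite inE (negbTE vS).
- by apply/eqP => e; rewrite e y1S in vS.
move: aT bT; rewrite !inE => /andP[aS fa]; rewrite negb_and -leqNgt => bT.
have fb := lf a b ab.
have bS : b \in S.
  by case: (side a b aS ab) => // e; move: fb fv fu; rewrite e; lia.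
have -> : 2 = #|[set y1; b]%SET| by rewrite cards2 eq_sym bu.
apply: subset_leq_card; apply/fintype.subsetP => y; rewrite !inE => /orP[/eqP->|/eqP->].
  by rewrite y1S fy1 eqxx.
by rewrite bS /=; move: bT; rewrite bS /=; lia.
Qed.

Lemma card_below_step S f j : #|below S f j.+1| = #|below S f j| + #|level S f j|.
Proof.
rewrite -cardsUI (_ : _ :&: _ = finset.set0) ?cards0 ?addn0.
  by apply: eq_card => w; rewrite !inE; case: (w \in S) => //=; lia.
by apply/setP => w; rewrite !inE; case: (w \in S) => //=; lia.
Qed.

Lemma below_bound0 u v S f w : adj u v -> is_side u v S -> edge_lipschitz f ->
  f v = 0 -> f u = 0 -> w \in S -> 2 * f w <= 2 + #|below S f (f w)|.
Proof.
move=> uv sd lf fv fu wS.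
have key i : i < f w -> 2 * i <= #|below S f i.+1|.
  elim: i => [|i IH] // iw; rewrite card_below_step.
  have := @level_ge2 u v S f i.+1 w uv sd lf; rewrite fv fu => /(_ isT isT wS iw).
  by have := IH (ltnW iw); lia.
by case E : (f w) => [|t] //; have := key t; rewrite E => /(_ (ltnSn t)); lia.
Qed.

(** As [u] may have value 1, level 1 is only known to contain one vertex of [S]; the constant 3 in
    place of 2 pays for this. *)
Lemma below_bound1 u v S f w : adj u v -> is_side u v S -> edge_lipschitz f ->
  f v = 0 -> f u <= 1 -> w \in S -> 2 * f w <= 3 + #|below S f (f w)|.
Proof.
move=> uv sd lf fv fu wS.
have key i : i < f w -> 2 * i <= 1 + #|below S f i.+1|.
  elim: i => [|[|i] IH] // iw; rewrite card_below_step.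
    have := @level_ge1 u v S f 1 w uv sd lf; rewrite fv => /(_ isT wS iw); lia.
  have fui : f u < i.+2 by lia.
  have := @level_ge2 u v S f i.+2 w uv sd lf; rewrite fv => /(_ isT fui wS iw).
  by have := IH (ltnW iw); lia.
by case E : (f w) => [|t] //; have := key t; rewrite E => /(_ (ltnSn t)); lia.
Qed.

Lemma side_sum0 u v S f : adj u v -> is_side u v S -> edge_lipschitz f ->
  f v = 0 -> f u = 0 -> 4 * \sum_(w in S) f w <= (#|S| + 1) ^ 2.
Proof.
move=> uv sd lf fv fu; apply: leq_trans (sum_half2 _); rewrite leq_mul2l /=.
by apply: sum_levels => w; exact: below_bound0 uv sd lf fv fu.
Qed.

Lemma side_sum1 u v S f : adj u v -> is_side u v S -> edge_lipschitz f ->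
  f v = 0 -> f u <= 1 -> 4 * \sum_(w in S) f w <= #|S| ^ 2 + 4 * #|S|.
Proof.
move=> uv sd lf fv fu; apply: leq_trans (sum_half3 _); rewrite leq_mul2l /=.
by apply: sum_levels => w; exact: below_bound1 uv sd lf fv fu.
Qed.

End Levels.

(** * Averaging distances over a cycle *)

Lemma sum_pairs k (h : nat -> nat) : \sum_(0 <= j < k) h j =
  \sum_(0 <= j < k./2) (h j + h (k - 1 - j)) + (if odd k then h k./2 else 0).
Proof.
elim/ltn_ind: k h => -[|[|k]] IH h; [by rewrite !big_geq|by rewrite big_nat1 big_geq|].
rewrite [in LHS]big_nat_recl// big_nat_recr//= (IH k (leqW (leqnn _)) (fun j => h j.+1)).
rewrite [in RHS]big_nat_recl//= negbK subn0 subn1 /=.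
have -> : \sum_(0 <= i < k./2) (h i.+1 + h (k.-1 - i).+1) =
          \sum_(0 <= i < k./2) (h i.+1 + h (k.+1 - i.+1)).
  apply: eq_big_nat => i /andP[_ ik]; congr (_ + h _).
  by move: ik; lia.
by rewrite !subn1 /=; lia.
Qed.

Lemma sum_linear m : \sum_(0 <= j < m) 2 * j + m = m * m.
Proof.
elim: m => [|m IH]; first by rewrite big_geq.
by rewrite big_nat_recr//=; nia.
Qed.

Section Averaging.
Context {G : sgraph} (h2 : two_connected G).
Implicit Types (u v w x y : G) (S D : {set G}) (p c : seq G).

Let cG : connected_graph G. Proof. by have [] := h2. Qed.

Lemma is_sideC u v S : is_side u v S -> is_side v u S.
Proof.
by move=> [uS vS sd]; split => // w y wS /(sd w y wS)[];
  [constructor 1|constructor 3|constructor 2].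
Qed.

Lemma lipschitz_dist v : edge_lipschitz (dist v).
Proof. by move=> w y; exact: dist_lipschitz. Qed.

Lemma sum_side_le (D : {set G}) (f g : G -> nat) j :
  (forall w, w \in D -> f w <= j + g w) ->
  \sum_(w in D) f w <= j * #|D| + \sum_(w in D) g w.
Proof.
by move=> h; rewrite mulnC -sum_nat_const -big_split /=; exact: leq_sum.
Qed.

(** The vertex at position [j] is within [j] of [b] and within [k - 1 - j] of [a], which suggests
    pairing opposite positions and using the nearer end for each. If [k] is odd, the middle vertex
    is bounded through both ends at once: the minimum of the two distances vanishes at [a] and at
    [b], and [(m + 1) ^ 2] in place of [m ^ 2 + 4 * m] makes up for the missing partner, as [m] is
    positive. *)
Lemma cycle_side_sum b p D : path adj b p -> adj (last b p) b -> 1 < size p ->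
  is_side (last b p) b D -> 0 < #|D| ->
  4 * \sum_(x <- b :: p) \sum_(w in D) dist x w <=
    (size p).+1 * (#|D| ^ 2 + 4 * #|D|) + #|D| * ((size p).+1 * (size p).-1).
Proof.
set a := last b p => pp ab sz sd D0.
pose h j := \sum_(w in D) dist (nth b (b :: p) j) w.
have -> : \sum_(x <- b :: p) \sum_(w in D) dist x w = \sum_(0 <= j < (size p).+1) h j.
  by rewrite (big_nth b).
set k := (size p).+1; set m := #|D| in D0 *.
have aE : nth b (b :: p) (size p) = a by rewrite -last_nth.
have ba : adj b a by rewrite adj_sym.
have hb j : j < k -> 4 * h j <= 4 * (j * m) + (m ^ 2 + 4 * m).
  move=> jk; have : h j <= j * m + \sum_(w in D) dist b w.
    apply: sum_side_le => w _.
    apply: leq_trans (dist_cat _ b w cG) _; rewrite leq_add2r dist_sym//.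
    by have := dist_path cG pp (leq0n j) jk; rewrite subn0.
  have : 4 * \sum_(w in D) dist b w <= m ^ 2 + 4 * m.
    by apply: (side_sum1 h2 ab sd (@lipschitz_dist b)); rewrite ?distxx// dist_adj.
  lia.
have da j w : j < k -> dist (nth b (b :: p) j) w <= (k - 1 - j) + dist a w.
  move=> jk; apply: leq_trans (dist_cat _ a w cG) _; rewrite leq_add2r -aE.
  by have := dist_path cG pp _ (leqnn _); rewrite /k subn1; apply; rewrite -ltnS.
have ha j : j < k -> 4 * h j <= 4 * ((k - 1 - j) * m) + (m ^ 2 + 4 * m).
  move=> jk; have : h j <= (k - 1 - j) * m + \sum_(w in D) dist a w.
    by apply: sum_side_le => w _; exact: da.
  have : 4 * \sum_(w in D) dist a w <= m ^ 2 + 4 * m.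
    by apply: (side_sum1 h2 ba (is_sideC sd) (@lipschitz_dist a)); rewrite ?distxx// dist_adj.
  lia.
have hm : odd k -> 4 * h k./2 <= 4 * (k./2 * m) + (m + 1) ^ 2.
  move=> ok; have k2 : k - 1 - k./2 = k./2 by move: (odd_double_half k); rewrite ok; lia.
  have kk : k./2 < k by rewrite /k; lia.
  have : h k./2 <= k./2 * m + \sum_(w in D) minn (dist a w) (dist b w).
    apply: sum_side_le => w _; rewrite addn_minr leq_min; apply/andP; split.
      by rewrite -{2}k2 da.
    apply: leq_trans (dist_cat _ b w cG) _; rewrite leq_add2r dist_sym//.
    by have := dist_path cG pp (leq0n _) kk; rewrite subn0.
  have : 4 * \sum_(w in D) minn (dist a w) (dist b w) <= (m + 1) ^ 2.
    apply: (side_sum0 h2 ab sd); rewrite ?distxx ?minn0 ?min0n//.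
    by move=> w y wy; have := lipschitz_dist a wy; have := lipschitz_dist b wy; lia.
  lia.
have kE : (size p).-1 = k - 2 by rewrite /k; lia.
rewrite kE sum_pairs.
have P : 4 * \sum_(0 <= j < k./2) (h j + h (k - 1 - j)) <=
    4 * (m * \sum_(0 <= j < k./2) 2 * j) + 2 * (k./2 * (m ^ 2 + 4 * m)).
  have -> : 4 * (m * \sum_(0 <= j < k./2) 2 * j) + 2 * (k./2 * (m ^ 2 + 4 * m)) =
      \sum_(0 <= j < k./2) (4 * (m * (2 * j)) + 2 * (m ^ 2 + 4 * m)).
    elim: k./2 => [|t IH]; first by rewrite !big_geq// muln0.
    by rewrite ![in RHS]big_nat_recr//= -IH big_nat_recr//=; lia.
  rewrite big_distrr /= big_nat [X in _ <= X]big_nat; apply: leq_sum => j /andP[_ jk].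
  have j1 : j < k by move: jk; lia.
  have j2 : k - 1 - j < k by rewrite /k; lia.
  have j3 : k - 1 - (k - 1 - j) = j by move: j1; lia.
  have := hb j j1; have := ha _ j2; rewrite j3.
  set B := m ^ 2 + 4 * m; nia.
have SL := sum_linear k./2.
have := odd_double_half k.
case: ifPn => [ok|ok] kh; rewrite -!mul2n in kh.
  have := hm ok; move: P SL kh; set s1 := \sum_(0 <= j < _) _; set s2 := \sum_(0 <= j < _) _.
  set t := k./2; set H := h t; set B := m ^ 2 + 4 * m => P SL kh Hm.
  have e1 : m * s2 + m * t = m * (t * t) by rewrite -mulnDr SL.
  have e2 : k * (k - 2) + 1 = 4 * (t * t).
    have [t' tE] : exists t', t = t'.+1 by exists t.-1; move: kh sz; rewrite /k; lia.
    have -> : k - 2 = 2 * t' + 1 by rewrite -kh tE; lia.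
    by rewrite -kh tE; lia.
  have e3 : m * (k * (k - 2)) + m = 4 * (m * (t * t)) by rewrite (mulnCA 4) -e2 mulnDr muln1.
  have e4 : k * B = B + 2 * (t * B) by rewrite -kh mulnDl mul1n mulnA.
  have e5 : (m + 1) ^ 2 = B + 1 - 2 * m.
    by rewrite /B !expnS !expn0 !muln1 mulnDl !mulnDr !muln1 !mul1n; lia.
  have e6 : 2 * m <= B by rewrite /B; lia.
  rewrite e4 mulnDr; move: P Hm; rewrite e5 (mulnC t m); lia.
move: P SL kh; set s1 := \sum_(0 <= j < _) _; set s2 := \sum_(0 <= j < _) _.
set t := k./2; set B := m ^ 2 + 4 * m => P SL kh.
have e1 : m * s2 + m * t = m * (t * t) by rewrite -mulnDr SL.
have e2 : k * (k - 2) + 4 * t = 4 * (t * t).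
  have [t' tE] : exists t', t = t'.+1 by exists t.-1; move: kh sz; rewrite /k; lia.
  have -> : k - 2 = 2 * t' by rewrite -kh tE; lia.
  by rewrite -kh tE; lia.
have e3 : m * (k * (k - 2)) + 4 * (m * t) = 4 * (m * (t * t)).
  by rewrite (mulnCA 4 m (t * t)) -e2 mulnDr (mulnCA m 4).
have e4 : k * B = 2 * (t * B) by rewrite -kh mulnA.
by rewrite e4 addn0; lia.
Qed.

End Averaging.

Lemma sum_seq_gt (T : eqType) (s : seq T) (F : T -> nat) B :
  (forall x, x \in s -> B < F x) -> size s * B.+1 <= \sum_(x <- s) F x.
Proof.
elim: s => [|x s IH] h; first by rewrite big_nil.
rewrite big_cons /= mulSn; apply: leq_add; first by apply: h; rewrite inE eqxx.
by apply: IH => y ys; apply: h; rewrite inE ys orbT.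
Qed.

Section Average.
Context {G : sgraph} (h2 : two_connected G).
Implicit Types (u v w x y : G) (S D : {set G}) (p c : seq G).

Let cG : connected_graph G. Proof. by have [] := h2. Qed.

Lemma cycle_rotation c x : ucycle adj c -> 1 < size c -> x \in c ->
  exists p, [/\ perm_eq c (x :: p), path adj x p, adj (last x p) x,
    next c (last x p) = x & last x p \in c].
Proof.
move=> /andP[cy u] sz xc; have [i s E] := rot_to xc; exists s.
have pe : perm_eq c (x :: s) by rewrite -E perm_sym perm_rot.
have lc : last x s \in c by rewrite (perm_mem pe) mem_last.
have : cycle adj (x :: s) by rewrite -E rot_cycle.
rewrite /= rcons_path => /andP[ps la]; split => //.
rewrite -(next_rot i u) E; move: u; rewrite -(rot_uniq i) E => u.
by rewrite next_nth mem_last index_last// nth_default.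
Qed.

Lemma cycle_self_sum x p : path adj x p -> adj (last x p) x ->
  4 * \sum_(y <- x :: p) dist x y <= (size p).+1 ^ 2.
Proof.
move=> pp lx; set k := (size p).+1.
rewrite (big_nth x) sum_pairs -/k.
have lE : nth x (x :: p) (size p) = last x p by rewrite -last_nth.
have d1 j : j < k -> dist x (nth x (x :: p) j) <= j.
  by move=> jk; have := dist_path cG pp (leq0n j) jk; rewrite subn0.
have d2 j : j < k -> dist x (nth x (x :: p) j) <= k - j.
  move=> jk; rewrite dist_sym//; apply: leq_trans (dist_cat _ (last x p) _ cG) _.
  have := dist_path cG pp (i := j) (j := size p); rewrite lE => h.
  rewrite /k subSn// -addn1; apply: leq_add; last exact: dist_adj.
  by apply: h => //; rewrite -ltnS.
have P : \sum_(0 <= j < k./2) (dist x (nth x (x :: p) j) + dist x (nth x (x :: p) (k - 1 - j)))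
    <= \sum_(0 <= j < k./2) 2 * j + k./2.
  have -> : \sum_(0 <= j < k./2) 2 * j + k./2 = \sum_(0 <= j < k./2) (2 * j + 1).
    elim: k./2 => [|t IH]; first by rewrite !big_geq.
    by rewrite ![in RHS]big_nat_recr//= -IH big_nat_recr//=; lia.
  rewrite big_nat [X in _ <= X]big_nat; apply: leq_sum => j /andP[_ jk].
  have j1 : j < k by move: jk; lia.
  have j2 : k - 1 - j < k by rewrite /k; lia.
  have := d1 j j1; have := d2 _ j2; move: j1; lia.
rewrite sum_linear in P; move: P.
set s := \sum_(0 <= j < _) _; set t := k./2 => P.
have := odd_double_half k; rewrite -mul2n -/t; case: ifPn => ok kh.
  have kk : t < k by rewrite /t /k; lia.
  have e : k ^ 2 = 4 * (t * t) + 4 * t + 1 by rewrite !expnS expn0 -kh; lia.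
  by rewrite e; have := d1 _ kk; lia.
have e : k ^ 2 = 4 * (t * t) by rewrite !expnS expn0 -kh; lia.
by rewrite e; lia.
Qed.

End Average.

(** * Bridges of a cycle *)

(** With [r = n - k], the right-hand side exceeds the bound obtained for [s + 4 * q] by [(q - k) * r
    + (q - 2) ^ 2 - (k - 2) ^ 2 + 4], which is positive because [2 < k <= q]. *)
Lemma average_arith n q k s : 2 < k -> k <= q -> k <= n ->
  s + q * (n - k) <= 2 * k ^ 2 + (n - k) * (n + 2 * k + 4) ->
  s + 4 * q <= n ^ 2 + 4 * n + q ^ 2 + 4.
Proof.
move=> k2 kq kn.
have [r ->] : exists r, n = k + r by exists (n - k); lia.
have [t ->] : exists t, q = k + t by exists (q - k); lia.
rewrite (_ : k + r - k = r); last by lia.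
rewrite !expnS !expn0 !muln1.
have [k' ->] : exists k', k = k' + 3 by exists (k - 3); lia.
lia.
Qed.

Section Bridges.
Context {G : sgraph} (h2 : two_connected G).
Implicit Types (u v w x y : G) (S D : {set G}) (p c : seq G).

Definition off_cycle c : rel G := [rel x y | [&& x \notin c, y \notin c & adj x y]].
(** For [w] off the cycle, the vertex set of its component after removal of the cycle, without the
    attachments. Chords give no bridges in this sense. *)
Definition bridge c w : {set G} := [set y | (y \notin c) && connect (off_cycle c) w y].

Lemma off_cycle_sym c : symmetric (connect (off_cycle c)).
Proof.
by apply: sym_connect_sym => x y; rewrite /off_cycle /= (@adj_sym G) andbCA.
Qed.

(** Adding [cycle_side_sum] over the bridges bounds the total over the cycle. Some cycle vertex does
    no worse than the average on the bridges, and its distances to the cycle itself sum to at most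
    [k ^ 2 / 4]. *)
Lemma bridge_partition_average c q : ucycle adj c -> 2 < size c -> size c <= q ->
  (forall w, w \notin c -> exists2 a, a \in c &
    is_side a (next c a) (bridge c w) /\ 2 * #|bridge c w| + q < #|G|) ->
  exists v, 8 * \sum_(w : G) dist v w + 4 * q <= #|G| ^ 2 + 4 * #|G| + q ^ 2 + 4.
Proof.
move=> uc sz kq sides; have /andP[cy u] := uc.
set k := size c in sz kq *; set n := #|G|.
have k1 : (k - 1).+1 = k by lia.
have k2 : (k - 1).-1 = k - 2 by lia.
have k3 : 1 < k - 1 by lia.
pose C := ~: [set x in c].
have cardC : #|C| = n - k by rewrite cardsCs finset.setCK cardsE (card_uniqP u).
have kn : k <= n by rewrite /k -(card_uniqP u) max_card.
pose P := equivalence_partition (connect (off_cycle c)) C.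
have pP : finset.partition P C.
  apply: equivalence_partitionP => x y z _ _ _; split; first exact: connect0.
  by move=> xy; apply/idP/idP => h; [apply: connect_trans h; rewrite off_cycle_sym|apply: connect_trans h].
have PE D : D \in P -> exists2 w, w \notin c & D = bridge c w.
  move=> /imsetP[w]; rewrite !inE => wc ->; exists w => //.
  by apply/setP => y; rewrite !inE.
have cardP : \sum_(D in P) #|D| = n - k by rewrite -cardC (card_partition pP).
pose B D := #|D| ^ 2 + 4 * #|D| + #|D| * (k - 2).
pose T := \sum_(D in P) B D.
have sumD D : D \in P -> \sum_(x <- c) (4 * \sum_(w in D) dist x w) <= k * B D.
  move=> DP; have [w wc DE] := PE D DP; have [a ac [sd _]] := sides w wc.
  have nc : next c a \in c by rewrite mem_next.
  have [p [pe pp lx nl lc]] := cycle_rotation uc (ltnW sz) nc.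
  have la : last (next c a) p = a by have := congr1 (prev c) nl; rewrite !prev_next.
  have szp : size p = k - 1 by have := perm_size pe => /=; rewrite /k => ->; lia.
  have D0 : 0 < #|D|.
    by apply/card_gt0P; exists w; rewrite DE inE wc connect0.
  rewrite -DE in sd.
  have := @cycle_side_sum G h2 (next c a) p D pp lx; rewrite la szp k1 k2.
  move=> /(_ k3 sd D0); rewrite -big_distrr /= (perm_big _ pe) /= => h.
  apply: leq_trans h _.
  by rewrite /B !mulnDr (mulnCA k #|D| (k - 2)).
have total : \sum_(x <- c) (4 * \sum_(D in P) \sum_(w in D) dist x w) <= k * T.
  under eq_bigr => x _ do rewrite big_distrr /=.
  by rewrite exchange_big /= /T big_distrr /=; apply: leq_sum.
have [x xc hx] : exists2 x, x \in c & 4 * \sum_(D in P) \sum_(w in D) dist x w <= T.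
  apply/hasP; rewrite -[has _ _]negbK -all_predC; apply/negP => /allP al.
  have := sum_seq_gt (s := c) (F := fun x => 4 * \sum_(D in P) \sum_(w in D) dist x w) (B := T).
  have hh x : x \in c -> T < 4 * \sum_(D in P) \sum_(w in D) dist x w.
    by move=> /al /=; rewrite -ltnNge.
  move=> /(_ hh) h; have := leq_trans h total; rewrite -/k mulnS; lia.
exists x.
have -> : \sum_w dist x w = \sum_(y <- c) dist x y + \sum_(D in P) \sum_(w in D) dist x w.
  rewrite -(set_partition_big _ pP) /= (bigID (fun y => y \in c)) /= big_uniq//.
  by congr (_ + _); apply: eq_bigl => y; rewrite !inE.
have hA : 4 * \sum_(y <- c) dist x y <= k ^ 2.
  have [p [pe pp lx _ _]] := cycle_rotation uc (ltnW sz) xc.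
  rewrite (perm_big _ pe) /=; have := cycle_self_sum h2 pp lx.
  by have := perm_size pe => /= <-.
(* A bridge with [m] vertices contributes [m * (2 * m + q + 2 * k + 4)], and [2 * m + q < n]. *)
have hT : 2 * T + q * (n - k) <= (n - k) * (n + 2 * k + 4).
  rewrite -cardP /T !big_distrr big_distrl /= -big_split /=; apply: leq_sum => D DP.
  have [w wc DE] := PE D DP; have [a ac [_ hw]] := sides w wc.
  rewrite -DE -/n in hw; rewrite /B.
  have [r kE] : exists r, k = r + 2 by exists (k - 2); lia.
  rewrite kE addnK !expnS expn0 muln1.
  move: hw; set m := #|D| => hw.
  have -> : 2 * (m * m + 4 * m + m * r) + q * m = m * (2 * m + 8 + 2 * r + q) by lia.
  by rewrite leq_mul2l; apply/orP; right; lia.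
apply: (average_arith sz kq kn); rewrite mulnDr.
lia.
Qed.

End Bridges.

(** * Where a bridge is attached to its cycle *)

Section Attach.
Context {G : sgraph} (h2 : two_connected G).
Implicit Types (u v w x y d : G) (S D : {set G}) (p r c : seq G).

Context (nt : forall x p1 y p2 r, p1 != [::] -> p2 != [::] -> r != [::] ->
  ucycle adj (x :: p1 ++ y :: p2) -> path adj x (rcons r y) -> uniq r ->
  (forall w, w \in r -> w \notin x :: p1 ++ y :: p2) -> False).

Lemma bridge_eq c c' w : c =i c' -> bridge c w = bridge c' w.
Proof.
move=> cc; apply/setP => y; rewrite !inE cc; congr (_ && _).
by apply: eq_connect => a b; rewrite /off_cycle /= !cc.
Qed.

Lemma bridge_closed c w x y : x \in bridge c w -> adj x y -> y \notin c -> y \in bridge c w.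
Proof.
rewrite !inE => /andP[xc wx] xy yc; rewrite yc /=.
by apply: connect_trans wx _; apply: connect1; rewrite /off_cycle /= xc yc.
Qed.

Lemma bridge_path c w d1 d2 : d1 \in bridge c w -> d2 \in bridge c w ->
  exists p, [/\ path adj d1 p, last d1 p = d2, uniq (d1 :: p) &
    {subset d1 :: p <= bridge c w}].
Proof.
rewrite !inE => /andP[d1c wd1] /andP[d2c wd2].
have /connectP[p pp lp] : connect (off_cycle c) d1 d2.
  by apply: connect_trans wd2; rewrite off_cycle_sym.
case/shortenP: pp lp => p' pp' up' _ lp'.
exists p'; split => //.
  by apply: sub_path pp' => a b; rewrite /off_cycle /= => /and3P[].
move=> y yp; rewrite inE; move: d1c wd1 pp' {lp' up' d2c wd2}; move: yp.
elim: p' d1 => [|e p' IH] d1 /=; first by rewrite inE => /eqP-> -> ->.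
rewrite inE => /orP[/eqP->|yp] d1c wd1; first by rewrite d1c wd1.
move=> /andP[]; rewrite {1}/off_cycle /= => /and3P[h1 h2' h3] pp; apply: (IH e) => //.
by apply: connect_trans wd1 _; apply: connect1; rewrite /off_cycle /= h1 h2' h3.
Qed.

Lemma bridge_notin c w x : x \in bridge c w -> x \notin c.
Proof. by rewrite inE => /andP[]. Qed.

Lemma theta_bridge x p1 y p2 w d1 d2 : p1 != [::] -> p2 != [::] ->
  ucycle adj (x :: p1 ++ y :: p2) ->
  d1 \in bridge (x :: p1 ++ y :: p2) w -> d2 \in bridge (x :: p1 ++ y :: p2) w ->
  adj x d1 -> adj d2 y -> False.
Proof.
move=> p10 p20 uc b1 b2 xd dy; have [p [pp lp up sub]] := bridge_path b1 b2.
apply: (@nt x p1 y p2 (d1 :: p)) => //.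
  by rewrite /= rcons_path xd pp lp.
by move=> t /sub/bridge_notin.
Qed.

Lemma next_last x p : uniq (x :: p) -> next (x :: p) (last x p) = x.
Proof. by move=> u; rewrite next_nth mem_last index_last// nth_default. Qed.

(** Otherwise both arcs of the cycle between [a] and [b] have inner vertices, and a path through the
    bridge is a third one. *)
Lemma attach_consecutive c w a b d1 d2 : ucycle adj c -> a \in c -> b \in c -> a != b ->
  d1 \in bridge c w -> d2 \in bridge c w -> adj a d1 -> adj d2 b ->
  b = next c a \/ a = next c b.
Proof.
move=> uc ac bc ab b1 b2 ad db; have /andP[cy u] := uc.
have [i s E] := rot_to ac.
have uE : ucycle adj (a :: s) by rewrite -E rot_ucycle.
have cE : c =i a :: s by move=> t; rewrite -E mem_rot.
rewrite (bridge_eq w cE) in b1 b2.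
rewrite -!(next_rot i u) E.
have : b \in s by move: bc; rewrite cE inE eq_sym (negbTE ab).
move=> bs; case/splitPr: bs uE b1 b2 {E cE} => p1 p2 uE b1 b2.
have /andP[_ u'] := uE.
have [->|p10] := eqVneq p1 [::]; first by left; rewrite /= eqxx.
have [p20|p20] := eqVneq p2 [::].
  right; move: u'; rewrite p20 => u'.
  by have := next_last u'; rewrite last_cat /= => ->.
by case: (theta_bridge p10 p20 uE b1 b2 ad db).
Qed.

(** By 2-connectedness the bridge of a vertex outside [K] is attached to two vertices [b], [b'] of
    [K]. A path through it and the paths through the other two vertices [e], [f] form the forbidden
    configuration. *)
Lemma clique4_spans (K : {set G}) : #|K| = 4 ->
  (forall s t, s \in K -> t \in K -> s != t -> adj s t) -> #|G| = 4.
Proof.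
move=> K4 cl; apply/eqP; rewrite -K4 eqn_leq max_card andbT.
apply: subset_leq_card; apply/fintype.subsetP => v _; apply: contraT => vK.
pose c := enum K; have cK : c =i K by move=> t; rewrite mem_enum.
have vD : v \in bridge c v by rewrite inE connect0 cK vK.
have nD t : t \in K -> t \notin bridge c v by move=> tK; rewrite inE cK tK.
have inK a b : a \in bridge c v -> b \notin bridge c v -> adj a b -> b \in K.
  by move=> aD bD ab; apply: contraNT bD => bK; apply: bridge_closed aD ab _; rewrite cK.
have two x : exists2 t, t \in K & t != x.
  have /card_gt0P[t] : 0 < #|K :\ x| by have := cardsD1 x K; rewrite K4; case: (x \in K) => /=; lia.
  by rewrite !inE => /andP[tx tK]; exists t.
have [t0 t0K _] := two v.
have [t1 t1K t10] := two t0.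
have nv t : t \in K -> v != t by move=> tK; apply: contraNneq vK => ->.
have [a [b [aD bD bt0 ab]]] := cut_neighbour h2 vD (nv _ t0K) (nD _ t1K) t10.
have bK := inK a b aD bD ab.
have [t2 t2K t2b] := two b.
have [a' [b' [aD' bD' bb' ab']]] := cut_neighbour h2 vD (nv _ bK) (nD _ t2K) t2b.
have bK' := inK a' b' aD' bD' ab'.
have /cards2P[e [f [ef KE]]] : #|K :\ b :\ b'| == 2.
  have := cardsD1 b K; rewrite K4 bK (cardsD1 b' (K :\ b)) in_setD1 bb' bK'.
  by rewrite !add1n => -[<-].
have : e \in K :\ b :\ b' by rewrite KE !inE eqxx.
have : f \in K :\ b :\ b' by rewrite KE !inE eqxx orbT.
rewrite !inE => /and3P[fb' fb fK] /and3P[eb' eb eK].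
have cE : c =i [:: b; e; b'; f].
  move=> t; rewrite cK !inE.
  have := congr1 (fun A : {set G} => t \in A) KE; rewrite !inE.
  have [->|tb] := eqVneq t b; first by rewrite bK.
  have [->|tb'] := eqVneq t b'; first by rewrite bK' orbT.
  by rewrite /= => ->.
have uc : ucycle adj [:: b; e; b'; f].
  rewrite /ucycle /= (cl b e)// 1?eq_sym// (cl e b')// (cl b' f)// 1?eq_sym// (cl f b)//=.
  by rewrite !inE !negb_or (eq_sym b e) eb (eq_sym b b') bb' (eq_sym b f) fb eb' ef (eq_sym b' f) fb'.
rewrite (bridge_eq v cE) in aD aD'.
by case: (@theta_bridge b [:: e] b' [:: f] v a a' _ _ uc aD aD' _ ab') => //; rewrite adj_sym.
Qed.

(** Let [P] be a path through the bridge from a neighbour of [x] to a neighbour of [y]. If [dz] were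
    not on [P], its bridge of the longer cycle through [z], [x], [P], [y] would be attached to [z]
    and to a vertex of [P], which are not consecutive. If [P] had vertices before [dz], they would
    give a third path from [dz] to [x], besides those through [z] and through [y]; likewise after
    [dz], with [x] and [y] exchanged. So [P] is just [dz], and there is a clique on four
    vertices. *)
Lemma triangle_bridge x y z w dx dy dz : adj x y -> adj y z -> adj z x ->
  dx \in bridge [:: x; y; z] w -> dy \in bridge [:: x; y; z] w ->
  dz \in bridge [:: x; y; z] w -> adj x dx -> adj y dy -> adj z dz -> #|G| = 4.
Proof.
move=> xy yz zx bx by_ bz xd yd zd; set c := [:: x; y; z] in bx by_ bz.
have nadj (s t : G) : adj s t -> s != t by apply: contraTneq => ->; rewrite adj_irrefl.
have [p [pp lp up sub]] := bridge_path bx by_.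
set P := dx :: p in up sub.
have nP t : t \in P -> [&& t != x, t != y & t != z].
  by move=> /sub/bridge_notin; rewrite !inE !negb_or.
have xP : x \notin P by apply/negP => /nP; rewrite eqxx.
have yP : y \notin P by apply/negP => /nP; rewrite eqxx andbF.
have zP : z \notin P by apply/negP => /nP; rewrite eqxx !andbF.
have pxy : path adj x (rcons P y) by rewrite /= rcons_path xd pp lp adj_sym.
have dxP : dx \in P by rewrite inE eqxx.
have szP : P != [::] by [].
clearbody P.
have uc1 : ucycle adj (z :: x :: rcons P y).
  apply/andP; split.
    by rewrite /= rcons_path pxy last_rcons zx yz.
  rewrite 2!cons_uniq rcons_uniq up yP in_cons !mem_rcons !in_cons !negb_or.
  by rewrite zP xP (nadj _ _ zx) (nadj _ _ xy) (eq_sym z y) (nadj _ _ yz).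
have inP : dz \in P.
  apply: contraT => nin.
  have dzc := bridge_notin bz.
  have mc1 t : (t \in z :: x :: rcons P y) = (t \in c) || (t \in P).
    rewrite !in_cons mem_rcons in_cons in_nil orbF.
    by case: (t == z); case: (t == x); case: (t == y); case: (t \in P).
  have dzc1 : dz \notin z :: x :: rcons P y by rewrite mc1 negb_or dzc.
  have dD : dz \in bridge (z :: x :: rcons P y) dz by rewrite inE dzc1 connect0.
  have ndx : dx \notin bridge (z :: x :: rcons P y) dz by rewrite inE mc1 dxP orbT.
  have cc : connect (off_cycle c) dz dx.
    move: bz bx; rewrite !inE => /andP[_ h1] /andP[_ h2']; apply: connect_trans h2'.
    by rewrite off_cycle_sym.
  have [a [b [aD bD]]] := connect_leaves cc dD ndx.
    rewrite {1}/off_cycle /= => /and3P[_ bc ab] _.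
  have bP : b \in P.
    apply: contraNT bD => nbP; apply: bridge_closed aD ab _.
    by rewrite mc1 negb_or bc.
  case/splitPr: bP uc1 dD aD {dzc1 mc1 ndx bD} => Q1 Q2 uc1 dD aD.
  case: (@theta_bridge z (x :: Q1) b (rcons Q2 y) dz dz a) => //; first by case: (Q2).
  - by move: uc1; rewrite rcons_cat.
  - by move: dD; rewrite rcons_cat.
  - by move: aD; rewrite rcons_cat.
case/splitPr: inP pxy up xP yP zP nP {uc1 sub} => Q1 Q2.
rewrite rcons_cat /= cat_path /= => /and3P[p1 l1 p2].
rewrite cat_uniq [has _ _]/= cons_uniq negb_or => /and3P[u1 /andP[dQ1 /hasPn h12] /andP[dQ2 u2]].
rewrite !mem_cat !in_cons !negb_or => /and3P[xQ1 xd0 xQ2] /and3P[yQ1 yd0 yQ2] /and3P[zQ1 zd0 zQ2] nP.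
have nxy := nadj _ _ xy; have nyz := nadj _ _ yz; have nzx := nadj _ _ zx.
have [nyx nzy nxz] : [/\ y != x, z != y & x != z] by split; rewrite eq_sym.
have [ndx ndy ndz] : [/\ dz != x, dz != y & dz != z] by split; rewrite eq_sym.
have yx : adj y x by rewrite adj_sym.
have xz : adj x z by rewrite adj_sym.
have zy : adj z y by rewrite adj_sym.
have dzz : adj dz z by rewrite adj_sym.
have Q10 : Q1 = [::].
  apply/eqP; apply: contraT => Q1n.
  case: (@nt dz (rcons Q2 y) x [:: z] (rev Q1)) => //.
  - by case: (Q2).
  - by rewrite -size_eq0 size_rev size_eq0.
  - apply/andP; split.
      by rewrite /= rcons_cat cat_path p2 last_rcons /= yx xz zd.
    rewrite cons_uniq cat_uniq rcons_uniq mem_cat mem_rcons !inE u2 yQ2 /= !mem_rcons !inE !negb_or.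
    by rewrite ?ndx ?ndy ?ndz ?nxy ?nyz ?nzx ?nyx ?nzy ?nxz ?dQ2 ?xQ2 ?zQ2.
  - have := @rev_path _ adj x (rcons Q1 dz); rewrite last_rcons belast_rcons rev_cons => ->.
    rewrite rcons_path; apply/andP; split; last by rewrite adj_sym.
    by apply: sub_path p1 => s t; rewrite adj_sym.
  - by rewrite rev_uniq.
  - move=> t; rewrite mem_rev => tQ; rewrite in_cons mem_cat mem_rcons !inE !negb_or.
    have tx : t != x by apply: contraNneq xQ1 => <-.
    have ty : t != y by apply: contraNneq yQ1 => <-.
    have tz : t != z by apply: contraNneq zQ1 => <-.
    have td : t != dz by apply: contraNneq dQ1 => <-.
    rewrite tx ty tz td /= andbT; apply/negP => /h12; by rewrite tQ.
rewrite Q10 /= in l1.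
have Q20 : Q2 = [::].
  apply/eqP; apply: contraT => Q2n.
  case: (@nt dz [:: x] y [:: z] Q2) => //.
  - by rewrite /ucycle /= (adj_sym dz x) l1 xy yz zd !inE !negb_or ndx ndy ndz nxy nxz nyz.
  - move=> t tQ; rewrite !inE !negb_or.
    have -> /= : t != x by apply: contraNneq xQ2 => <-.
    have -> /= : t != y by apply: contraNneq yQ2 => <-.
    have -> : t != z by apply: contraNneq zQ2 => <-.
    by have -> : t != dz by apply: contraNneq dQ2 => <-.
rewrite Q20 /= andbT in p2.
apply: (@clique4_spans (dz |: (x |: (y |: [set z])))).
  by rewrite !cardsU1 cards1 !inE !negb_or ndx ndy ndz nxy nxz nyz.
have dx' : adj dz x by rewrite adj_sym.
have yd' : adj y dz by rewrite adj_sym.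
by move=> s t; rewrite !inE => /or4P[]/eqP-> /or4P[]/eqP->; rewrite ?eqxx.
Qed.

End Attach.

(** * Chordless cycles and the proximity bound *)

Section InducedCycle.
Context {G : sgraph} (h2 : two_connected G).
Implicit Types (u v w x y d : G) (S D : {set G}) (p r c : seq G).

Definition chordless c := forall a b, a \in c -> b \in c -> adj a b ->
  b = next c a \/ a = next c b.

Lemma adj_neq u v : adj u v -> u != v.
Proof. by apply: contraTneq => ->; rewrite adj_irrefl. Qed.

Definition adj_within S : rel G := [rel x y | [&& x \in S, y \in S & adj x y]].

(** Deleting [v] cannot cut off a component of [S], so it has [u] as a neighbour, and in the same
    way [v]. *)
Lemma side_connect u v S w : is_side u v S -> w \in S -> adj u v ->
  exists a a', [/\ a \in S, a' \in S, adj a u, adj a' v & connect (adj_within S) a a'].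
Proof.
move=> [uS vS sd] wS uv.
have e_sym : symmetric (connect (adj_within S)).
  by apply: sym_connect_sym => x y; rewrite /adj_within /= (@adj_sym G) andbCA.
have nuv := adj_neq uv.
have nvu : v != u by rewrite eq_sym.
pose T := [set y in S | connect (adj_within S) w y].
have wT : w \in T by rewrite inE wS connect0.
have uT : u \notin T by rewrite inE (negbTE uS).
have vT : v \notin T by rewrite inE (negbTE vS).
have wu : w != u by apply: contraNneq uS => <-.
have wv : w != v by apply: contraNneq vS => <-.
have close a b : a \in T -> b \notin T -> adj a b -> b = u \/ b = v.
  rewrite !inE => /andP[aS wa] bT ab.
  case: (sd a b aS ab); [move=> bS|by left|by right].
  case/negP: bT; rewrite bS /=; apply: connect_trans wa (connect1 _).
  by rewrite /adj_within /= aS bS.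
have [a [b [aT bT bv ab]]] := cut_neighbour h2 wT wv uT nuv.
have [a' [b' [aT' bT' bu' ab']]] := cut_neighbour h2 wT wu vT nvu.
have bE : b = u by case: (close a b aT bT ab) => // e; rewrite e eqxx in bv.
have bE' : b' = v by case: (close a' b' aT' bT' ab') => // e; rewrite e eqxx in bu'.
move: aT aT'; rewrite !inE => /andP[aS wa] /andP[aS' wa'].
exists a, a'; rewrite -bE -bE'; split => //.
by apply: connect_trans wa'; rewrite e_sym.
Qed.

Lemma last_take u p i : i <= size p -> last u (take i p) = nth u (u :: p) i.
Proof.
move=> ip; rewrite (last_nth u) size_takel//.
by rewrite -[u :: take i p]/(take i.+1 (u :: p)) nth_take.
Qed.

(* A shortest path from [u] to [v] inside the side that avoids the edge [uv]. *)
Lemma induced_cycle u v S w : adj u v -> is_side u v S -> w \in S ->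
  exists p, [/\ ucycle adj (u :: p), last u p = v, 1 < size p,
    (forall x, x \in u :: p -> [\/ x \in S, x = u | x = v]) & chordless (u :: p)].
Proof.
move=> uv sd wS; have [uS vS _] := sd.
have nuv := adj_neq uv.
have nvu : v != u by rewrite eq_sym.
pose H := u |: (v |: S).
pose e := [rel a b | [&& adj a b, a \in H, b \in H, ~~ ((a == u) && (b == v)) &
  ~~ ((a == v) && (b == u))]].
have uH : u \in H by rewrite !inE eqxx.
have vH : v \in H by rewrite !inE eqxx orbT.
have SH x : x \in S -> x \in H by move=> xS; rewrite !inE xS !orbT.
have e_uv : connect e u v.
  have [a [a' [aS aS' au av aa]]] := side_connect sd wS uv.
  have nu x : x \in S -> x != u by move=> xS; apply: contraNneq uS => <-.
  have nv x : x \in S -> x != v by move=> xS; apply: contraNneq vS => <-.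
  apply: (@connect_trans _ _ a).
    apply: connect1; rewrite /e /= (@adj_sym G) au uH SH// (negbTE (nv _ aS)) andbF.
    by rewrite (negbTE (nu _ aS)) andbF.
  apply: (@connect_trans _ _ a').
    apply: connect_sub aa => x y; rewrite /adj_within /= => /and3P[xS yS xy].
    apply: connect1; rewrite /e /= xy !SH// (negbTE (nu _ xS)).
    by rewrite (negbTE (nv _ xS)).
  apply: connect1; rewrite /e /= av vH SH// (negbTE (nu _ aS')) /=.
  by rewrite (negbTE (nv _ aS')).
have [p [pp pl up pmin]] : exists p, [/\ path e u p, last u p = v, uniq (u :: p) &
    forall p', path e u p' -> last u p' = v -> size p <= size p'].
  pose Q k := [exists p : k.-tuple G, path e u p && (last u p == v)].
  have QP p : path e u p -> last u p = v -> Q (size p).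
    by move=> pp pl; apply/existsP; exists (in_tuple p); rewrite /= pp pl eqxx.
  have exQ : exists k, Q k.
    by have /connectP[p pp pl] := e_uv; exists (size p); exact: QP.
  have [m /existsP[p /andP[pp /eqP pl]] mmin] := ex_minnP exQ.
  move: pl; case/shortenP: pp => p' pp' up' sub pl'.
  exists p'; split => // p'' pp'' pl''.
  have /andP[_ u2] := up'.
  apply: leq_trans (uniq_leq_size u2 sub) _; rewrite size_tuple.
  by apply: mmin; exact: QP.
have p_adj : path adj u p.
  by apply: sub_path pp => a b; rewrite /e /= => /andP[].
have sz : 1 < size p.
  case: p pp pl {up pmin p_adj} => [|a [|b p]] //=; first by move=> _ e0; rewrite e0 eqxx in nuv.
  by move=> + av; rewrite /e /= av !eqxx /= !andbF.
have inH x : x \in u :: p -> x \in H.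
  rewrite inE => /orP[/eqP->//|xp]; case/splitPr: xp pp => p1 p2.
  by rewrite cat_path /e /= => /and3P[_ /and4P[_ _ xH _] _].
exists p; split => //.
- by rewrite /ucycle up andbT /= rcons_path p_adj pl adj_sym.
- move=> x /inH; rewrite !inE => /or3P[/eqP->|/eqP->|->];
    by [constructor 2|constructor 3|constructor 1].
suff key i j : i < j -> j <= size p -> adj (nth u (u :: p) i) (nth u (u :: p) j) ->
    nth u (u :: p) j = next (u :: p) (nth u (u :: p) i) \/
    nth u (u :: p) i = next (u :: p) (nth u (u :: p) j).
  move=> a b ac bc ab.
  have ia : index a (u :: p) <= size p by rewrite -ltnS -[(size p).+1]/(size (u :: p)) index_mem.
  have ib : index b (u :: p) <= size p by rewrite -ltnS -[(size p).+1]/(size (u :: p)) index_mem.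
  have [l|l|eq] := ltngtP (index a (u :: p)) (index b (u :: p)).
  - by have := key _ _ l ib; rewrite !nth_index//; apply.
  - by have := key _ _ l ia; rewrite !nth_index// adj_sym => /(_ ab)[]; [right|left].
  - have : a = b by rewrite -(nth_index u ac) eq nth_index.
    by move=> e1; move: ab; rewrite e1 adj_irrefl.
move=> ij jp aij.
have ip : i < size (u :: p) by rewrite ltnS (leq_trans (ltnW ij)).
have jp' : j < size (u :: p) by rewrite ltnS.
have nxt k : k < size (u :: p) -> next (u :: p) (nth u (u :: p) k) = nth u p k.
  by move=> kp; rewrite next_nth mem_nth// index_uniq.
have [e1|n1] := eqVneq j i.+1; first by left; rewrite nxt// e1.
have [/andP[/eqP i0 /eqP je]|nends] := boolP ((i == 0) && (j == size p)).
  by right; rewrite nxt// i0 je (nth_default u (leqnn (size p))).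
exfalso.
have eij : e (nth u (u :: p) i) (nth u (u :: p) j).
  rewrite /e /= aij !inH ?mem_nth//=.
  have nthu k : k < size (u :: p) -> nth u (u :: p) k = u -> k = 0.
    by move=> kp /eqP; rewrite -[X in _ == X]/(nth u (u :: p) 0) nth_uniq// => /eqP.
  have nthv k : k < size (u :: p) -> nth u (u :: p) k = v -> k = size p.
    by move=> kp; rewrite -pl (last_nth u) => /eqP; rewrite nth_uniq// => /eqP.
  apply/andP; split; apply/negP => /andP[/eqP h1 /eqP h3].
    by move: nends; rewrite (nthu _ ip h1) (nthv _ jp' h3) !eqxx.
  by have := nthu _ jp' h3; move: ij => /[swap] ->.
have lj : last u (take j p) = nth u (u :: p) j by rewrite last_take.
have li : last u (take i p) = nth u (u :: p) i by rewrite last_take// (leq_trans (ltnW ij)).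
have [q1 q2] : path e u (take i p) /\ path e (nth u (u :: p) j) (drop j p).
  split; first exact: take_path.
  by move: pp; rewrite -{1}(cat_take_drop j p) cat_path lj => /andP[].
have q3 : path e u (take i p ++ nth u (u :: p) j :: drop j p).
  by rewrite cat_path q1 li; apply/andP; split => //; apply/andP.
have := pmin _ q3; rewrite last_cat [last _ (_ :: _)]/=.
have -> : last (nth u (u :: p) j) (drop j p) = v.
  by rewrite -pl -[in RHS](cat_take_drop j p) last_cat lj.
move=> /(_ erefl); rewrite size_cat /= size_drop size_takel; last by rewrite (leq_trans (ltnW ij)).
move: ij jp n1; clear; lia.
Qed.

End InducedCycle.

(** The two inequalities say that [m] and [m'] differ by at most [q - 2]. Hence
    [2 * (m ^ 2 + m' ^ 2)] is at most [(n - 2) ^ 2 + (q - 2) ^ 2]. *)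
Lemma balanced_arith n q m m' s : m + m' + 2 = n -> n <= 2 * m + q -> n <= 2 * m' + q ->
  4 * s <= 4 + (m ^ 2 + 4 * m) + (m' ^ 2 + 4 * m') ->
  8 * s + 4 * q <= n ^ 2 + 4 * n + q ^ 2 + 4.
Proof.
wlog mm : m m' / m' <= m.
  move=> h; have [l|/ltnW l] := leqP m' m; first exact: h.
  by move=> h1 h2 h3 h4; apply: (h m' m) => //; lia.
move=> nE h1 h2 hs.
have [d dE] : exists d, m = m' + d by exists (m - m'); lia.
have [f fE] : exists f, q = d + 2 + f by exists (q - d - 2); lia.
subst m q n; move: hs; rewrite !expnS !expn0 !muln1; clear; lia.
Qed.

(** * Heavy and light sides, and the bound *)

Section Final.
Context {G : sgraph} (h2 : two_connected G).
Implicit Types (u v w x y d : G) (S D : {set G}) (p r c : seq G).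

Context (nt : forall x p1 y p2 r, p1 != [::] -> p2 != [::] -> r != [::] ->
  ucycle adj (x :: p1 ++ y :: p2) -> path adj x (rcons r y) -> uniq r ->
  (forall w, w \in r -> w \notin x :: p1 ++ y :: p2) -> False).

(** Attachments of a bridge are pairwise consecutive on the cycle. If no cycle edge contained them
    all, there would be three, each the successor of another; then the cycle is a triangle with a
    bridge attached to all its vertices, which forces order 4. *)
Lemma bridge_side c w : ucycle adj c -> 2 < size c -> w \notin c -> #|G| != 4 ->
  exists2 a, a \in c & is_side a (next c a) (bridge c w).
Proof.
move=> uc sz wc n4; have /andP[cy u] := uc.
pose att b := [exists d in bridge c w, adj d b].
have attP b : att b -> exists2 d, d \in bridge c w & adj d b by move=> /exists_inP.
have nx x : x \in c -> adj x (next c x) by move=> xc; exact: next_cycle.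
have ninj a b : next c a = next c b -> a = b.
  by move=> /(congr1 (prev c)); rewrite !prev_next.
have consec a b : a \in c -> b \in c -> a != b -> att a -> att b ->
    b = next c a \/ a = next c b.
  move=> ac bc ab /attP[d1 d1b da] /attP[d2 d2b db].
  by apply: (attach_consecutive nt uc ac bc ab d1b d2b) => //; rewrite adj_sym.
have notin x : x \in c -> x \notin bridge c w by move=> xc; rewrite inE xc.
have [/exists_inP[a ac /forall_inP ha]|no] :=
    boolP [exists a in c, [forall b in c, att b ==> (b == a) || (b == next c a)]].
  exists a => //; split; [exact: notin|by apply: notin; rewrite mem_next|].
  move=> x y xD xy; have [yc|yc] := boolP (y \in c); last first.
    by constructor 1; exact: bridge_closed xD xy yc.
  have ay : att y by apply/exists_inP; exists x.
  have := ha y yc; rewrite ay /= => /orP[/eqP->|/eqP->]; by [constructor 2|constructor 3].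
have third a : a \in c -> exists b, [/\ b \in c, att b, b != a & b != next c a].
  move=> ac; move: no; rewrite negb_exists_in => /forall_inP/(_ a ac).
  rewrite negb_forall_in => /exists_inP[b bc].
  by rewrite negb_imply negb_or => /and3P[h1 h3 h4]; exists b.
exfalso.
have [a0 a0c] : exists a0, a0 \in c.
  by case: (c) sz => // a0 s _; exists a0; rewrite inE eqxx.
have [b1 [b1c t1 _ _]] := third a0 a0c.
have [b2 [b2c t2 b21 b2n]] := third b1 b1c.
have e1 : b1 = next c b2.
  have [] := consec b1 b2 b1c b2c _ t1 t2 => //; first by rewrite eq_sym.
  by move=> e; rewrite e eqxx in b2n.
have [b3 [b3c t3 b32 b3n]] := third b2 b2c.
have e2 : b2 = next c b3.
  have [] := consec b2 b3 b2c b3c _ t2 t3 => //; first by rewrite eq_sym.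
  by move=> e; rewrite e eqxx in b3n.
have b31 : b3 != b1 by rewrite e1.
have e3 : b3 = next c b1.
  have [] := consec b1 b3 b1c b3c _ t1 t3 => //; first by rewrite eq_sym.
  by rewrite -e2 => e; move: b21; rewrite e eqxx.
have cE : c =i [:: b1; b3; b2].
  have [i s E] := rot_to b1c.
  have us : uniq (b1 :: s) by rewrite -E rot_uniq.
  have nE x : next c x = next (b1 :: s) x by rewrite -E next_rot.
  move: e1 e2 e3; rewrite !nE => e1 e2 e3.
  have : size (b1 :: s) = size c by rewrite -E size_rot.
  case: s E us nE e1 e2 e3 => [|x1 [|x2 s]] E us nE e1 e2 e3 sE.
  - by move: sz; rewrite -sE.
  - by move: sz; rewrite -sE.
  have x1E : x1 = b3 by rewrite e3 /= eqxx.
  have x2E : x2 = b2.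
    move: us => /= /andP[]; rewrite inE negb_or => /andP[n1 _] _.
    by rewrite e2 -x1E /= eq_sym (negbTE n1) eqxx.
  subst x1 x2.
  case: s E us nE e1 e2 e3 sE => [|x3 s] E us nE e1 e2 e3 sE.
    by move=> t; rewrite -(mem_rot i) E.
  exfalso; move: us e1 => /= /and4P[]; rewrite !inE !negb_or => /and4P[n1 n2 n3 _] /andP[n4' _] _ _.
  rewrite (eq_sym b2 b1) (negbTE n2) (eq_sym b2 b3) (negbTE n4') eqxx => e.
  by rewrite e eqxx in n3.
have [d1 d1b a1] := attP b1 t1; have [d2 d2b a2] := attP b2 t2.
have [d3 d3b a3] := attP b3 t3.
have br := bridge_eq w cE; rewrite br in d1b d2b d3b.
have A13 : adj b1 b3 by rewrite e3 nx.
have A32 : adj b3 b2 by rewrite e2 nx.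
have A21 : adj b2 b1 by rewrite e1 nx.
move: n4; rewrite (triangle_bridge h2 nt A13 A32 A21 d1b d3b d2b) ?eqxx// adj_sym//.
Qed.

Lemma side_compl u v S : is_side u v S -> is_side u v (~: (u |: (v |: S))).
Proof.
move=> [uS vS sd]; split; rewrite ?inE ?eqxx ?orbT//= => w y.
rewrite !inE !negb_or => /and3P[wu wv wS] wy.
have [->|yu] := eqVneq y u; first by constructor 2.
have [->|yv] := eqVneq y v; first by constructor 3.
constructor 1; rewrite /=; apply: contraNN wS => yS.
case: (sd y w yS) => [|//|e|e]; first by rewrite adj_sym.
  by rewrite e eqxx in wu.
by rewrite e eqxx in wv.
Qed.

(** The constant 4 pays for [u], at distance at most 1 from [v]. *)
Lemma two_sides u v S : adj u v -> is_side u v S ->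
  let S' := ~: (u |: (v |: S)) in #|S| + #|S'| + 2 = #|G| /\
  4 * \sum_(w : G) dist v w <= 4 + (#|S| ^ 2 + 4 * #|S|) + (#|S'| ^ 2 + 4 * #|S'|).
Proof.
move=> uv sd S'; have [uS vS _] := sd; have cG : connected_graph G by have [] := h2.
have nuv := adj_neq uv.
have lip : edge_lipschitz (dist v) by move=> x y; exact: dist_lipschitz.
have du : dist v u <= 1 by rewrite dist_adj// adj_sym.
have s1 := side_sum1 h2 uv sd lip (distxx v) du.
have s2 := side_sum1 h2 uv (side_compl sd) lip (distxx v) du.
split.
  have := cardsC (u |: (v |: S)); rewrite !cardsU1 !inE negb_or nuv uS vS /= -/S'; lia.
rewrite (bigID (fun w => w \in S')) /= addnC.
have -> : \sum_(w | w \notin S') dist v w = dist v u + (dist v v + \sum_(w in S) dist v w).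
  rewrite -big_setU1//= -big_setU1/=; last by rewrite !inE negb_or nuv uS.
  by apply: eq_bigl => w; rewrite inE negbK.
rewrite distxx; move: s1 s2 du; clear; rewrite -/S'.
set a := \sum_(w in S) _; set b := \sum_(w in S') _; lia.
Qed.

(* Call a side of an edge heavy when the vertices not in it number at most
   [#|S| + q]. For an edge [uv] with a heavy side [S] of least size, either the
   other side is heavy too and [v] is central enough, or a shortest cycle closing
   [uv] through [S] has only light bridges and one averages over its vertices. *)
Theorem proximity_bound q :
  (forall c, ucycle adj c -> 2 < size c -> chordless c -> size c <= q) ->
  exists v : G, 8 * \sum_(w : G) dist v w + 4 * q <= #|G| ^ 2 + 4 * #|G| + q ^ 2 + 4.
Proof.
move=> short; have [cG n3 _] := h2.
have [u0 [v0 uv0]] : exists u v, adj u v.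
  have /card_gt0P[x _] : 0 < #|G| by apply: leq_trans n3.
  have : 1 < #|[set~ x]%SET| by move: n3; rewrite cardsC1; clear; lia.
  move=> /card_gt1P[y [z [yx zx yz]]]; rewrite !inE in yx zx.
  have [||||a [b [_ _ _ ab]]] := @cut_neighbour G h2 [set x]%SET z x y.
  - by rewrite inE.
  - by rewrite eq_sym.
  - by rewrite inE.
  - exact: yz.
  by exists a, b.
have side0 : is_side u0 v0 finset.set0 by split; rewrite ?inE// => w y; rewrite inE.
(* In order 4 an edge has the empty side and its complement of size 2, so the distance sum is at
   most 4, and [4 * q <= q ^ 2 + 4] suffices. *)
have [n4|n4] := eqVneq #|G| 4.
  have [cE sE] := two_sides uv0 side0; exists v0; move: cE sE; rewrite cards0 n4.
  set m := #|_| => cE; have -> : m = 2 by move: cE; clear; lia.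
  set s := \sum_(w : G) _ => hs.
  have q2 := (nat_Cauchy q 2).1.
  by move: hs q2; rewrite !expnS !expn0; clear; lia.
have sideT := side_compl side0.
have [w0 w0T] : exists w, w \in ~: (u0 |: (v0 |: finset.set0)).
  have [+ _] := two_sides uv0 side0; rewrite cards0 add0n.
  move=> e; apply/card_gt0P; move: e n3; clear; lia.
have q3 : 2 < q.
  have [p [uc _ sp _ ch]] := induced_cycle h2 uv0 sideT w0T.
  have sz : 2 < size (u0 :: p) by [].
  by apply: leq_trans (short _ uc sz ch).
pose heavy k := `[< exists u v S, [/\ adj u v, is_side u v S, #|G| <= 2 * #|S| + q & #|S| = k] >].
(* The vertices other than [u0] and [v0] form a heavy side, because [n <= 2 * (n - 2) + q] when [n]
   and [q] are at least 3. *)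
have exH : exists k, heavy k.
  exists #|~: (u0 |: (v0 |: finset.set0))|; apply/asboolP; exists u0, v0, (~: (u0 |: (v0 |: finset.set0))); split => //.
  have [+ _] := two_sides uv0 side0; rewrite cards0 add0n; move: n3 q3; clear; lia.
have [m /asboolP[u [v [S [uv sd hS Sm]]]] mmin] := ex_minnP exH.
have [cE sE] := two_sides uv sd; set S' := ~: _ in cE sE.
have [hS'|hS'] := leqP #|G| (2 * #|S'| + q).
  by exists v; apply: (balanced_arith cE hS hS' sE).
have [w wS] : exists w, w \in S.
  by apply/card_gt0P; move: cE hS' n3 q3; clear; lia.
have [p [uc pl sp inS ch]] := induced_cycle h2 uv sd wS.
have sz : 2 < size (u :: p) by [].
have uc' : u \in u :: p by rewrite inE eqxx.
have vc' : v \in u :: p by rewrite -pl mem_last.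
have [uS vS sdc] := sd.
(* A bridge contained in [S] misses this vertex [x] of the cycle, so it is smaller than [S] and by
   minimality not heavy. *)
have [x xc xS] : exists2 x, x \in u :: p & x \in S.
  case: p sp uc pl inS {ch sz uc' vc'} => [|a [|b p]] //= _ uc pl inS.
  exists a; first by rewrite !inE eqxx orbT.
  have [|//|e|e] := inS a; first by rewrite !inE eqxx orbT.
    by move: uc; rewrite /ucycle e /= inE eqxx /= andbF.
  have vbp : v \in b :: p by rewrite -pl mem_last.
  by case/andP: uc => _; rewrite e !cons_uniq vbp !andbF.
apply: (bridge_partition_average h2 uc sz (short _ uc sz ch)) => t tc.
have [a ac sda] := bridge_side uc sz tc n4; exists a => //; split => //.
(* Since [u] and [v] are on the cycle, a bridge cannot pass from one side of [uv] to the other.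
   Bridges in [S'] are light because [S'] is. *)
have sub A : is_side u v A -> t \in A -> bridge (u :: p) t \subset A.
  move=> [_ _ sA] tA; apply/fintype.subsetP => y; rewrite inE => /andP[yc ty].
  apply: contraT => yA; have [b [d [bA dA]]] := connect_leaves ty tA yA.
  rewrite {1}/off_cycle /= => /and3P[_ dc bd] _.
  by case: (sA b d bA bd) => e; [rewrite e in dA|rewrite e uc' in dc|rewrite e vc' in dc].
have [tS|tS] := boolP (t \in S).
  rewrite ltnNge; apply/negP => h.
  have : heavy #|bridge (u :: p) t|.
    apply/asboolP; exists a, (next (u :: p) a), (bridge (u :: p) t); split => //.
    by apply: next_cycle => //; case/andP: uc.
  move=> /mmin; rewrite -Sm; apply/negP; rewrite -ltnNge.
  apply: proper_card; rewrite properE sub//=; apply/fintype.subsetPn; exists x => //.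
  by rewrite inE xc.
have tS' : t \in S'.
  rewrite !inE !negb_or tS andbT; apply/andP; split.
    by apply: contraNneq tc => ->.
  by apply: contraNneq tc => ->.
have := subset_leq_card (sub _ (side_compl sd) tS'); move: hS'; rewrite -/S'; clear; lia.
Qed.

End Final.

End Combinatorics.

Unset Implicit Arguments.
Set Printing Implicit Defensive.

Theorem theorem3p7 (R : realType) (G : sgraph) (E : plane_embedding R G)
    (n q : nat) (hn : #|G| = n) (h2 : two_connected G) (hE : outerplane E)
    (hq : forall F l, internal_face E F -> face_length E F l -> (l <= q)%N) :
  proximity R G <=
    (n%:R + 5) / 8 + (q%:R ^+ 2 - 4 * q%:R + 9) / (8 * (n%:R - 1)).
Proof.
have short (c : seq G) : ucycle adj c -> (2 < size c)%N -> chordless c -> (size c <= q)%N.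
  move=> uc sz ch; have [F iF bF] := chordless_face hE uc sz ch.
  by apply: (hq F) => //; exists c.
have [v hv] := proximity_bound h2 (no_theta hE) short.
have n2 : (2 < n)%N by rewrite -hn; case: h2.
have N0 : 0 < n%:R - 1 :> R by rewrite subr_gt0 ltr1n; exact: ltnW.
have le_v : proximity R G <= avg_dist R v.
  (* The infimum of a set of reals is a lower bound once the set is bounded below, here by 0. *)
  apply: ge_inf; last by exists v.
  by exists 0 => _ [u _ <-]; rewrite /avg_dist divr_ge0// hn ltW.
apply: le_trans le_v _; rewrite /avg_dist hn ler_pdivrMr//.
have -> : ((n%:R + 5) / 8 + (q%:R ^+ 2 - 4 * q%:R + 9) / (8 * (n%:R - 1))) * (n%:R - 1) =
    (n%:R ^+ 2 + 4 * n%:R + q%:R ^+ 2 + 4 - 4 * q%:R) / 8 :> R.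
  by field; rewrite gt_eqF.
(* The term [4 * q] moves to the left, where [hv] has it because subtraction of natural numbers
   truncates. *)
rewrite ler_pdivlMr// lerBrDr.
have : ((8 * \sum_(w : G) dist v w + 4 * q)%N%:R <= (n ^ 2 + 4 * n + q ^ 2 + 4)%N%:R :> R).
  by rewrite ler_nat -hn.
move: (\sum_(w : G) dist v w)%N => s.
rewrite (natrD _ (8 * s)) (natrM _ 8) (natrM _ 4 q) (natrD _ (n ^ 2 + 4 * n + q ^ 2)%N).
rewrite (natrD _ (n ^ 2 + 4 * n)%N) (natrD _ (n ^ 2)%N) (natrM _ 4 n) (natrX _ n) (natrX _ q).
by rewrite mulrC.
Qed.
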